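(* Let $\Omega=(a,b)$ be a bounded interval and $s\in(0,1)$. For any measurable $w:\Omega\to[0,\infty)$ and any non-negative $v\in H^{2s+1}(\Omega)$, one has $$\int_\Omega\frac{v^2(x)}{w(x)}\,dx\int_\Omega w(x)\,|\partial_x(-\Delta)^sv|^2\,dx\ge\frac1{4|\Omega|^2}\left(\int_\Omega|(-\Delta)^{\frac s2}v|^2\,dx\right)^2.$$
   Context: Let $\{\lambda_k,\varphi_k\}_{k\ge0}$ be the eigenvalues and $L^2(\Omega)$-normalized eigenfunctions of $-\Delta$ on $\Omega$ with Neumann boundary conditions. For $r\ge0$, $H^r_N(\Omega)=\{u=\sum_kc_k\varphi_k:\sum_kc_k^2(1+\lambda_k^r)<\infty\}$; it coincides with $H^r(\Omega)$ for $r\in(0,3/2)$ and with $\{u\in H^r(\Omega):\partial_xu=0\text{ on }\partial\Omega\}$ for $r\in(3/2,7/2)$. The fractional Laplacian is the spectral Neumann one: $(-\Delta)^{\sigma}\left(\sum_kc_k\varphi_k\right)=\sum_kc_k\lambda_k^{\sigma}\varphi_k$. The convention $\frac10=+\infty$ is used. *)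

(* Defs.v *)
From HB Require Import structures.
From mathcomp Require Import all_boot all_order all_algebra.
From mathcomp Require Import all_classical all_reals all_analysis.
Import Order.TTheory GRing.Theory Num.Theory.
Import numFieldNormedType.Exports.

Set Implicit Arguments.
Unset Strict Implicit.
Unset Printing Implicit Defensive.

Local Open Scope classical_set_scope.
Local Open Scope ring_scope.

(* Functions on Omega = ]a, b[ are maps R -> R whose values outside ]a, b[ are
   irrelevant; functions in Lebesgue and Sobolev spaces are representatives of
   their almost-everywhere classes. *)
Section FunctionsOnInterval.
Variables (R : realType) (a b : R).
Local Notation mu := (@lebesgue_measure R).
Local Notation Omega := `]a, b[%classic.

Definition L2 (f : R -> R) : Prop :=
  measurable_fun Omega f /\
  mu.-integrable Omega (fun x => (f x ^+ 2)%:E).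

Definition inner (f g : R -> R) : R := \int[mu]_(x in Omega) (f x * g x).

Definition test_function (psi : R -> R) : Prop :=
  (forall n x, derivable (derive1n n psi) x 1) /\
  exists c d : R, [/\ a < c, d < b & forall x, x \notin `[c, d] -> psi x = 0].

Definition weak_derivative (f g : R -> R) : Prop :=
  [/\ locally_integrable Omega f, locally_integrable Omega g &
      forall psi, test_function psi -> inner f (derive1 psi) = - inner g psi].

(* The Sobolev-Slobodeckij space H^r(Omega), r >= 0, with r = m + theta,
   m natural and 0 <= theta < 1; D k is the k-th weak derivative of v.  The
   Gagliardo integrand takes the value 0 on the null diagonal x = y. *)
Definition Sobolev (r : R) (v : R -> R) : Prop :=
  let m := Num.truncn r in
  let theta := r - m%:R in
  exists D : nat -> R -> R,
  [/\ D 0%N = v,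
      forall k, (k <= m)%N -> L2 (D k),
      forall k, (k < m)%N -> weak_derivative (D k) (D k.+1) &
      0 < theta ->
      (\int[mu]_(x in Omega) \int[mu]_(y in Omega)
         (`|D m x - D m y| ^+ 2 / `|x - y| `^ (1 + 2 * theta))%:E < +oo)%E].

(* The Neumann condition is stated with one-sided limits of phi', phi being
   arbitrary outside Omega. *)
Definition Neumann_eigenpair (l : R) (phi : R -> R) : Prop :=
  [/\ forall x, x \in `]a, b[ ->
        [/\ derivable phi x 1, derivable (derive1 phi) x 1 &
            - derive1n 2 phi x = l * phi x],
      derive1 phi x @[x --> a^'+] --> (0 : R) &
      derive1 phi x @[x --> b^'-] --> (0 : R)].

(* (lambda k, phi k), k >= 0, lists the eigenpairs of - Delta with Neumann
   conditions: an orthonormal family of eigenfunctions, total in L^2(Omega). *)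
Definition Neumann_eigensystem (lambda : nat -> R) (phi : nat -> R -> R) :
    Prop :=
  [/\ forall k, Neumann_eigenpair (lambda k) (phi k),
      forall k, L2 (phi k),
      forall j k, inner (phi j) (phi k) = (j == k)%:R &
      forall f, L2 f -> (forall k, inner f (phi k) = 0) ->
        {ae mu, forall x, x \in `]a, b[ -> f x = 0}].

(* p = (- Delta)^sigma v: if v = \sum_k c_k phi_k with c_k = inner v (phi k),
   then p is the function with expansion \sum_k c_k lambda_k^sigma phi_k.  The
   function p is only required to be integrable: when v is in H^(2s+1) but
   does not satisfy the Neumann condition and s >= 3/4, (- Delta)^s v behaves
   like dist^(1 - 2s) at the boundary and need not be in L^2. *)
Definition fractional_Laplacian (lambda : nat -> R) (phi : nat -> R -> R)
    (sigma : R) (v p : R -> R) : Prop :=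
  mu.-integrable Omega (EFin \o p) /\
  forall k, inner p (phi k) = inner v (phi k) * lambda k `^ sigma.

End FunctionsOnInterval.

(* Product of two nonnegative extended reals where +oo absorbs everything,
   0 included; [mule] has 0 * +oo = 0 instead. *)
Definition mul_absorbing (R : realType) (x y : \bar R) : \bar R :=
  if (x == +oo%E) || (y == +oo%E) then +oo%E else (x * y)%E.

(* Main.v *)
(* Write L = b - a, p = (- Delta)^s v, u = (- Delta)^(s/2) v and, for t > 0,
   p_t = v - om_t, where om_t solves om_t'' = t (om_t - v) with Neumann conditions;
   p is a multiple of \int_0^oo t^(s-1) p_t dt.  The function
   F_t = - p_t^2 / 2 + om_t'^2 / (2 t) satisfies F_t' = - v' p_t, and the bounds
   om_t +- om_t' / sqrt t >= min v give F_t <= 0 at every minimum point c of v.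
   Combined with the energy identity \int v p_t = \int p_t^2 + \int om_t'^2 / t and
   integrated in t, this yields, for H' = v' p and G = v p - H,
       (1/2) \int u^2 = (1/2) \int v p <= \int (G + H(c)),
   where G' = v p'.  Let M = \int v |p'| and suppose 2 L M < \int u^2.  Then
   G + H(c) is bounded below by a positive constant on ]a, b[.  Taking for c a
   minimum point of v at which H is smallest, v p = G + H is bounded below by a
   positive constant where v is close to min v; this contradicts
   \int p beta(v) <= 0, which holds for nonincreasing beta.  So
   \int u^2 <= 2 L M, and the Cauchy-Schwarz inequality bounds M^2. *)
Require Import Defs.
From mathcomp Require Import all_boot all_order all_algebra.
From mathcomp Require Import all_classical all_reals all_analysis.
From mathcomp Require Import measurable_realfun ring lra.
Import Order.TTheory GRing.Theory Num.Theory.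
Import numFieldNormedType.Exports.

Set Implicit Arguments.
Unset Strict Implicit.
Unset Printing Implicit Defensive.

Local Open Scope classical_set_scope.
Local Open Scope ring_scope.

(** * Integration on the line and absolutely continuous functions *)

Section Integrals.
Context {R : realType}.
Local Notation mu := (@lebesgue_measure R).
Implicit Types (f g F G : R -> R) (x y z : R) (D : set (measurableTypeR R)).

(** Resolvents bring pointwise arguments to a nonlocal operator: each [om_t] solves a local second
    order equation with a maximum principle. The inequalities obtained at fixed t are linear in p_t,
    with coefficients depending on v alone, so they survive integration against the positive weight
    t^(s-1).

    The obstacle is regularity. As v need not satisfy the Neumann condition, p is merely integrable:
    it is identified with the integral of the p_t through cosine coefficients of L^1 functions, and
    v' p is handled by Fubini with the unbounded weight 1 + |v'|. Convergence at t = +oo has two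
    sources: for s < 1/2, v' in L^2 gives decay t^(-1/2); for s >= 1/2, v'' integrable gives decay
    1/t in L^1.

    The minimum point c needs the least H because v p = (G + H(c)) - (H(c) - H), and the last
    bracket must be small wherever v is close to its minimum, not only near c. The factor 4 L^2 is
    the square of 2 L, whose 2 comes from the 1/2 in front of the energy. *)

Lemma ae_impl (P Q : R -> Prop) : (forall x, P x -> Q x) ->
  {ae mu, forall x, P x} -> {ae mu, forall x, Q x}.
Proof. by move=> PQ; apply: filterS; first exact: (ae_filter_ringOfSetsType mu). Qed.

Lemma ae_impl2 (P Q S : R -> Prop) : (forall x, P x -> Q x -> S x) ->
  {ae mu, forall x, P x} -> {ae mu, forall x, Q x} -> {ae mu, forall x, S x}.
Proof.
by move=> PQ; apply: filterS2; first exact: (ae_filter_ringOfSetsType mu).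
Qed.

Lemma continuous_integrable f x y :
  continuous f -> mu.-integrable `[x, y] (EFin \o f).
Proof.
move=> cf; apply: continuous_compact_integrable; first exact: segment_compact.
exact: continuous_subspaceT.
Qed.

Lemma integrable_continuousM f g x y : continuous g ->
  mu.-integrable `[x, y] (EFin \o f) ->
  mu.-integrable `[x, y] (EFin \o (fun t => f t * g t)).
Proof.
move=> cg fi; have := @integrableMl _ _ _ mu `[x, y] (measurable_itv _) _ g fi.
apply.
  by apply: measurable_funTS; exact: continuous_measurable_fun.
have /compact_bounded[M [_ mrt]] :=
  continuous_compact (continuous_subspaceT cg) (@segment_compact _ x y).
by exists M; split; rewrite ?num_real // => ? ? ? ?; exact: mrt.
Qed.

Lemma integrableRD D f g : measurable D -> mu.-integrable D (EFin \o f) ->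
  mu.-integrable D (EFin \o g) ->
  mu.-integrable D (EFin \o (fun t => f t + g t)).
Proof. by move=> mD fi gi; exact: (integrableD mD fi gi). Qed.

Lemma integrableRB D f g : measurable D -> mu.-integrable D (EFin \o f) ->
  mu.-integrable D (EFin \o g) ->
  mu.-integrable D (EFin \o (fun t => f t - g t)).
Proof. by move=> mD fi gi; exact: (integrableB mD fi gi). Qed.

Lemma integrableRZ D f (k : R) : measurable D -> mu.-integrable D (EFin \o f) ->
  mu.-integrable D (EFin \o (fun t => k * f t)).
Proof. by move=> mD fi; exact: (integrableZl mD k fi). Qed.

Lemma ae_eq_Rintegral D f g : measurable D ->
  measurable_fun D f -> measurable_fun D g ->
  {ae mu, forall x, D x -> f x = g x} ->
  \int[mu]_(x in D) f x = \int[mu]_(x in D) g x.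
Proof.
move=> mD mf mg fg; congr fine; apply: ae_eq_integral => //.
- exact/measurable_EFinP.
- exact/measurable_EFinP.
- by apply: ae_impl fg => x /= h Dx; rewrite h.
Qed.

Lemma ae_eq_integrable D f g : measurable D -> measurable_fun D g ->
  {ae mu, forall x, D x -> f x = g x} ->
  mu.-integrable D (EFin \o f) -> mu.-integrable D (EFin \o g).
Proof.
move=> mD mg fg /integrableP[mf fi]; apply/integrableP; split.
  exact/measurable_EFinP.
apply: le_lt_trans fi; rewrite le_eqVlt; apply/orP; left; apply/eqP.
apply: ae_eq_integral => //.
- by apply: measurableT_comp => //; exact/measurable_EFinP.
- by apply: measurableT_comp => //.
- by apply: ae_impl fg => x /= h Dx; rewrite h.
Qed.

Lemma integrable_measurable D f : mu.-integrable D (EFin \o f) -> measurable_fun D f.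
Proof. by move=> fi; apply/measurable_EFinP; exact: (measurable_int mu fi). Qed.

Lemma integrable_itv_oo f x y :
  mu.-integrable `[x, y] (EFin \o f) -> mu.-integrable `]x, y[ (EFin \o f).
Proof. by apply: integrableS => //; exact: subset_itv_oo_cc. Qed.

Lemma integrable_patch D f : measurable D -> mu.-integrable D (EFin \o f) ->
  mu.-integrable setT (EFin \o (f \_ D)).
Proof.
by move=> mD fi; rewrite -restrict_EFin; apply/integrable_restrict => //; rewrite setTI.
Qed.

(** [Rintegral] is [fine] of the extended integral, so the real and the extended inner integrals
    agree only where the section is integrable. That is almost everywhere, which is enough for the
    outer integral. *)
Lemma fubini_real (phi : measurableTypeR R * measurableTypeR R -> R) : measurable_fun setT phi ->
  (\int[mu]_x \int[mu]_y `|phi (x, y)|%:E < +oo)%E ->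
  [/\ mu.-integrable setT (EFin \o (fun x => \int[mu]_y phi (x, y))),
      {ae mu, forall x, mu.-integrable setT (EFin \o (fun y => phi (x, y)))} &
   \int[mu]_x (\int[mu]_y phi (x, y)) = \int[mu]_y (\int[mu]_x phi (x, y))].
Proof.
move=> mphi fin.
have mphiE : measurable_fun setT (EFin \o phi) by exact/measurable_EFinP.
have iphi : (mu \x mu)%E.-integrable setT (EFin \o phi).
  by apply/(@integrable12ltyP _ _ _ _ _ mu mu _ mphiE).
have ae1 := ae_integrable1 iphi; have ae2 := ae_integrable2 iphi.
have e1 : ae_eq mu setT (EFin \o (fun x => \int[mu]_y phi (x, y)))
    (fun x => \int[mu]_y (phi (x, y))%:E)%E.
  apply: ae_impl ae1 => x /= ix _; rewrite /Rintegral fineK//.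
  exact: integrable_fin_num.
have e2 : ae_eq mu setT (EFin \o (fun y => \int[mu]_x phi (x, y)))
    (fun y => \int[mu]_x (phi (x, y))%:E)%E.
  apply: ae_impl ae2 => x /= ix _; rewrite /Rintegral fineK//.
  exact: integrable_fin_num.
have mF : measurable_fun [set: measurableTypeR R] (fun x => \int[mu]_y (phi (x, y))%:E)%E.
  exact: (measurable_fubini_F iphi).
have mG : measurable_fun [set: measurableTypeR R] (fun y => \int[mu]_x (phi (x, y))%:E)%E.
  exact: (measurable_fubini_G iphi).
have mF' : measurable_fun [set: measurableTypeR R] (EFin \o (fun x => \int[mu]_y phi (x, y))).
  by apply/measurable_EFinP; exact: measurableT_comp.
have mG' : measurable_fun [set: measurableTypeR R] (EFin \o (fun y => \int[mu]_x phi (x, y))).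
  by apply/measurable_EFinP; exact: measurableT_comp.
split.
- apply/integrableP; split => //.
  have /integrableP[_] := integrable_fubini_F iphi; apply: le_lt_trans.
  rewrite le_eqVlt; apply/orP; left; apply/eqP; apply: ae_eq_integral => //.
  + exact: measurableT_comp.
  + exact: measurableT_comp.
  + by apply: ae_impl e1 => x /= h xT; exact: (congr1 abse (h xT)).
- exact: ae1.
- rewrite {1}/Rintegral {2}/Rintegral; congr fine.
  rewrite (@ae_eq_integral _ _ _ mu _ _ _ measurableT mF' mF e1).
  rewrite (@ae_eq_integral _ _ _ mu _ _ _ measurableT mG' mG e2).
  exact: (Fubini iphi).
Qed.

Lemma fubini_real_swap (phi : measurableTypeR R * measurableTypeR R -> R) :
  measurable_fun setT phi ->
  (\int[mu]_x \int[mu]_y `|phi (x, y)|%:E < +oo)%E ->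
  mu.-integrable setT (EFin \o (fun y => \int[mu]_x phi (x, y))) /\
  {ae mu, forall y, mu.-integrable setT (EFin \o (fun x => phi (x, y)))}.
Proof.
move=> mphi fin; pose psi (u : measurableTypeR R * measurableTypeR R) := phi (u.2, u.1).
have mpsi : measurable_fun setT psi.
  apply: (measurableT_comp mphi); apply/measurable_fun_pairP; split.
    exact: measurable_snd.
  exact: measurable_fst.
suff /(fubini_real mpsi)[h1 h2 _] :
  (\int[mu]_y \int[mu]_x `|psi (y, x)|%:E < +oo)%E by split.
have := @fubini_tonelli _ _ _ _ R mu mu (fun u => `|phi u|%:E).
move=> <-//.
by apply/measurable_EFinP; exact: measurableT_comp.
Qed.

(** No measurability is asked: the integral of a nonnegative function is a supremum over the simple
    functions below it. Bounds on iterated integrals then need no measurability of the inner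
    ones. *)
Lemma ge0_le_integral_nm D (f1 f2 : measurableTypeR R -> \bar R) :
  (forall x, D x -> 0 <= f1 x)%E -> (forall x, D x -> f1 x <= f2 x)%E ->
  (\int[mu]_(x in D) f1 x <= \int[mu]_(x in D) f2 x)%E.
Proof.
move=> f10 f12; have f20 x : D x -> (0 <= f2 x)%E.
  by move=> Dx; rewrite (le_trans (f10 _ Dx))// f12.
rewrite !ge0_integralE//; apply: le_ereal_sup => _ [h hf <-].
exists h => // x; apply: le_trans (hf x) _.
by rewrite !patchE; case: ifPn => // /set_mem; exact: f12.
Qed.

Lemma integrable_prod_fin f g : mu.-integrable setT (EFin \o f) ->
  mu.-integrable setT (EFin \o g) ->
  (\int[mu]_x \int[mu]_y (`|f x| * `|g y|)%:E < +oo)%E.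
Proof.
move=> fi gi.
have mf : measurable_fun [set: measurableTypeR R] f.
  exact: integrable_measurable fi.
have mg : measurable_fun [set: measurableTypeR R] g.
  exact: integrable_measurable gi.
have /integrableP[_ fo] := fi; have /integrableP[_ go] := gi.
have g0 : (0 <= \int[mu]_y `|g y|%:E)%E.
  by apply: integral_ge0 => y _; rewrite lee_fin.
rewrite (_ : (fun x => _) =
  (fun x => `|f x|%:E * \int[mu]_y `|g y|%:E)%E); last first.
  apply/funext => x; under eq_integral do rewrite EFinM.
  rewrite ge0_integralZl//.
  by apply/measurable_EFinP; exact: measurableT_comp.
rewrite ge0_integralZr//; last first.
  by apply/measurable_EFinP; exact: measurableT_comp.
rewrite lte_mul_pinfty//; first by apply: integral_ge0 => x _; rewrite lee_fin.
rewrite ge0_fin_numE//; by apply: integral_ge0 => x _; rewrite lee_fin.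
Qed.

(* [F] is locally absolutely continuous with derivative [f] almost everywhere. *)
Definition primitive F f :=
  (forall x y, mu.-integrable `[x, y] (EFin \o f)) /\
  forall x y, x <= y -> F y - F x = \int[mu]_(t in `[x, y]) f t.

Lemma primitive_continuous F f : primitive F f -> continuous F.
Proof.
move=> [fi Ff] x.
have lt : x - 1 < x + 1 by lra.
have cI := parameterized_integral_continuous (ltW lt) (fi (x - 1) (x + 1)).
have xI : x \in `]x - 1, x + 1[ by rewrite in_itv/=; lra.
pose I t := \int[mu]_(r in `[x - 1, t]) f r.
have cIx : {for x, continuous I} := within_continuous_continuous lt cI xI.
have : {for x, continuous (fun t => F (x - 1) + I t)}.
  by apply: continuousD; [exact: cst_continuous|exact: cIx].
rewrite /prop_for /continuous_at.
have FI t : x - 1 <= t -> F t = F (x - 1) + I t.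
  by move=> xt; rewrite /I -Ff// subrKC.
rewrite -(FI x); last by lra.
apply: cvg_trans; apply: near_eq_cvg; near=> t; rewrite (FI t)//.
near: t; exists 1 => //= t /=; rewrite ltr_norml => /andP[h1 h2]; lra.
Unshelve. all: by end_near.
Qed.

Lemma FTC2_global F f x y : x <= y -> continuous f ->
  (forall t : R, is_derive t 1 F (f t)) -> \int[mu]_(t in `[x, y]) f t = F y - F x.
Proof.
rewrite le_eqVlt => /predU1P[<- _ _|xy cf dF].
  by rewrite set_itv1 Rintegral_set1 subrr.
have cF : continuous F.
  by move=> t; apply/differentiable_continuous/derivable1_diffP.
rewrite /Rintegral (@continuous_FTC2 _ f F x y xy) //.
- exact: continuous_subspaceT.
- by split => [t _| |] //; [exact: cvg_at_right_filter (cF x)|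
                            exact: cvg_at_left_filter (cF y)].
- by move=> t _; rewrite derive1E; exact: derive_val.
Qed.

Lemma is_derive_primitive F f : continuous f ->
  (forall t : R, is_derive t 1 F (f t)) -> primitive F f.
Proof.
move=> cf dF; split=> [x y|x y xy]; first exact: continuous_integrable.
by rewrite (FTC2_global xy cf dF).
Qed.

Lemma primitiveZ F f (k : R) : primitive F f ->
  primitive (fun t => k * F t) (fun t => k * f t).
Proof.
move=> [fi Ff]; split=> [x y|x y xy]; first exact: integrableRZ.
by rewrite RintegralZl// -Ff//; ring.
Qed.

Lemma primitiveB F f G g : primitive F f -> primitive G g ->
  primitive (fun t => F t - G t) (fun t => f t - g t).
Proof.
move=> [fi Ff] [gi Gg]; split=> [x y|x y xy]; first exact: integrableRB.
by rewrite RintegralB// -Ff// -Gg//; ring.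
Qed.

(** Integration by parts for absolutely continuous functions. The product f(t) g(r) is integrated
    over the triangle x <= r <= t <= y in both orders; each inner integral is an increment of [G] or
    of [F]. *)
Lemma primitiveM F f G g : primitive F f -> primitive G g ->
  primitive (fun t => F t * G t) (fun t => f t * G t + F t * g t).
Proof.
move=> pF pG; have cF := primitive_continuous pF.
have cG := primitive_continuous pG; move: pF pG => [fi Ff] [gi Gg].
have fGi x y : mu.-integrable `[x, y] (EFin \o (fun t => f t * G t)).
  exact: integrable_continuousM.
have Fgi x y : mu.-integrable `[x, y] (EFin \o (fun t => F t * g t)).
  have := integrable_continuousM cF (gi x y).
  by apply: eq_integrable => // t _ /=; rewrite mulrC.
split=> [x y|x y xy]; first exact: integrableRD.
rewrite RintegralD//.
pose A : measurableTypeR R -> R := f \_ `[x, y].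
pose B : measurableTypeR R -> R := g \_ `[x, y].
have Ai : mu.-integrable setT (EFin \o A).
  exact: integrable_patch.
have Bi : mu.-integrable setT (EFin \o B).
  exact: integrable_patch.
have mA : measurable_fun setT A.
  exact: integrable_measurable Ai.
have mB : measurable_fun setT B.
  exact: integrable_measurable Bi.
pose phi (z : measurableTypeR R * measurableTypeR R) : R :=
  if (z.2 : R) <= z.1 then A z.1 * B z.2 else 0.
have mphi : measurable_fun setT phi.
  apply: measurable_fun_ifT => //.
  - exact: measurable_fun_ler.
  - by apply: measurable_funM; exact: measurableT_comp.
have [|_ _] := fubini_real mphi.
  apply: le_lt_trans (integrable_prod_fin Ai Bi).
  apply: ge0_le_integral_nm => t _; first exact: integral_ge0.
  apply: ge0_le_integral_nm => r _; first by rewrite lee_fin.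
  rewrite lee_fin /phi /=; case: ifP => _; first by rewrite normrM.
  by rewrite normr0 mulr_ge0.
have e1 : \int[mu]_t (\int[mu]_r phi (t, r)) =
    \int[mu]_(t in `[x, y]) (f t * (G t - G x)).
  rewrite [RHS]Rintegral_mkcond; apply: eq_Rintegral => t _.
  rewrite patchE; case: ifPn => [|tN]; last first.
    rewrite -[RHS](Rintegral_set0 mu (cst 0)) [RHS]Rintegral_mkcond.
    apply: eq_Rintegral => r _; rewrite patchE in_set0 /phi /= /A patchE.
    by rewrite (negbTE tN) mul0r if_same.
  rewrite inE/= in_itv/= => /andP[xt ty].
  rewrite Gg// -RintegralZl//; rewrite [RHS]Rintegral_mkcond.
  apply: eq_Rintegral => r _; rewrite /phi /A /B /= !patchE.
  rewrite !mem_setE !in_itv/= xt ty/=.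
  by case: (leP x r) => xr; case: (leP r t) => rt; rewrite ?mulr0// (le_trans rt ty).
have e2 : \int[mu]_r (\int[mu]_t phi (t, r)) =
    \int[mu]_(r in `[x, y]) (g r * (F y - F r)).
  rewrite [RHS]Rintegral_mkcond; apply: eq_Rintegral => r _.
  rewrite patchE; case: ifPn => [|rN]; last first.
    rewrite -[RHS](Rintegral_set0 mu (cst 0)) [RHS]Rintegral_mkcond.
    apply: eq_Rintegral => t _; rewrite patchE in_set0 /phi /= /B patchE.
    by rewrite (negbTE rN) mulr0 if_same.
  rewrite inE/= in_itv/= => /andP[xr ry].
  rewrite Ff// -RintegralZl//; rewrite [RHS]Rintegral_mkcond.
  apply: eq_Rintegral => t _; rewrite /phi /A /B /= !patchE.
  rewrite !mem_setE !in_itv/= xr ry/=.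
  case: (leP r t) => rt //=; case: (leP t y) => ty; rewrite ?andbF ?mul0r//.
  by rewrite (le_trans xr rt)/= mulrC.
rewrite e1 e2.
under eq_Rintegral do rewrite mulrBr.
under [X in _ = X -> _]eq_Rintegral do rewrite mulrBr.
have fGx : mu.-integrable `[x, y] (EFin \o (fun t => f t * G x)).
  by apply: integrable_continuousM => //; exact: cst_continuous.
have gFy : mu.-integrable `[x, y] (EFin \o (fun t => g t * F y)).
  by apply: integrable_continuousM => //; exact: cst_continuous.
have gF : mu.-integrable `[x, y] (EFin \o (fun t => g t * F t)).
  exact: integrable_continuousM.
rewrite !RintegralB// !RintegralZr// -Ff// -Gg//.
have -> : \int[mu]_(t in `[x, y]) (g t * F t) =
          \int[mu]_(t in `[x, y]) (F t * g t).
  by apply: eq_Rintegral => t _; rewrite mulrC.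
lra.
Qed.

End Integrals.

(** * Derivatives and antiderivatives *)

Section Calculus.
Context {R : realType}.
Local Notation mu := (@lebesgue_measure R).
Implicit Types (f g F G : R -> R) (x y z : R).

Lemma derive_add F (f : R) G (g : R) x : is_derive x (1 : R) F f -> is_derive x (1 : R) G g ->
  is_derive x (1 : R) (fun t => F t + G t) (f + g).
Proof. by move=> dF dG; exact: is_deriveD. Qed.

Lemma derive_sub F (f : R) G (g : R) x : is_derive x (1 : R) F f -> is_derive x (1 : R) G g ->
  is_derive x (1 : R) (fun t => F t - G t) (f - g).
Proof. by move=> dF dG; exact: is_deriveB. Qed.

Lemma derive_mul F (f : R) G (g : R) x : is_derive x (1 : R) F f -> is_derive x (1 : R) G g ->
  is_derive x (1 : R) (fun t => F t * G t) (f * G x + F x * g).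
Proof.
move=> dF dG.
have -> : f * G x + F x * g = F x *: g + G x *: f.
  by rewrite /GRing.scale/=; ring.
exact: is_deriveM dF dG.
Qed.

Lemma derive_scale (k : R) F (f : R) x : is_derive x (1 : R) F f ->
  is_derive x (1 : R) (fun t => k * F t) (k * f).
Proof. by move=> dF; exact: is_deriveZ. Qed.

Lemma derive_affine (k c x : R) : is_derive x (1 : R) (fun t => k * (t - c)) k.
Proof.
have := derive_scale k (derive_sub (is_derive_id x (1 : R)) (is_derive_cst c x (1 : R))).
by rewrite subr0 mulr1.
Qed.

(** The value of the derivative is a separate variable tied by an equation, so that a goal of any
    shape is left to [ring] or [field]. *)
Lemma derive_compE F (f g h : R) G x : is_derive (G x) (1 : R) F g ->
  is_derive x (1 : R) G h -> f = g * h -> is_derive x (1 : R) (fun t => F (G t)) f.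
Proof.
move=> dF dG ->; exact: is_derive1_comp dF dG.
Qed.

Lemma derive_exp_affine (k c x : R) :
  is_derive x (1 : R) (fun t => expR (k * (t - c))) (k * expR (k * (x - c))).
Proof.
apply: (derive_compE (is_derive_expR _) (derive_affine k c x)).
by rewrite mulrC.
Qed.

Lemma derive_cos_affine (k c x : R) :
  is_derive x (1 : R) (fun t => cos (k * (t - c))) (- k * sin (k * (x - c))).
Proof.
apply: (derive_compE (is_derive_cos _) (derive_affine k c x)).
ring.
Qed.

Lemma derive_sin_affine (k c x : R) :
  is_derive x (1 : R) (fun t => sin (k * (t - c))) (k * cos (k * (x - c))).
Proof.
apply: (derive_compE (is_derive_sin _) (derive_affine k c x)).
ring.
Qed.

Lemma is_derive_continuous F f : (forall x : R, is_derive x (1 : R) F (f x)) ->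
  continuous F.
Proof. by move=> dF x; apply/differentiable_continuous/derivable1_diffP. Qed.

Lemma Rintegral_split f x y z : x <= y -> y <= z ->
  mu.-integrable `[x, z] (EFin \o f) ->
  \int[mu]_(t in `[x, z]) f t =
  \int[mu]_(t in `[x, y]) f t + \int[mu]_(t in `[y, z]) f t.
Proof.
move=> xy yz fi; have := Rintegral_itvB fi (_ : (BLeft x <= BRight y)%O) (_ : (BRight y <= BRight z)%O).
rewrite !bnd_simp => /(_ xy yz).
rewrite Rintegral_itv_obnd_cbnd; first by move=> <-; ring.
by apply: integrableS fi => //; apply: subset_itv; rewrite bnd_simp.
Qed.

Lemma Rintegral_itv_ge f x y : y <= x -> \int[mu]_(t in `[x, y]) f t = 0.
Proof.
rewrite le_eqVlt => /predU1P[->|yx]; first by rewrite set_itv1 Rintegral_set1.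
by rewrite set_itv_ge ?Rintegral_set0// bnd_simp -ltNge.
Qed.

Lemma primitive_exists f : (forall x y, mu.-integrable `[x, y] (EFin \o f)) ->
  exists F, primitive F f.
Proof.
move=> fi.
(* This is the oriented integral from 0: at least one of the two intervals is empty or a point. *)
exists (fun x => \int[mu]_(t in `[0, x]) f t - \int[mu]_(t in `[x, 0]) f t).
split=> // x y xy.
have [x0|x0] := leP 0 x.
  rewrite (Rintegral_itv_ge _ x0) (Rintegral_itv_ge _ (le_trans x0 xy)).
  by rewrite (Rintegral_split x0 xy)//; ring.
have {}x0 := ltW x0; have [y0|y0] := leP y 0.
  rewrite (Rintegral_itv_ge _ x0) (Rintegral_itv_ge _ y0).
  by rewrite (Rintegral_split xy y0)//; ring.
have {}y0 := ltW y0; rewrite (Rintegral_itv_ge _ x0) (Rintegral_itv_ge _ y0).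
by rewrite (Rintegral_split x0 y0)//; ring.
Qed.

Lemma primitive_is_derive F f x : primitive F f -> {for x, continuous f} ->
  is_derive x (1 : R) F (f x).
Proof.
move=> [fi Ff] cf.
pose I t := \int[mu]_(r in `[x - 1, t]) f r.
have [] // := @continuous_FTC1_closed _ f (x - 1) x (x + 1) _ (fi _ _) _ cf; try lra.
rewrite -/I => dI I'.
have dI' : is_derive x (1 : R) (fun t => F (x - 1) + I t) (f x).
  have := derive_add (is_derive_cst (F (x - 1)) x (1 : R)) (DeriveDef dI erefl).
  by rewrite -derive1E I' add0r.
have FI t : x - 1 <= t -> F t = F (x - 1) + I t.
  by move=> xt; rewrite /I -Ff// subrKC.
have near_eq : {near x, (fun t => F (x - 1) + I t) =1 F}.
  near=> t; rewrite (FI t)//.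
  near: t; exists 1 => //= t /=; rewrite ltr_norml => /andP[h1 h2]; lra.
exact: near_eq_is_derive near_eq dI'.
Unshelve. all: by end_near.
Qed.

Lemma antiderivative_exists f : continuous f ->
  exists F, forall x : R, is_derive x (1 : R) F (f x).
Proof.
move=> cf; have [x y|F pF] := @primitive_exists f; first exact: continuous_integrable.
by exists F => x; apply: primitive_is_derive => //; exact: cf.
Qed.

End Calculus.

(** * Continuity of algebraic expressions *)

Section Continuity.
Context {R : realType}.
Implicit Types (f g : R -> R).

Lemma ctsD f g : continuous f -> continuous g -> continuous (fun t => f t + g t).
Proof. by move=> cf cg x; apply: continuousD; [exact: cf|exact: cg]. Qed.

Lemma ctsB f g : continuous f -> continuous g -> continuous (fun t => f t - g t).
Proof. by move=> cf cg x; apply: continuousB; [exact: cf|exact: cg]. Qed.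

Lemma ctsN f : continuous f -> continuous (fun t => - f t).
Proof. by move=> cf x; apply: continuousN; exact: cf. Qed.

Lemma ctsM f g : continuous f -> continuous g -> continuous (fun t => f t * g t).
Proof. by move=> cf cg x; apply: continuousM; [exact: cf|exact: cg]. Qed.

Lemma ctsX f n : continuous f -> continuous (fun t => f t ^+ n).
Proof.
move=> cf x; apply: (@continuous_comp _ _ _ f (fun y => y ^+ n)); first exact: cf.
exact: exprn_continuous.
Qed.

Lemma cts_cst (k : R) : continuous (fun _ : R => k).
Proof. exact: cst_continuous. Qed.

Lemma cts_id : continuous (fun t : R => t).
Proof. by move=> x; exact: cvg_id. Qed.

Lemma cts_norm f : continuous f -> continuous (fun t => `|f t|).
Proof. by move=> cf x; apply: continuous_comp; [exact: cf|exact: norm_continuous]. Qed.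

Lemma cts_comp f g : continuous f -> continuous g -> continuous (fun t => f (g t)).
Proof. by move=> cf cg x; apply: continuous_comp; [exact: cg|exact: cf]. Qed.

End Continuity.

Ltac cts := try first [assumption | lazymatch goal with
  | |- forall x, continuous_at x ?h => lazymatch h with
    | fun _ => ?k => exact: (@cts_cst _ k)
    | fun t => t => exact: cts_id
    (* A difference is a sum with an opposite, so this pattern has to precede the one for sums. *)
    | fun t => @Algebra.add _ (@?f t) (@Algebra.opp _ (@?g t)) => apply: (@ctsB _ f g); cts
    | fun t => @Algebra.add _ (@?f t) (@?g t) => apply: (@ctsD _ f g); cts
    | fun t => @Algebra.opp _ (@?f t) => apply: (@ctsN _ f); cts
    | fun t => @GRing.mul _ (@?f t) (@?g t) => apply: (@ctsM _ f g); cts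
    | fun t => @GRing.exp _ (@?f t) ?n => apply: (@ctsX _ f n); cts
    | fun t => @Num.norm _ _ (@?f t) => apply: (@cts_norm _ f); cts
    end
  end].

(** * The Neumann resolvent and its maximum principle *)

Section Resolvent.
Context {R : realType}.
Local Notation mu := (@lebesgue_measure R).

(* [om] solves [om'' = al^2 (om - V)] with Neumann conditions and [om1 = om']. *)
Definition resolvent (a b al : R) (V om om1 : R -> R) :=
  [/\ forall x : R, is_derive x (1 : R) om (om1 x),
      forall x : R, is_derive x (1 : R) om1 (al ^+ 2 * (om x - V x)),
      om1 a = 0 & om1 b = 0].

Lemma resolvent_exists (a b al : R) (V : R -> R) : a < b -> 0 < al ->
  continuous V -> exists om om1, resolvent a b al V om om1.
Proof.
move=> ab al0 cV.
pose ep x := expR (al * (x - a)); pose em x := expR (- al * (x - a)).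
have dep (x : R) : is_derive x (1 : R) ep (al * ep x) by exact: derive_exp_affine.
have dem (x : R) : is_derive x (1 : R) em (- al * em x) by exact: derive_exp_affine.
have cep := is_derive_continuous dep; have cem := is_derive_continuous dem.
have [E1 dE1] := antiderivative_exists (ctsM cem cV).
have [E2 dE2] := antiderivative_exists (ctsM cep cV).
pose e1 x := E1 x - E1 a; pose e2 x := E2 x - E2 a.
have de1 (x : R) : is_derive x (1 : R) e1 (em x * V x).
  have := derive_sub (dE1 x) (is_derive_cst (E1 a) x (1 : R)).
  by rewrite subr0.
have de2 (x : R) : is_derive x (1 : R) e2 (ep x * V x).
  have := derive_sub (dE2 x) (is_derive_cst (E2 a) x (1 : R)).
  by rewrite subr0.
have epem x : ep x * em x = 1.
  by rewrite /ep /em -expRD mulNr addrN expR0.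
have eb0 : ep b - em b != 0.
  have alba : 0 < al * (b - a) by rewrite mulr_gt0// subr_gt0.
  by rewrite gt_eqF// subr_gt0 ltr_expR mulNr; lra.
(* Variation of constants: the part built from [e1] and [e2] vanishes at [a] together with its
   derivative, the hyperbolic cosine has zero slope at [a], and its coefficient [A] is what the
   condition at [b] imposes. *)
pose A := al * (ep b * e1 b + em b * e2 b) / (ep b - em b).
exists (fun x => A / 2 * (ep x + em x) - al / 2 * (ep x * e1 x - em x * e2 x)).
exists (fun x => A * al / 2 * (ep x - em x) - al ^+ 2 / 2 * (ep x * e1 x + em x * e2 x)).
split.
- move=> x.
  have := derive_sub (derive_scale (A / 2) (derive_add (dep x) (dem x)))
    (derive_scale (al / 2) (derive_sub (derive_mul (dep x) (de1 x)) (derive_mul (dem x) (de2 x)))).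
  set d := (X in is_derive _ _ _ X).
  suff -> : d = A * al / 2 * (ep x - em x) - al ^+ 2 / 2 * (ep x * e1 x + em x * e2 x) by [].
  rewrite /d; lra.
- move=> x.
  have := derive_sub (derive_scale (A * al / 2) (derive_sub (dep x) (dem x)))
    (derive_scale (al ^+ 2 / 2) (derive_add (derive_mul (dep x) (de1 x)) (derive_mul (dem x) (de2 x)))).
  set d := (X in is_derive _ _ _ X).
  set d' := (X in _ -> is_derive _ _ _ X).
  suff -> : d = d' by [].
  have -> : d' = al ^+ 2 *
   (A / 2 * (ep x + em x) - al / 2 * (ep x * e1 x - em x * e2 x) - ep x * em x * V x).
    by rewrite /d' epem mul1r.
  rewrite /d; lra.
- by rewrite /= /e1 /e2 /ep /em !subrr !mulr0 expR0 addr0 subrr !mulr0 subr0.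
- rewrite /A; field; exact: eb0.
Qed.

(** The operator factors into two first order ones, acting on om + om1 / al and om - om1 / al. With
    their integrating factors the first quantity, minus [m], is nonincreasing and the second is
    nondecreasing, since V >= m. The Neumann conditions make both equal to [om - m] at the two ends,
    up to the exponential factors, which settles the signs there. *)
Lemma resolvent_ge (a b al : R) (V om om1 : R -> R) (m : R) : a < b -> 0 < al ->
  continuous V -> resolvent a b al V om om1 -> (forall x, a <= x <= b -> m <= V x) ->
  forall x, a <= x <= b -> m <= om x + om1 x / al /\ m <= om x - om1 x / al.
Proof.
move=> ab al0 cV [dom dom1 om1a om1b] mV.
have com := is_derive_continuous dom; have com1 := is_derive_continuous dom1.
have I_ge0 (f : R -> R) x y : x <= y -> continuous f ->
  (forall t, x <= t <= y -> 0 <= f t) -> 0 <= \int[mu]_(t in `[x, y]) f t.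
  by move=> xy cf f0; apply: Rintegral_ge0 => t; rewrite /= in_itv/=; exact: f0.

pose zp x := expR (- al * (x - a)) * (om x + om1 x / al - m).
pose zm x := expR (al * (x - a)) * (om x - om1 x / al - m).
have dzp (x : R) : is_derive x (1 : R) zp (expR (- al * (x - a)) * (al * (m - V x))).
  have := derive_mul (derive_exp_affine (- al) a x)
    (derive_sub (derive_add (dom x) (derive_mul (dom1 x) (is_derive_cst (al^-1) x (1 : R))))
      (is_derive_cst m x (1 : R))).
  set d := (X in is_derive _ _ _ X).
  suff -> : d = expR (- al * (x - a)) * (al * (m - V x)) by [].
  by rewrite /d /cst /=; field; rewrite gt_eqF.
have dzm (x : R) : is_derive x (1 : R) zm (expR (al * (x - a)) * (al * (V x - m))).
  have := derive_mul (derive_exp_affine al a x)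
    (derive_sub (derive_sub (dom x) (derive_mul (dom1 x) (is_derive_cst (al^-1) x (1 : R))))
      (is_derive_cst m x (1 : R))).
  set d := (X in is_derive _ _ _ X).
  suff -> : d = expR (al * (x - a)) * (al * (V x - m)) by [].
  by rewrite /d /cst /=; field; rewrite gt_eqF.
have czp : continuous (fun x => expR (- al * (x - a)) * (al * (m - V x))).
  by cts; exact: is_derive_continuous (derive_exp_affine _ _).
have czm : continuous (fun x => expR (al * (x - a)) * (al * (V x - m))).
  by cts; exact: is_derive_continuous (derive_exp_affine _ _).
have zp_ni x y : a <= x -> x <= y -> y <= b -> zp y <= zp x.
  move=> ax xy yb; rewrite -subr_ge0 -opprB -(FTC2_global xy czp dzp).
  rewrite oppr_ge0.
  have : 0 <= \int[mu]_(t in `[x, y]) (- 1 * (expR (- al * (t - a)) * (al * (m - V t)))).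
    apply: I_ge0 => //; first by cts; exact: is_derive_continuous (derive_exp_affine _ _).
    move=> t /andP[xt ty]; rewrite mulN1r -mulrN mulr_ge0 ?expR_ge0// -mulrN.
    by rewrite mulr_ge0 ?(ltW al0)// opprB subr_ge0 mV// (le_trans ax xt)/= (le_trans ty yb).
  by rewrite RintegralZl//; [rewrite mulN1r oppr_ge0|exact: continuous_integrable].
have zm_nd x y : a <= x -> x <= y -> y <= b -> zm x <= zm y.
  move=> ax xy yb; rewrite -subr_ge0 -(FTC2_global xy czm dzm).
  apply: I_ge0 => // t /andP[xt ty]; rewrite mulr_ge0 ?expR_ge0//.
  by rewrite mulr_ge0 ?(ltW al0)// subr_ge0 mV// (le_trans ax xt)/= (le_trans ty yb).
have a_le_b := ltW ab.
have e0 (r : R) : 0 < expR r by exact: expR_gt0.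
have zpE : zp a = om a - m.
  by rewrite /zp subrr mulr0 expR0 mul1r om1a mul0r addr0.
have zmE : zm a = om a - m.
  by rewrite /zm subrr mulr0 expR0 mul1r om1a mul0r subr0.
pose E := expR (al * (b - a)); pose E' := expR (- al * (b - a)).
have zpbE : zp b = E' * (om b - m) by rewrite /zp om1b mul0r addr0.
have zmbE : zm b = E * (om b - m) by rewrite /zm om1b mul0r subr0.
have E1 : 1 < E by rewrite /E expR_gt1 mulr_gt0// subr_gt0.
have EE' : E * E' = 1 by rewrite /E /E' mulNr expRN divff// gt_eqF.
have hp := zp_ni _ _ (lexx a) a_le_b (lexx b).
have hm := zm_nd _ _ (lexx a) a_le_b (lexx b).
rewrite zpE zpbE in hp; rewrite zmE zmbE in hm.
have E'0 : 0 < E' by exact: e0.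
have E'1 : E' < 1.
  by rewrite /E' expR_lt1 mulNr oppr_lt0 mulr_gt0// subr_gt0.
(* By monotonicity E' (om b - m) <= om a - m <= E (om b - m), and E' < 1 < E. *)
have omb : 0 <= om b - m.
  have : 0 <= (E - E') * (om b - m) by rewrite mulrBl subr_ge0 (le_trans hp).
  by rewrite pmulr_rge0// subr_gt0 (lt_trans E'1).
have oma : 0 <= om a - m by apply: le_trans hp; rewrite mulr_ge0// ltW.
move=> x /andP[ax xb]; split.
- have := zp_ni _ _ ax xb (lexx b); rewrite zpbE /zp => h.
  have : 0 <= expR (- al * (x - a)) * (om x + om1 x / al - m).
    by apply: le_trans h; rewrite mulr_ge0// ltW.
  by rewrite pmulr_rge0// subr_ge0.
- have := zm_nd _ _ (lexx a) ax xb; rewrite zmE /zm => h.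
  have : 0 <= expR (al * (x - a)) * (om x - om1 x / al - m) by apply: le_trans h.
  by rewrite pmulr_rge0// subr_ge0.
Qed.

End Resolvent.

(** Slope -1 on each side of a jump of height b - a at [c]; the branches vanish at [a] and at [b]
    respectively. It is the kernel that represents the value at [c] in terms of the mean and the
    derivative. *)
Definition sawtooth {R : realType} (a b c t : R) : R := (if t < c then a else b) - t.

(** Integration by parts on [a, c] against a - t and on [c, b] against b - t: the boundary terms at
    [a] and [b] vanish, those at [c] add up to (b - a) F(c). *)
Lemma primitive_weighted {R : realType} (a b c : R) (F f : R -> R) :
  a <= c -> c <= b -> primitive F f ->
  (@lebesgue_measure R).-integrable `[a, b] (EFin \o (fun t => sawtooth a b c t * f t)) /\
  \int[@lebesgue_measure R]_(t in `[a, b]) F t =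
  (b - a) * F c + \int[@lebesgue_measure R]_(t in `[a, b]) (sawtooth a b c t * f t).
Proof.
set mu := @lebesgue_measure R.
move=> ac cb pF; pose k := sawtooth a b c; have ab := le_trans ac cb.
have [fi Ff] := pF.
rewrite -/k; have mk : measurable_fun [set: R] k.
  apply: measurable_funB => //; apply: measurable_fun_ifT => //.
  exact: measurable_fun_ltr.
have ki : mu.-integrable `[a, b] (EFin \o (fun t => k t * f t)).
  have := @integrableMr _ _ _ mu `[a, b] (measurable_itv _) k (EFin \o f).
  apply => //; first exact: measurable_funTS.
  exists (`|a| + `|b| + `|a| + `|b|); split; first exact: num_real.
  move=> M hM t /=; rewrite in_itv/= => /andP[at_ tb]; apply: ltW; apply: le_lt_trans hM.
  have ha := ler_norm a; have ha' := ler_norm (- a).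
  have hb := ler_norm b; have hb' := ler_norm (- b).
  rewrite !normrN in ha' hb'.
  by rewrite /k /sawtooth; case: ifP => _; rewrite ler_norml; apply/andP; split; lra.
split=> //.
have pl (d : R) : primitive (fun t : R => d - t) (fun=> -1).
  apply: is_derive_primitive; first exact: cts_cst.
  move=> t; have := derive_sub (is_derive_cst d t (1 : R)) (is_derive_id t (1 : R)).
  by rewrite sub0r.
have cF := primitive_continuous pF.
have Fi x y : mu.-integrable `[x, y] (EFin \o F) by exact: continuous_integrable.
have key x y d : x <= y ->
  \int[mu]_(t in `[x, y]) ((d - t) * f t) =
   (d - y) * F y - (d - x) * F x + \int[mu]_(t in `[x, y]) F t.
  move=> xy; have [_ ->//] := primitiveM (pl d) pF.
  have dfi : mu.-integrable `[x, y] (EFin \o (fun t => (d - t) * f t)).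
    have cd : continuous (fun t : R => d - t) by cts.
    have := integrable_continuousM cd (fi x y).
    by apply: eq_integrable => // t _ /=; rewrite mulrC.
  have Fi' : mu.-integrable `[x, y] (EFin \o (fun t => -1 * F t)).
    exact: integrableRZ.
  by rewrite RintegralD// RintegralZl//; ring.
rewrite (Rintegral_split ac cb (Fi _ _)) (Rintegral_split ac cb ki).
have -> : \int[mu]_(t in `[a, c]) (k t * f t) = \int[mu]_(t in `[a, c]) ((a - t) * f t).
  rewrite -!Rintegral_itv_bndo_bndc.
  - apply: eq_Rintegral => t; rewrite inE/= in_itv/= => /andP[_ tc].
    by rewrite /k /sawtooth tc.
  - apply: (@integrableS _ _ _ mu `[a, c]) => //.
      by apply: subset_itv; rewrite bnd_simp.
    have cd : continuous (fun t : R => a - t) by cts.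
    have := integrable_continuousM cd (fi a c).
    by apply: eq_integrable => // t _ /=; rewrite mulrC.
  - apply: (@integrableS _ _ _ mu `[a, b]) => //.
    by apply: subset_itv; rewrite bnd_simp.
have -> : \int[mu]_(t in `[c, b]) (k t * f t) = \int[mu]_(t in `[c, b]) ((b - t) * f t).
  apply: eq_Rintegral => t; rewrite inE/= in_itv/= => /andP[ct _].
  by rewrite /k /sawtooth ltNge ct.
by rewrite !key//; ring.
Qed.

Lemma mulr_le_half_sqr {R : realType} (x y : R) :
  x * y <= 2^-1 * x ^+ 2 + 2^-1 * y ^+ 2.
Proof. by have := sqr_ge0 (x - y); nra. Qed.

Lemma mulr_le_quarter_sqr {R : realType} (x y : R) :
  x * y <= 4^-1 * x ^+ 2 + y ^+ 2.
Proof. by have := sqr_ge0 (2^-1 * x - y); nra. Qed.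

(** Makes every integral an atom for [lra]. *)
Ltac generalize_Rintegral :=
  repeat (let I := fresh "I" in set I := Rintegral _ _ _; move: I => ?).

(** * Energy identities and inequalities at a fixed parameter *)

Section ResolventEstimates.
Context {R : realType}.
Local Notation mu := (@lebesgue_measure R).
Variables (a b al : R) (V D om om1 : R -> R).
Hypotheses (ab : a < b) (al0 : 0 < al) (pV : primitive V D).
Hypothesis res : resolvent a b al V om om1.

Let dom (x : R) : is_derive x (1 : R) om (om1 x). Proof. by have [] := res. Qed.
Let dom1 (x : R) : is_derive x (1 : R) om1 (al ^+ 2 * (om x - V x)).
Proof. by have [] := res. Qed.
Let om1a : om1 a = 0. Proof. by have [] := res. Qed.
Let om1b : om1 b = 0. Proof. by have [] := res. Qed.
Let cV : continuous V. Proof. exact: primitive_continuous pV. Qed.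
Let com : continuous om. Proof. exact: is_derive_continuous dom. Qed.
Let com1 : continuous om1. Proof. exact: is_derive_continuous dom1. Qed.
Let ab' : a <= b. Proof. exact: ltW. Qed.
Let tau0 : 0 < al ^+ 2. Proof. exact: exprn_gt0. Qed.
Let ci f : continuous f -> mu.-integrable `[a, b] (EFin \o f).
Proof. exact: continuous_integrable. Qed.

(** Testing the equation with [om]: the product om om1 vanishes at both ends. *)
Lemma resolvent_energy :
  \int[mu]_(t in `[a, b]) (V t * (V t - om t)) =
  \int[mu]_(t in `[a, b]) (V t - om t) ^+ 2 +
  (al ^+ 2)^-1 * \int[mu]_(t in `[a, b]) (om1 t ^+ 2).
Proof.
have d (x : R) := derive_mul (dom x) (dom1 x).
have := FTC2_global ab' _ d; rewrite om1a om1b !mulr0 subrr => /(_ _)/=.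
have -> : (fun t => om1 t * om1 t + om t * (al ^+ 2 * (om t - V t))) =
  (fun t => om1 t ^+ 2 - al ^+ 2 * (V t * (V t - om t) - (V t - om t) ^+ 2)).
  by apply/funext => t; ring.
set f := (X in continuous X); have cf : continuous f by rewrite /f; cts.
move=> /(_ cf); rewrite /f.
rewrite RintegralB ?RintegralZl ?RintegralB//; try (apply: ci; cts).
move=> h; apply: (mulfI (lt0r_neq0 tau0)).
by rewrite mulrDr mulVKf ?gt_eqF//; lra.
Qed.

(** A bound uniform in [al], for the range of small parameters. *)
Lemma resolvent_square_le :
  \int[mu]_(t in `[a, b]) (V t - om t) ^+ 2 <= \int[mu]_(t in `[a, b]) (V t ^+ 2).
Proof.
have h1 : \int[mu]_(t in `[a, b]) (V t * (V t - om t)) <=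
   \int[mu]_(t in `[a, b]) (2^-1 * V t ^+ 2 + 2^-1 * (V t - om t) ^+ 2).
  apply: le_Rintegral => //; try (apply: ci; cts).
  by move=> t _; exact: mulr_le_half_sqr.
move: h1; rewrite RintegralD ?RintegralZl//; try (apply: ci; cts).
rewrite resolvent_energy => h1.
have h2 : 0 <= (al ^+ 2)^-1 * \int[mu]_(t in `[a, b]) (om1 t ^+ 2).
  by rewrite mulr_ge0 ?invr_ge0 ?(ltW tau0)// Rintegral_ge0// => t _; exact: sqr_ge0.
move: h1 h2; generalize_Rintegral; lra.
Qed.

(** Testing with [V] instead gives al^2 times the integral of V (V - om) as the integral of D om1.
    In the arithmetic-geometric inequality the coefficient of om1^2 is exactly 1, so that the energy
    identity absorbs it and only D^2 / 4 remains. *)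
Lemma resolvent_square_decay :
  mu.-integrable `[a, b] (EFin \o (fun t => D t ^+ 2)) ->
  \int[mu]_(t in `[a, b]) (V t - om t) ^+ 2 <=
  (4 * al ^+ 2)^-1 * \int[mu]_(t in `[a, b]) (D t ^+ 2).
Proof.
move=> D2i; have [Di _] := pV.
have pom1 : primitive om1 (fun t => al ^+ 2 * (om t - V t)).
  by apply: is_derive_primitive dom1; cts.
have [/(_ a b) i1 /(_ a b ab')] := primitiveM pV pom1.
rewrite om1a om1b !mulr0 subrr.
have Doi : mu.-integrable `[a, b] (EFin \o (fun t => D t * om1 t)).
  exact: integrable_continuousM.
have -> : (fun t => D t * om1 t + V t * (al ^+ 2 * (om t - V t))) =
  (fun t => D t * om1 t - al ^+ 2 * (V t * (V t - om t))).
  by apply/funext => t; ring.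
rewrite RintegralB ?RintegralZl//; try (apply: ci; cts).
rewrite resolvent_energy => h.
have i4 : mu.-integrable `[a, b] (EFin \o (fun t => 4^-1 * D t ^+ 2)).
  exact: integrableRZ.
have h1 : \int[mu]_(t in `[a, b]) (D t * om1 t) <=
  \int[mu]_(t in `[a, b]) (4^-1 * D t ^+ 2 + om1 t ^+ 2).
  apply: le_Rintegral => //; first by apply: integrableRD => //; apply: ci; cts.
  by move=> t _; exact: mulr_le_quarter_sqr.
move: h1; rewrite RintegralD ?RintegralZl//; try (apply: ci; cts).
move: h; rewrite mulrDr mulVKf ?gt_eqF// => h h1.
rewrite invfM -mulrA (mulrCA _ (al ^+ 2)^-1) ler_pdivlMl//.
move: h h1; generalize_Rintegral; lra.
Qed.

(** The quadratic quantity [F] enters through its value at [c] and its mean; the energy identity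
    removes the latter, and what remains is linear in V - om and can be integrated in the
    parameter. *)
Lemma resolvent_functional (c : R) : a <= c <= b ->
  (forall x, a <= x <= b -> V c <= V x) ->
  2^-1 * \int[mu]_(t in `[a, b]) (V t * (V t - om t)) <=
  \int[mu]_(t in `[a, b]) ((V t - sawtooth a b c t * D t) * (V t - om t)).
Proof.
move=> /andP[ac cb] mV; set k := sawtooth a b c.
have [] := resolvent_ge ab al0 cV res mV (_ : a <= c <= b).
  by rewrite ac.
move=> h1 h2.
have pom : primitive om om1 by exact: is_derive_primitive.
have pom1 : primitive om1 (fun t => al ^+ 2 * (om t - V t)).
  by apply: is_derive_primitive dom1; cts.
have pp := primitiveB pV pom.
pose F t := (2 * al ^+ 2)^-1 * (om1 t * om1 t) - 2^-1 * ((V t - om t) * (V t - om t)).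
have pF : primitive F (fun t => - (D t * (V t - om t))).
  have := primitiveB (primitiveZ ((2 * al ^+ 2)^-1) (primitiveM pom1 pom1))
    (primitiveZ 2^-1 (primitiveM pp pp)).
  set f := (X in primitive _ X).
  suff -> : f = (fun t => - (D t * (V t - om t))) by [].
  by apply/funext => t; rewrite /f; field; rewrite gt_eqF.
have Fc : F c <= 0.
  (* A difference of squares: the factors are the two quantities that [resolvent_ge] makes
     nonnegative, with m = V(c). *)
  have -> : F c = - 2^-1 * ((om c + om1 c / al - V c) * (om c - om1 c / al - V c)).
    by rewrite /F; field; rewrite gt_eqF.
  by rewrite mulNr oppr_le0 mulr_ge0// mulr_ge0// subr_ge0.
have [ki FE] := primitive_weighted ac cb pF.
rewrite -/k in ki FE.
have -> : \int[mu]_(t in `[a, b]) ((V t - k t * D t) * (V t - om t)) =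
  \int[mu]_(t in `[a, b]) (V t * (V t - om t)) +
  \int[mu]_(t in `[a, b]) (k t * - (D t * (V t - om t))).
  rewrite -RintegralD//; try (apply: ci; cts).
  by apply: eq_Rintegral => t _; ring.
have FE2 : \int[mu]_(t in `[a, b]) F t =
  2^-1 * ((al ^+ 2)^-1 * \int[mu]_(t in `[a, b]) (om1 t ^+ 2)) -
  2^-1 * \int[mu]_(t in `[a, b]) (V t - om t) ^+ 2.
  rewrite /F RintegralB ?RintegralZl//; try (apply: ci; cts).
  have -> : (fun t => om1 t * om1 t) = (fun t => om1 t ^+ 2) by apply/funext => t; ring.
  have -> : (fun t => (V t - om t) * (V t - om t)) = (fun t => (V t - om t) ^+ 2).
    by apply/funext => t; ring.
  by rewrite invfM mulrA.
rewrite FE2 in FE; rewrite resolvent_energy.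
have h3 : 0 <= (al ^+ 2)^-1 * \int[mu]_(t in `[a, b]) (om1 t ^+ 2).
  by rewrite mulr_ge0 ?invr_ge0 ?(ltW tau0)// Rintegral_ge0// => t _; exact: sqr_ge0.
have h4 : (b - a) * F c <= 0 by rewrite mulr_ge0_le0// subr_ge0.
(* With X the integral of (V - om)^2 and Y that of om1^2 / al^2, the claim reads (X + Y) / 2 <= X +
   Y + (Y - X) / 2 - (b - a) F(c). *)
move: FE h3 h4; generalize_Rintegral; lra.
Qed.

(** Testing the equation with be(om) yields the sign for be(om) in place of be(V); the replacement
    is allowed because (V - om) (be(V) - be(om)) <= 0 for nonincreasing [be]. *)
Lemma resolvent_composition_le0 (be be1 : R -> R) :
  (forall x : R, is_derive x (1 : R) be (be1 x)) -> continuous be1 ->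
  (forall x, be1 x <= 0) -> {homo be : x y /~ x <= y} ->
  \int[mu]_(t in `[a, b]) ((V t - om t) * be (V t)) <= 0.
Proof.
move=> dbe cbe1 be1_le0 be_ni; have cbe := is_derive_continuous dbe.
have cbo : continuous (fun t => be (om t)) by exact: cts_comp.
have cbV : continuous (fun t => be (V t)) by exact: cts_comp.
have cb1o : continuous (fun t => be1 (om t)) by exact: cts_comp.
have dbo (x : R) : is_derive x (1 : R) (fun t => be (om t)) (be1 (om x) * om1 x).
  exact: derive_compE.
have := FTC2_global ab' _ (fun x => derive_mul (dom1 x) (dbo x)).
rewrite om1a om1b !mul0r subrr.
have -> : (fun t => al ^+ 2 * (om t - V t) * be (om t) + om1 t * (be1 (om t) * om1 t)) =
  (fun t => be1 (om t) * om1 t ^+ 2 - al ^+ 2 * ((V t - om t) * be (om t))).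
  by apply/funext => t; ring.
move=> h0.
set f := (X in Rintegral _ _ X) in h0; have cf : continuous f by rewrite /f; cts.
have := h0 cf; rewrite /f RintegralB ?RintegralZl//; try (apply: ci; cts).
move=> h.
have h1 : \int[mu]_(t in `[a, b]) ((V t - om t) * be (V t)) <=
          \int[mu]_(t in `[a, b]) ((V t - om t) * be (om t)).
  apply: le_Rintegral => //; try (apply: ci; cts).
  move=> t _; rewrite -subr_ge0 -mulrBr.
  have [Vo|/ltW oV] := leP (V t) (om t).
    by rewrite mulr_le0// ?subr_le0// be_ni.
  by rewrite mulr_ge0// ?subr_ge0// be_ni.
apply: le_trans h1 _; rewrite -(pmulr_rle0 _ tau0).
have : \int[mu]_(t in `[a, b]) (be1 (om t) * om1 t ^+ 2) <= 0.
  rewrite -oppr_ge0 -mulN1r -RintegralZl//; last by apply: ci; cts.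
  by apply: Rintegral_ge0 => t _; rewrite mulN1r -mulNr mulr_ge0 ?sqr_ge0// oppr_ge0.
move: h; generalize_Rintegral; lra.
Qed.

(** The function om1 cos + k om sin vanishes at both ends, and its derivative is (al^2 (om - V) +
    k^2 om) cos. So V - om is obtained from V by a multiplier on cosine coefficients. *)
Lemma resolvent_cos (k : R) : sin (k * (b - a)) = 0 ->
  \int[mu]_(t in `[a, b]) ((V t - om t) * cos (k * (t - a))) =
  k ^+ 2 / (k ^+ 2 + al ^+ 2) * \int[mu]_(t in `[a, b]) (V t * cos (k * (t - a))).
Proof.
move=> kb.
have dc (x : R) := derive_cos_affine k a x; have ds (x : R) := derive_sin_affine k a x.
have cc := is_derive_continuous dc; have cs := is_derive_continuous ds.
have := FTC2_global ab' _ (fun x => derive_add (derive_mul (dom1 x) (dc x))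
   (derive_scale k (derive_mul (dom x) (ds x)))).
rewrite om1a om1b !mul0r subrr !mulr0 sin0 kb !mulr0 !addr0 subrr.
set f := (X in Rintegral _ _ X) => h0.
have cf : continuous f by rewrite /f; cts.
move: (h0 cf).
have -> : f = (fun t => (k ^+ 2) * (V t * cos (k * (t - a))) -
  (k ^+ 2 + al ^+ 2) * ((V t - om t) * cos (k * (t - a)))).
  by apply/funext => t; rewrite /f; ring.
rewrite RintegralB ?RintegralZl//; try (apply: ci; cts).
have d0 : 0 < k ^+ 2 + al ^+ 2 by rewrite ltr_wpDl// sqr_ge0.
move=> h; apply: (mulfI (lt0r_neq0 d0)).
rewrite mulrA mulrCA divff ?gt_eqF// mulr1.
move: h; generalize_Rintegral; lra.
Qed.

End ResolventEstimates.

(** * Decay in L^1 for an integrable second derivative *)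

Section ResolventL1.
Context {R : realType}.
Local Notation mu := (@lebesgue_measure R).

Lemma Rintegral_eq0 (D : set (measurableTypeR R)) (f : R -> R) :
  (forall x, x \in D -> f x = 0) -> \int[mu]_(x in D) f x = 0.
Proof. by move=> /eq_Rintegral ->; rewrite /Rintegral integral0. Qed.

Lemma Rintegral_itv_cst (k x y : R) : x <= y ->
  \int[mu]_(t in `[x, y]) k = k * (y - x).
Proof.
rewrite Rintegral_cst//; have := @lebesgue_measure_itv R `[x, y].
rewrite /= lte_fin le_eqVlt => E /predU1P[->|xy]; last by rewrite E xy.
by rewrite set_itv1 lebesgue_measure_set1 subrr.
Qed.

Lemma derive_inv (F : R -> R) (f x : R) : F x != 0 -> is_derive x (1 : R) F f ->
  is_derive x (1 : R) (fun t => (F t)^-1) (- f / F x ^+ 2).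
Proof.
move=> Fx dF; have [Fd <-] := dF; apply: DeriveDef; first exact: derivableV.
rewrite deriveV// /GRing.scale/=; field; exact: Fx.
Qed.

(* [y / sqrt (y^2 + e^2)] is a smooth nondecreasing approximation of the sign. *)
Lemma smooth_sign (e : R) : 0 < e -> exists be be1 : R -> R,
  [/\ forall x : R, is_derive x (1 : R) be (be1 x), continuous be1,
      forall x, 0 <= be1 x, forall x, `|be x| <= 1 &
      forall x, `|x| - e <= x * be x].
Proof.
move=> e0; pose q (x : R) := x ^+ 2 + e ^+ 2; pose S (x : R) := Num.sqrt (q x).
have e20 : 0 < e ^+ 2 by exact: exprn_gt0.
have q0 x : 0 < q x by rewrite /q ltr_wpDl// sqr_ge0.
have S0 x : 0 < S x by rewrite sqrtr_gt0.
have S2 x : S x ^+ 2 = q x by rewrite sqr_sqrtr// ltW.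
have dq (x : R) : is_derive x (1 : R) q (2 * x).
  have := derive_add (derive_mul (is_derive_id x (1 : R)) (is_derive_id x (1 : R)))
    (is_derive_cst (e ^+ 2) x (1 : R)).
  have -> : 1 * id x + id x * 1 + 0 = 2 * x :> R by rewrite /=; ring.
  rewrite (_ : (fun t => _) = q)//.
have dS (x : R) : is_derive x (1 : R) S (x / S x).
  apply: (derive_compE (is_derive1_sqrt (q0 x)) (dq x)).
  by rewrite -/(S x); field; rewrite gt_eqF.
pose be (x : R) := x * (S x)^-1; pose be1 (x : R) := e ^+ 2 * (S x)^-1 ^+ 3.
have Sneq x : S x != 0 by rewrite gt_eqF.
have dbe (x : R) : is_derive x (1 : R) be (be1 x).
  have := derive_mul (is_derive_id x (1 : R)) (derive_inv (Sneq x) (dS x)).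
  set d := (X in is_derive _ _ _ X -> _).
  suff -> : d = be1 x by [].
  rewrite /d /be1; have -> : e ^+ 2 = S x ^+ 2 - x ^+ 2 by rewrite S2 /q; ring.
  by rewrite /=; field; rewrite Sneq.
have cSV : continuous (fun x => (S x)^-1).
  exact: is_derive_continuous (fun x => derive_inv (Sneq x) (dS x)).
exists be, be1; split => //.
- by rewrite /be1; cts.
- by move=> x; rewrite mulr_ge0 ?(ltW e20)// exprn_ge0// invr_ge0 ltW.
- move=> x; rewrite normrM normfV (gtr0_norm (S0 x)) ler_pdivrMr// mul1r.
  rewrite -sqrtr_sqr ler_sqrt; first by rewrite lerDl ltW.
  by rewrite ltW.
- move=> x; rewrite mulrA ler_pdivlMr// -expr2 -real_normK ?num_real//.
  have xS : `|x| <= S x.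
    by rewrite -sqrtr_sqr ler_sqrt ?lerDl ltW.
  have Sx : S x <= `|x| + e.
    rewrite -(ler_pXn2r (n := 2)) ?nnegrE ?addr_ge0 ?(ltW e0) ?(ltW (S0 x))//.
    rewrite S2 /q -(real_normK (num_real x)).
    by have := normr_ge0 x; nra.
  by have := normr_ge0 x; have := S0 x; nra.
Qed.

(** The difference V - om has second derivative al^2 (V - om) + D2 and the slopes of [V] at the
    ends. It is tested with an approximate sign of itself: the term with the derivative of the sign
    is nonnegative, and the boundary contributes |D a| + |D b|, because [V] need not satisfy the
    Neumann condition. *)
Lemma resolvent_L1_decay a b al (V D D2 om om1 : R -> R) (ab : a < b) (al0 : 0 < al) :
  (forall x : R, is_derive x (1 : R) V (D x)) -> primitive D D2 ->
  resolvent a b al V om om1 ->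
  \int[mu]_(t in `[a, b]) `|V t - om t| <=
  (al ^+ 2)^-1 * (`|D a| + `|D b| + \int[mu]_(t in `[a, b]) `|D2 t|).
Proof.
move=> dV pD [dom dom1 om1a om1b]; have ab' := ltW ab.
have tau0 : 0 < al ^+ 2 by exact: exprn_gt0.
have cD := primitive_continuous pD; have cV := is_derive_continuous dV.
have com := is_derive_continuous dom; have com1 := is_derive_continuous dom1.
have ci f : continuous f -> mu.-integrable `[a, b] (EFin \o f).
  exact: continuous_integrable.
have [D2i _] := pD.
have aD2i : mu.-integrable `[a, b] (EFin \o (fun t => `|D2 t|)).
  exact: integrable_norm (D2i a b).
have cp : continuous (fun t => V t - om t) by cts.
have cap : continuous (fun t => `|V t - om t|) by cts.
rewrite ler_pdivlMl//; apply/ler_addgt0Pr => e e0.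
(* Chosen so that the total loss al^2 e' (b - a) of the approximate sign equals [e]. *)
pose e' := e / (al ^+ 2 * (b - a)).
have ba0 : 0 < b - a by rewrite subr_gt0.
have e'0 : 0 < e' by rewrite divr_gt0// mulr_gt0.
have [be [be1 [dbe cbe1 be1_ge0 be_le1 xbe]]] := smooth_sign e'0.
have cbe := is_derive_continuous dbe.
have pom1 : primitive om1 (fun t => al ^+ 2 * (om t - V t)).
  by apply: is_derive_primitive dom1; cts.
have dbp (x : R) : is_derive x (1 : R) (fun t => be (V t - om t))
    (be1 (V x - om x) * (D x - om1 x)).
  exact: derive_compE (dbe _) (derive_sub (dV x) (dom x)) _.
have cbp : continuous (fun t => be (V t - om t)) by exact: cts_comp.
have cb1p : continuous (fun t => be1 (V t - om t)) by exact: cts_comp.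
have pbp : primitive (fun t => be (V t - om t))
    (fun t => be1 (V t - om t) * (D t - om1 t)).
  by apply: is_derive_primitive => //; cts.
have [/(_ a b) i1 /(_ a b ab')] := primitiveM (primitiveB pD pom1) pbp.
rewrite om1a om1b !subr0.
have -> : (fun t => (D2 t - al ^+ 2 * (om t - V t)) * be (V t - om t) +
   (D t - om1 t) * (be1 (V t - om t) * (D t - om1 t))) =
   (fun t => D2 t * be (V t - om t) +
   (al ^+ 2 * ((V t - om t) * be (V t - om t)) + be1 (V t - om t) * (D t - om1 t) ^+ 2)).
  by apply/funext => t; ring.
have i2 : mu.-integrable `[a, b] (EFin \o (fun t => D2 t * be (V t - om t))).
  exact: integrable_continuousM.
have c3 : continuous (fun t => (V t - om t) * be (V t - om t)) by cts.
have c3' : continuous (fun t => al ^+ 2 * ((V t - om t) * be (V t - om t))) by cts.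
have c4 : continuous (fun t => be1 (V t - om t) * (D t - om1 t) ^+ 2) by cts.
rewrite RintegralD//; last exact/ci/ctsD.
rewrite RintegralD//; try exact: ci.
rewrite RintegralZl//; last exact: ci.
have h4 : 0 <= \int[mu]_(t in `[a, b]) (be1 (V t - om t) * (D t - om1 t) ^+ 2).
  by apply: Rintegral_ge0 => t _; rewrite mulr_ge0// sqr_ge0.
have h2 : - (\int[mu]_(t in `[a, b]) `|D2 t|) <=
    \int[mu]_(t in `[a, b]) (D2 t * be (V t - om t)).
  have -> : - (\int[mu]_(t in `[a, b]) `|D2 t|) =
      \int[mu]_(t in `[a, b]) (-1 * `|D2 t|) by rewrite RintegralZl// mulN1r.
  apply: le_Rintegral => //; first exact: integrableRZ.
  move=> t _; rewrite mulN1r lerNl; apply: le_trans (ler_norm _) _.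
  by rewrite normrN normrM ler_piMr.
have h3 : \int[mu]_(t in `[a, b]) `|V t - om t| - e' * (b - a) <=
    \int[mu]_(t in `[a, b]) ((V t - om t) * be (V t - om t)).
  have -> : e' * (b - a) = \int[mu]_(t in `[a, b]) e'.
    by rewrite Rintegral_itv_cst.
  have ce : continuous (fun _ : R => e') by exact: cts_cst.
  rewrite -RintegralB//; try exact: ci.
  by apply: le_Rintegral => //; apply: ci => //; cts.
have hb : D b * be (V b - om b) <= `|D b|.
  by apply: le_trans (ler_norm _) _; rewrite normrM ler_piMr.
have ha : - `|D a| <= D a * be (V a - om a).
  rewrite lerNl; apply: le_trans (ler_norm _) _; rewrite normrN normrM ler_piMr//.
have e'E : al ^+ 2 * (e' * (b - a)) = e.
  by rewrite /e'; field; rewrite !gt_eqF.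
rewrite -(ler_pM2l tau0) mulrBr e'E in h3.
move=> h; move: h h2 h3 h4 ha hb; generalize_Rintegral; lra.
Qed.

End ResolventL1.

(** * The integral formula for fractional powers *)

Section FractionalKernel.
Context {R : realType}.
Local Notation mu := (@lebesgue_measure R).

Lemma ctsV (f : R -> R) : continuous f -> (forall x, f x != 0) ->
  continuous (fun t => (f t)^-1).
Proof. by move=> cf f0 x; apply: continuousV; [exact: f0|exact: cf]. Qed.

Lemma cts_expM (s : R) : continuous (fun t : R => expR (s * t)).
Proof. by apply: (@cts_comp _ _ (fun t => s * t)); [exact: continuous_expR|cts]. Qed.

Lemma integrable_exp_abs (d : R) : 0 < d ->
  mu.-integrable setT (EFin \o (fun t => expR (- d * `|t|))).
Proof.
move=> d0.
have ch : continuous (fun t : R => expR (- d * `|t|)).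
  apply: cts_comp; first exact: continuous_expR.
  by cts.
have mh : measurable_fun [set: measurableTypeR R] (fun t : R => expR (- d * `|t|)).
  exact: continuous_measurable_fun.
apply/integrableP; split; first exact/measurable_EFinP.
under eq_integral do rewrite /= ger0_norm ?expR_ge0//.
rewrite ge0_symfun_integralT//; last by move=> x /=; rewrite normrN.
rewrite -set_itvcy.
rewrite (@eq_integral _ _ _ mu _ (fun t => (expR (- d * (t - 0)))%:E)); last first.
  by move=> t; rewrite inE/= in_itv/= andbT => t0; rewrite subr0 ger0_norm.
have c0 : expR (- d * (t - 0)) @[t --> +oo] --> (0 : R).
  have -> : (fun t : R => expR (- d * (t - 0))) = (fun y => expR (- y)) \o (fun x => d * x).
    by apply/funext => x /=; rewrite subr0 mulNr.
  by apply: (cvg_comp _ _ _ (@cvgr_expR R)); exact: gt0_cvgMry.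
have dE (x : R) := derive_scale (- d^-1) (derive_exp_affine (- d) 0 x).
have cE := is_derive_continuous dE.
rewrite (@ge0_continuous_FTC2y R (fun t => expR (- d * (t - 0)))
   (fun t => - d^-1 * expR (- d * (t - 0))) 0 0).
- by rewrite -EFinB -EFinM ltry.
- by move=> x _; exact: expR_ge0.
- apply: continuous_subspaceT.
  exact: is_derive_continuous (derive_exp_affine (- d) 0).
- have : - d^-1 * expR (- d * (t - 0)) @[t --> +oo] --> - d^-1 * (0 : R).
    by apply: cvgM; [exact: cvg_cst|exact: c0].
  by rewrite mulr0.
- by move=> x _; have [] := dE x.
- exact: cvg_at_right_filter (cE 0).
- move=> x _; rewrite derive1E; have /@derive_val -> := dE x.
  by field; rewrite gt_eqF.
Qed.

(* With [tau = expR t], [\int tau^(s-1) f tau dtau] is [\int expR (s * t) f (expR t) dt]. *)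
Definition kern (s t : R) := expR (s * t) / (1 + expR t).

Lemma kern_den_gt0 (t : R) : 0 < 1 + expR t.
Proof. by rewrite addr_gt0// expR_gt0. Qed.

Lemma kern_gt0 s t : 0 < kern s t.
Proof. by rewrite divr_gt0// ?expR_gt0// kern_den_gt0. Qed.

Lemma continuous_kern s : continuous (kern s).
Proof.
apply: ctsM; first exact: cts_expM.
apply: ctsV => [|t]; last by rewrite gt_eqF// kern_den_gt0.
by cts; exact: continuous_expR.
Qed.

Lemma integrable_kern s : 0 < s < 1 -> mu.-integrable setT (EFin \o kern s).
Proof.
move=> /andP[s0 s1].
(* The kernel is of size exp(s t) at -oo and exp(-(1 - s) t) at +oo; [d] is the slower of the two
   rates. *)
pose d := Num.min s (1 - s).
have d0 : 0 < d by rewrite /d lt_min s0 subr_gt0.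
have mk : measurable_fun [set: measurableTypeR R] (kern s).
  by apply: continuous_measurable_fun; exact: continuous_kern.
apply: le_integrable (integrable_exp_abs d0) => //.
  exact/measurable_EFinP.
move=> t _ /=; rewrite lee_fin (ger0_norm (expR_ge0 _)) (ger0_norm (ltW (kern_gt0 _ _))).
rewrite /kern ler_pdivrMr ?kern_den_gt0//.
have ds : d <= s by rewrite /d ge_min lexx.
have ds1 : d <= 1 - s by rewrite /d ge_min lexx orbT.
have [t0|t0] := leP 0 t.
  rewrite ger0_norm// mulrDr mulr1 -expRD.
  apply: (@le_trans _ _ (expR (- d * t + t))); last by rewrite lerDr expR_ge0.
  by rewrite ler_expR; nra.
rewrite ltr0_norm// mulrDr mulr1 -expRD.
apply: (@le_trans _ _ (expR (- d * - t))); last by rewrite lerDl expR_ge0.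
by rewrite ler_expR; nra.
Qed.

Lemma Rintegral_kern_gt0 s : 0 < s < 1 -> 0 < \int[mu]_t kern s t.
Proof.
move=> s01; have ki := integrable_kern s01.
have k1i : mu.-integrable `[0, 1] (EFin \o kern s).
  by apply: integrableS ki.
pose m := (1 + expR 1 : R)^-1.
have m0 : 0 < m by rewrite invr_gt0 kern_den_gt0.
apply: (@lt_le_trans _ _ (\int[mu]_(t in `[0, 1]) kern s t)).
  apply: (@lt_le_trans _ _ (\int[mu]_(t in `[0, 1]) m)).
    by rewrite Rintegral_itv_cst// subr0 mulr1.
  apply: le_Rintegral => //.
    by apply: continuous_integrable; exact: cts_cst.
  move=> t /=; rewrite in_itv/= => /andP[t0 t1]; rewrite /kern.
  have /andP[s0 _] := s01.
  apply: (@le_trans _ _ (1 / (1 + expR t))).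
    by rewrite mul1r lef_pV2 ?posrE ?kern_den_gt0// lerD2l ler_expR.
  by rewrite ler_pM2r ?invr_gt0 ?kern_den_gt0// -[leLHS]expR0 ler_expR mulr_ge0// ltW.
rewrite fine_le//.
- exact: integrable_fin_num.
- exact: integrable_fin_num.
- rewrite ge0_subset_integral//.
  + exact: measurable_int ki.
  + by move=> t _; rewrite lee_fin ltW// kern_gt0.
Qed.

(** The translation of t by ln l turns l / (l + exp t) into 1 / (1 + exp t) and brings out the
    factor l^s. This is how the power s of an eigenvalue arises from resolvent multipliers. *)
Lemma Rintegral_kern_scale s l : 0 < s < 1 -> 0 <= l ->
  \int[mu]_t (expR (s * t) * (l / (l + expR t))) = l `^ s * \int[mu]_t kern s t.
Proof.
move=> s01; have /andP[s0 s1] := s01; rewrite le_eqVlt => /predU1P[<-|l0].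
  rewrite powR0 ?gt_eqF// mul0r.
  by apply: Rintegral_eq0 => t _; rewrite mul0r mulr0.
have ki := integrable_kern s01.
rewrite -RintegralZl//; rewrite /Rintegral; congr fine.
pose G t := expR (s * t) * (l / (l + expR t)).
have den t : 0 < l + expR t by rewrite addr_gt0// expR_gt0.
have cG : continuous G.
  apply: ctsM; first exact: cts_expM.
  apply: ctsM; first exact: cts_cst.
  apply: ctsV => [|t]; last by rewrite gt_eqF.
  by cts; exact: continuous_expR.
have dF (x : R) : is_derive x (1 : R) (fun t : R => t + ln l) 1.
  by have := derive_add (is_derive_id x (1 : R)) (is_derive_cst (ln l) x (1 : R)); rewrite addr0.
have F'E : derive1 (fun t : R => t + ln l) = cst 1.
  by apply/funext => x; rewrite derive1E; have /@derive_val -> := dF x.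
rewrite (@increasing_ge0_integration_by_substitutionT R (fun t => t + ln l) G).
- apply: eq_integral => t _; congr EFin; rewrite F'E /=.
  rewrite -[LHS]/(G (t + ln l) * 1) mulr1 /G /kern mulrDr !expRD lnK ?posrE//.
  rewrite /powR gt_eqF//; field.
  have den1 := kern_den_gt0 t; rewrite gt_eqF//=.
  by rewrite gt_eqF// addr_gt0// mulr_gt0// expR_gt0.
- by move=> x y xy; rewrite ltrD2r.
- by rewrite F'E; exact: cst_continuous.
- by rewrite F'E; apply: is_cvg_cst.
- by rewrite F'E; apply: is_cvg_cst.
- by move=> x; have [] := dF x.
- exact: cvg_addrr_Ny.
- exact: cvg_addrr.
- exact: cG.
- by move=> t; rewrite /G mulr_ge0 ?expR_ge0// divr_ge0 ?(ltW l0)// ltW.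
Qed.

End FractionalKernel.

(** * Smooth functions that vanish on a half-line *)

Section SmoothFunctions.
Context {R : realType}.
Implicit Types (f g : R -> R) (n k : nat).

Fixpoint Ck n f : Prop :=
  if n is n'.+1 then (forall x : R, derivable f x 1) /\ Ck n' (derive1 f) else True.

Lemma Ck_derive1 n f (f' : R -> R) : (forall x : R, is_derive x (1 : R) f (f' x)) ->
  Ck n f' -> Ck n.+1 f.
Proof.
move=> df f'n; split=> [x|]; first by have [] := df x.
rewrite (_ : derive1 f = f')//; apply/funext => x; rewrite derive1E.
by have [_ ->] := df x.
Qed.

Lemma Ck_is_derive n f : Ck n.+1 f -> forall x : R, is_derive x (1 : R) f (derive1 f x).
Proof. by move=> [df _] x; apply: DeriveDef => //; rewrite derive1E. Qed.

Lemma Ck_pred n f : Ck n.+1 f -> Ck n f.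
Proof.
by elim: n f => [//|n IH] f [df /IH].
Qed.

Lemma Ck_derivable f : (forall n, Ck n f) -> forall n (x : R), derivable (derive1n n f) x 1.
Proof.
move=> cf n; elim: n f cf => [|n IH] f cf x; first by have [] := cf 1%N.
by rewrite derive1Sn; apply: IH => m; have [] := cf m.+1.
Qed.

Lemma Ck_cst n (k : R) : Ck n (fun=> k).
Proof.
elim: n k => [//|n IH] k; by apply: (@Ck_derive1 _ _ (fun=> 0)).
Qed.

Lemma CkD n f g : Ck n f -> Ck n g -> Ck n (fun t => f t + g t).
Proof.
elim: n f g => [//|n IH] f g cf cg.
apply: (@Ck_derive1 _ _ (fun t => derive1 f t + derive1 g t)).
  by move=> x; exact: derive_add (Ck_is_derive cf x) (Ck_is_derive cg x).
by apply: IH; [case: cf|case: cg].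
Qed.

Lemma CkM n f g : Ck n f -> Ck n g -> Ck n (fun t => f t * g t).
Proof.
elim: n f g => [//|n IH] f g cf cg.
apply: (@Ck_derive1 _ _ (fun t => derive1 f t * g t + f t * derive1 g t)).
  by move=> x; exact: derive_mul (Ck_is_derive cf x) (Ck_is_derive cg x).
by apply: CkD; apply: IH; [case: cf|exact: Ck_pred|exact: Ck_pred|case: cg].
Qed.

Lemma Ck_affine n f (k c : R) : Ck n f -> Ck n (fun t => f (k * (t - c))).
Proof.
elim: n f => [//|n IH] f cf.
apply: (@Ck_derive1 _ _ (fun t => k * derive1 f (k * (t - c)))).
  move=> x; apply: derive_compE (Ck_is_derive cf _) (derive_affine k c x) _.
  by rewrite mulrC.
by apply: CkM; [exact: Ck_cst|apply: IH; case: cf].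
Qed.

Lemma is_derive_quadratic f (C : R) : (forall x, `|f x| <= C * x ^+ 2) ->
  is_derive (0 : R) (1 : R) f 0.
Proof.
move=> fC; have f0 : f 0 = 0.
  by apply/eqP; rewrite -normr_le0 (le_trans (fC 0))// expr0n mulr0.
have C0 : 0 <= C by have := fC 1; rewrite expr1n mulr1; apply: le_trans.
have cvg0 : h^-1 *: (f (h *: 1 + 0) - f 0) @[h --> (0 : R)^'] --> (0 : R).
  apply/cvgr0Pnorm_le => e e0; near=> h.
  have h0 : h != 0 by near: h; exact: nbhs_dnbhs_neq.
  rewrite f0 subr0 addr0 /GRing.scale/= mulr1 normrM normfV.
  rewrite ler_pdivrMl ?normr_gt0// (le_trans (fC h))//.
  rewrite -real_normK ?num_real// expr2 mulrCA ler_wpM2l//.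
  have hd : `|h| < e / (C + 1).
    by near: h; apply: dnbhs0_lt; rewrite divr_gt0// ltr_wpDl.
  rewrite ltr_pdivlMr in hd; last by rewrite ltr_wpDl.
  by have := normr_ge0 h; nra.
by apply: DeriveDef; [apply/cvg_ex; exists 0|exact/cvg_lim].
Unshelve. all: by end_near.
Qed.

(** The function exp(-c/t), extended by 0, with a factor t^(-k): this family is stable under
    differentiation up to linear combinations, so smoothness of all its members follows by one
    induction. *)
Definition flat (c : R) k (t : R) := if 0 < t then (t^-1) ^+ k * expR (- (c / t)) else 0.

Lemma flat_ge0 c k t : 0 <= flat c k t.
Proof.
rewrite /flat; case: ifPn => // t0.
by rewrite mulr_ge0 ?expR_ge0// exprn_ge0// invr_ge0 ltW.
Qed.

(** For a positive exponent n, raise z <= exp z to the power n, with z = c / (n t). *)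
Lemma flat_bound (c : R) k : 0 < c -> exists C, forall t, flat c k t <= C.
Proof.
move=> c0; case: k => [|k].
  exists 1 => t; rewrite /flat; case: ifPn => // t0.
  by rewrite expr0 mul1r -[leRHS]expR0 ler_expR oppr_le0 divr_ge0// ltW.
exists ((k.+1%:R / c) ^+ k.+1) => t; rewrite /flat; case: ifPn => t0; last first.
  by rewrite exprn_ge0// divr_ge0 ?ler0n// ltW.
rewrite expRN ler_pdivrMr ?expR_gt0//.
have -> : expR (c / t) = expR (c / t / k.+1%:R) ^+ k.+1.
  by rewrite -expRM_natl; congr expR; rewrite [RHS]mulrC mulfVK// pnatr_eq0.
rewrite -exprMn lerXn2r ?nnegrE ?invr_ge0 ?(ltW t0)//.
  by rewrite mulr_ge0 ?expR_ge0// divr_ge0 ?ler0n// ltW.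
set z := c / t / k.+1%:R.
have -> : t^-1 = k.+1%:R / c * z.
  by rewrite /z; field; rewrite !gt_eqF// pnatr_eq0.
rewrite ler_wpM2l// ?divr_ge0 ?ler0n ?(ltW c0)//.
by have := expR_ge1Dx z; lra.
Qed.

Lemma derive_pow k (x : R) :
  is_derive x (1 : R) (fun y => y ^+ k) (k%:R * x ^+ k.-1).
Proof.
elim: k => [|k IH].
  by rewrite mul0r; under eq_fun do rewrite expr0; exact: is_derive_cst.
under eq_fun do rewrite exprS.
have := derive_mul (is_derive_id x (1 : R)) IH.
have -> // : 1 * x ^+ k + id x * (k%:R * x ^+ k.-1) = k.+1%:R * x ^+ k.
by case: k {IH} => [|k] /=; rewrite ?exprS; ring.
Qed.

Lemma derive_flat (c : R) k (x : R) : 0 < c ->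
  is_derive x (1 : R) (flat c k) (- k%:R * flat c k.+1 x + c * flat c k.+2 x).
Proof.
move=> c0; have [x0|x0|x0] := ltgtP x 0.
- have E : \near x, (fun=> 0) x = flat c k x.
    near=> t; rewrite /flat ifF//; apply/negbTE; rewrite -leNgt.
    near: t; exists (- x) => /=; first by rewrite oppr_gt0.
    by move=> t /=; rewrite ltr_norml => /andP[h1 h2]; lra.
  have -> : - k%:R * flat c k.+1 x + c * flat c k.+2 x = 0.
    by rewrite /flat ltNge (ltW x0)/= !mulr0 addr0.
  exact: near_eq_is_derive E (is_derive_cst _ _ _).
- pose h (t : R) := (t^-1) ^+ k * expR (- c * (t^-1 - 0)).
  have E : \near x, h x = flat c k x.
    near=> t; rewrite /flat /h ifT ?subr0 ?mulNr//.
    near: t; exists x => //= t /=; rewrite ltr_norml => /andP[h1 h2]; lra.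
  apply: near_eq_is_derive E _.
  have xn0 : x != 0 by rewrite gt_eqF.
  have dV := derive_inv xn0 (is_derive_id x (1 : R)).
  have dX := derive_pow k x^-1.
  apply: (derive_compE (derive_mul dX (derive_exp_affine (- c) 0 x^-1)) dV).
  rewrite /flat x0 subr0 -mulNr; case: k {h dX} => [|k].
    by rewrite !expr0 /=; field.
  by rewrite !exprS /=; field; rewrite xn0.
(* At 0, [flat c k] is t^2 times the bounded function [flat c k.+2], hence has derivative 0. *)
- have [C CE] := flat_bound k.+2 c0.
  have z k' : flat c k' x = 0 by rewrite /flat x0 ltxx.
  rewrite !z !mulr0 addr0 x0.
  apply: (@is_derive_quadratic _ (Num.max C 0)) => t.
  have [t0|t0] := ltP 0 t; last by rewrite /flat ltNge t0/= normr0 mulr_ge0 ?sqr_ge0// le_max lexx orbT.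
  rewrite ger0_norm ?flat_ge0//.
  have -> : flat c k t = flat c k.+2 t * t ^+ 2.
    by rewrite /flat t0 !exprS; field; rewrite gt_eqF.
  by rewrite ler_wpM2r ?sqr_ge0// le_max CE.
Unshelve. all: by end_near.
Qed.

Lemma Ck_flat n (c : R) k : 0 < c -> Ck n (flat c k).
Proof.
move=> c0; elim: n k => [//|n IH] k.
apply: (Ck_derive1 (fun x => derive_flat k x c0)).
by apply: CkD; apply: CkM; [exact: Ck_cst|exact: IH|exact: Ck_cst|exact: IH].
Qed.

End SmoothFunctions.

(** * Functions with vanishing integrals and smooth cutoffs *)

Section DuBoisReymond.
Context {R : realType}.
Local Notation mu := (@lebesgue_measure R).
Implicit Types (f g h : R -> R).

Lemma dominated_Rintegral (D : set (measurableTypeR R)) (f_ : nat -> R -> R) f g :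
  measurable D -> (forall n, measurable_fun D (f_ n)) -> measurable_fun D f ->
  (forall x, D x -> f_ ^~ x @ \oo --> f x) -> mu.-integrable D (EFin \o g) ->
  (forall n x, D x -> `|f_ n x| <= g x) ->
  (fun n => \int[mu]_(x in D) f_ n x) @ \oo --> \int[mu]_(x in D) f x.
Proof.
move=> mD mf_ mf ff gi fg.
have [|||||fi _ fI] := @dominated_convergence _ _ R mu D mD (fun n => EFin \o f_ n)
  (EFin \o f) (EFin \o g).
- by move=> n; exact/measurable_EFinP.
- exact/measurable_EFinP.
- by apply: aeW => x Dx; apply: cvg_EFin; [exact: nearW|exact: ff].
- exact: gi.
- by apply: aeW => x n Dx; rewrite /= lee_fin fg.
apply: fine_cvg; rewrite /Rintegral fineK; last exact: integrable_fin_num.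
exact: fI.
Qed.

(** Lebesgue differentiation. Since [h] may fail to be integrable up to the ends, it is truncated to
    the intervals [I n] that exhaust ]a, b[. *)
Lemma ae_eq0_Rintegral a b h :
  (forall x y, a < x -> y < b -> mu.-integrable `[x, y] (EFin \o h)) ->
  (forall x y, a < x -> x <= y -> y < b -> \int[mu]_(t in `[x, y]) h t = 0) ->
  {ae mu, forall x, x \in `]a, b[ -> h x = 0}.
Proof.
move=> hi h0.
pose al n := a + n.+1%:R^-1; pose be n := b - n.+1%:R^-1 : R.
pose I n : set (measurableTypeR R) := `[al n, be n]%classic.
have aln n : a < al n by rewrite /al ltrDl invr_gt0.
have ben n : be n < b by rewrite /be ltrBlDr ltrDl invr_gt0.
have key n : {ae mu, forall x, (h \_ (I n)) x = 0}.
  have hni : mu.-integrable setT (EFin \o (h \_ (I n))).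
    rewrite -restrict_EFin; apply/integrable_restrict => //; first exact: measurable_itv.
    rewrite setTI.
    exact: hi.
  have lhn : locally_integrable [set: R] (h \_ (I n)).
    by apply: open_integrable_locally => //; exact: openT.
  have hni' y : mu.-integrable `]-oo, y] (EFin \o (h \_ (I n))).
    by apply: integrableS hni.
  (* The indefinite integral of the truncation is identically 0: each of its values is an integral
     of [h] over a closed subinterval of ]a, b[. *)
  apply: ae_impl (FTC1Ny hni' lhn) => x [_ <-].
  suff -> : (fun x0 => \int[mu]_(t in [set` `]-oo, x0]]) (h \_ (I n)) t) = cst 0.
    by rewrite derive1_cst.
  apply/funext => y /=.
  rewrite [LHS](_ : _ = \int[mu]_(t in `[al n, Num.min (be n) y]) h t); last first.
    rewrite [LHS]Rintegral_mkcond [RHS]Rintegral_mkcond.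
    apply: eq_Rintegral => t _; rewrite !patchE.
    rewrite !mem_setE !in_itv/= le_min.
    by case: (t <= y) => //=; rewrite ?andbF// andbT.
  have [aly|aly] := leP (al n) (Num.min (be n) y); last first.
    by rewrite Rintegral_itv_ge// ltW.
  by rewrite h0// gt_min ben.
have := ae_foralln key; apply: ae_impl => x hx.
rewrite in_itv/= => /andP[ax xb].
have /cvgrPdist_lt/(_ (Num.min (x - a) (b - x))) := @cvg_harmonic R.
rewrite lt_min !subr_gt0 ax xb => /(_ isT)[n _ /(_ n (leqnn n))] /=.
rewrite sub0r normrN ger0_norm; last by rewrite invr_ge0.
rewrite lt_min => /andP[h1 h2].
have := hx n; rewrite patchE ifT// mem_setE in_itv/= /al /be.
move: (n.+1%:R^-1) h1 h2 => e h1 h2.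
by apply/andP; split; lra.
Qed.

(** As c tends to 0, exp(-c/t) tends to 1 for every t > 0; a product of two such factors, one for
    each end, tends to the indicator of ]x, y[. Dominated convergence then replaces
    mollification. *)
Lemma smooth_indicator (x y : R) : exists th : nat -> R -> R,
  [/\ forall n m, Ck m (th n), forall n t, 0 <= th n t <= 1,
      forall n t, t \notin `]x, y[ -> th n t = 0 &
      forall t, t \in `]x, y[ -> th n t @[n --> \oo] --> (1 : R)].
Proof.
pose c n : R := n.+1%:R^-1.
have c0 n : 0 < c n by rewrite invr_gt0.
have f01 n t : 0 <= flat (c n) 0 t <= 1.
  rewrite flat_ge0/= /flat; case: ifPn => // t0.
  by rewrite expr0 mul1r -[leRHS]expR0 ler_expR oppr_le0 divr_ge0// ltW.
have f1 t : 0 < t -> flat (c n) 0 t @[n --> \oo] --> (1 : R).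
  move=> t0.
  have -> : (fun n => flat (c n) 0 t) = (fun n => expR (- (c n / t))).
    by apply/funext => n; rewrite /flat t0 expr0 mul1r.
  have : expR (- (c n / t)) @[n --> \oo] --> expR (- (0 / t)).
    apply: continuous_cvg; first exact: continuous_expR.
    by apply: cvgN; apply: cvgMl; exact: cvg_harmonic.
  by rewrite mul0r oppr0 expR0.
exists (fun n t => flat (c n) 0 (1 * (t - x)) * flat (c n) 0 (-1 * (t - y))); split.
- by move=> n m; apply: CkM; apply: Ck_affine; exact: Ck_flat.
- move=> n t; have /andP[h1 h2] := f01 n (1 * (t - x)).
  have /andP[h3 h4] := f01 n (-1 * (t - y)).
  by rewrite mulr_ge0//= mulr_ile1.
- move=> n t; rewrite in_itv/= negb_and -!leNgt => /orP[tx|yt].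
    by rewrite [X in X * _](_ : _ = 0) ?mul0r// /flat ifF// mul1r subr_gt0 ltNge tx.
  by rewrite [X in _ * X](_ : _ = 0) ?mulr0// /flat ifF// mulN1r opprB subr_gt0 ltNge yt.
- move=> t; rewrite in_itv/= => /andP[xt ty]; rewrite -[X in _ --> X]mulr1.
  by apply: cvgM; apply: f1; rewrite ?mul1r ?mulN1r ?opprB subr_gt0.
Qed.

End DuBoisReymond.

(** * Weak derivatives and absolutely continuous representatives *)

Section WeakDerivative.
Context {R : realType}.
Local Notation mu := (@lebesgue_measure R).
Implicit Types (f g h : R -> R) (a b c d x y : R).

Lemma Rintegral_itv_oo f x y : mu.-integrable `[x, y] (EFin \o f) ->
  \int[mu]_(t in `]x, y[) f t = \int[mu]_(t in `[x, y]) f t.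
Proof.
move=> fi; rewrite Rintegral_itv_bndo_bndc; last first.
  by apply: integrableS fi => //; exact: subset_itv_oo_cc.
rewrite Rintegral_itv_obnd_cbnd//.
by apply: integrableS fi => //; exact: subset_itv_oc_cc.
Qed.

Lemma locally_integrable_itv a b f x y : locally_integrable `]a, b[%classic f ->
  a < x -> y < b -> mu.-integrable `[x, y] (EFin \o f).
Proof.
move=> [mf _ fi] ax yb.
have sub : `[x, y]%classic `<=` `]a, b[%classic.
  move=> t /=; rewrite !in_itv/= => /andP[xt ty].
  by rewrite (lt_le_trans ax)// (le_lt_trans ty).
apply/integrableP; split.
  by apply/measurable_EFinP; exact: measurable_funS mf.
by apply: fi => //; exact: segment_compact.
Qed.

Lemma Rintegral_support (D : set (measurableTypeR R)) f c d :
  `[c, d]%classic `<=` D -> (forall t, t \notin `[c, d] -> f t = 0) ->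
  \int[mu]_(t in D) f t = \int[mu]_(t in `[c, d]) f t.
Proof.
move=> cdD f0; rewrite [LHS]Rintegral_mkcond [RHS]Rintegral_mkcond.
apply: eq_Rintegral => t _; rewrite !patchE.
case: ifPn => tD; case: ifPn => tcd //.
  by rewrite f0//; apply: contra tcd; rewrite inE.
by move: tcd; rewrite inE => /cdD tD'; rewrite mem_set// in tD.
Qed.

Lemma cvg_smooth_indicator h c d x y (th : nat -> R -> R) :
  mu.-integrable `[c, d] (EFin \o h) -> c <= x -> y <= d ->
  (forall n, continuous (th n)) -> (forall n t, 0 <= th n t <= 1) ->
  (forall n t, t \notin `]x, y[ -> th n t = 0) ->
  (forall t, t \in `]x, y[ -> th n t @[n --> \oo] --> (1 : R)) ->
  (fun n => \int[mu]_(t in `[c, d]) (h t * th n t)) @ \oo --> \int[mu]_(t in `[x, y]) h t.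
Proof.
move=> hi cx yd cth th01 th0 th1.
have mh : measurable_fun (`[c, d]%classic : set (measurableTypeR R)) h.
  exact: integrable_measurable hi.
have xycd : `[x, y]%classic `<=` `[c, d]%classic.
  move=> t /=; rewrite !in_itv/= => /andP[xt ty].
  by rewrite (le_trans cx)// (le_trans ty).
have xyi : mu.-integrable `[x, y] (EFin \o h) by exact: integrableS hi.
rewrite -Rintegral_itv_oo//.
have -> : \int[mu]_(t in `]x, y[) h t = \int[mu]_(t in `[c, d]) (h \_ `]x, y[%classic) t.
  rewrite -Rintegral_mkcondr; congr Rintegral.
  apply/seteqP; split=> t; last by case.
  by move=> txy; split => //; apply: xycd; exact: subset_itv_oo_cc.
apply: (@dominated_Rintegral _ _ _ _ (fun t => `|h t|)) => //.
- move=> n; apply: measurable_funM => //; apply: measurable_funTS.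
  exact: continuous_measurable_fun.
- apply/measurable_restrict => //.
  by apply: measurable_funS mh => //; exact: subIsetl.
- move=> t _; rewrite patchE; case: ifPn => txy.
    rewrite -[X in _ --> X]mulr1; apply: cvgM; first exact: cvg_cst.
    by apply: th1; rewrite inE in txy.
  have E n : h t * th n t = 0.
    by rewrite th0 ?mulr0//; apply: contra txy => /mem_set.
  by under eq_fun do rewrite E; exact: cvg_cst.
- exact: integrable_norm.
- by move=> n t _; have /andP[h1 h2] := th01 n t; rewrite normrM (ger0_norm h1) ler_piMr.
Qed.

(** The lemma of du Bois-Reymond: the mean of f - F is the same on all subintervals, so f - F minus
    this mean has vanishing integrals. *)
Lemma weak_derivative_ae a b f g F : a < b -> weak_derivative a b f g ->
  (forall x y, a < x -> x <= y -> y < b -> F y - F x = \int[mu]_(t in `[x, y]) g t) ->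
  exists k, {ae mu, forall x, x \in `]a, b[ -> f x = F x + k}.
Proof.
move=> ab [lf lg wd] Fg.
have fi x y := @locally_integrable_itv a b f x y lf.
have gi x y := @locally_integrable_itv a b g x y lg.
(* [F] is a primitive inside ]a, b[ only; on a compact subinterval it is matched with a primitive on
   the whole line, to which integration by parts applies. *)
have prim c d : a < c -> d < b -> exists2 G, primitive G (g \_ `[c, d]) &
    forall x, c <= x <= d -> F x = G x + (F c - G c).
  move=> ac db; have [|G pG] := @primitive_exists _ (g \_ `[c, d]).
    move=> x y; apply: (@integrableS _ _ _ mu setT) => //.
    by apply: integrable_patch => //; exact: gi.
  exists G => // x /andP[cx xd].
  have := Fg _ _ ac cx (le_lt_trans xd db); have [_ /(_ _ _ cx)] := pG.
  have -> : \int[mu]_(t in `[c, x]) (g \_ `[c, d]) t = \int[mu]_(t in `[c, x]) g t.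
    apply: eq_Rintegral => t; rewrite inE/= in_itv/= => /andP[ct tx].
    by rewrite patchE mem_setE in_itv/= ct (le_trans tx xd).
  by lra.
have Fi x y : a < x -> y < b -> mu.-integrable `[x, y] (EFin \o F).
  move=> ax yb; have [G pG FG] := prim x y ax yb.
  have cG := primitive_continuous pG.
  have : mu.-integrable `[x, y] (EFin \o (fun t => G t + (F x - G x))).
    by apply: continuous_integrable; cts.
  apply: eq_integrable => // t; rewrite inE/= in_itv/= => txy /=.
  by rewrite (FG _ txy).
pose h t := f t - F t.
have hi x y : a < x -> y < b -> mu.-integrable `[x, y] (EFin \o h).
  by move=> ax yb; apply: integrableRB => //; [exact: fi|exact: Fi].
(* Equality of the two means, with denominators cleared. *)
have key x1 y1 x2 y2 : a < x1 -> x1 < y1 -> y1 < b -> a < x2 -> x2 < y2 -> y2 < b ->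
    (\int[mu]_(t in `[x1, y1]) h t) * (y2 - x2) =
    (\int[mu]_(t in `[x2, y2]) h t) * (y1 - x1).
  move=> ax1 xy1 yb1 ax2 xy2 yb2.
  pose c := Num.min x1 x2; pose d := Num.max y1 y2.
  have ac : a < c by rewrite lt_min ax1.
  have db : d < b by rewrite gt_max yb1.
  have cx1 : c <= x1 by rewrite ge_min lexx.
  have cx2 : c <= x2 by rewrite ge_min lexx orbT.
  have yd1 : y1 <= d by rewrite le_max lexx.
  have yd2 : y2 <= d by rewrite le_max lexx orbT.
  have cd : c <= d by rewrite (le_trans cx1)// (le_trans (ltW xy1)).
  have [th1 [sm1 th01 supp1 lim1]] := smooth_indicator x1 y1.
  have [th2 [sm2 th02 supp2 lim2]] := smooth_indicator x2 y2.
  have cont (th : nat -> R -> R) n : (forall n m, Ck m (th n)) -> continuous (th n).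
    by move=> sm; exact: is_derive_continuous (Ck_is_derive (sm n 1%N)).
  have ct1 n : continuous (th1 n) by exact: cont.
  have ct2 n : continuous (th2 n) by exact: cont.
  have [G pG FG] := prim c d ac db.
  have cG := primitive_continuous pG.
  have out1 n t : t \notin `]c, d[ -> th1 n t = 0.
    move=> tcd; apply: supp1; apply: contra tcd; rewrite !in_itv/= => /andP[h1 h2].
    by rewrite (le_lt_trans cx1 h1) (lt_le_trans h2).
  have out2 n t : t \notin `]c, d[ -> th2 n t = 0.
    move=> tcd; apply: supp2; apply: contra tcd; rewrite !in_itv/= => /andP[h1 h2].
    by rewrite (le_lt_trans cx2 h1) (lt_le_trans h2).
  have eqn n : (\int[mu]_(t in `[c, d]) (h t * th1 n t)) *
      (\int[mu]_(t in `[c, d]) (1 * th2 n t)) =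
      (\int[mu]_(t in `[c, d]) (h t * th2 n t)) *
      (\int[mu]_(t in `[c, d]) (1 * th1 n t)).
    set r := \int[mu]_(t in `[c, d]) (1 * th2 n t).
    set s := \int[mu]_(t in `[c, d]) (1 * th1 n t).
    (* The combination has integral 0, so its antiderivative vanishes outside [c, d] and is an
       admissible test function. *)
    pose chi t := r * th1 n t - s * th2 n t.
    have cchi : continuous chi by rewrite /chi; cts; [exact: ct1|exact: ct2].
    have ci f0 : continuous f0 -> mu.-integrable `[c, d] (EFin \o f0).
      exact: continuous_integrable.
    have chi0 t : t \notin `]c, d[ -> chi t = 0.
      by move=> tcd; rewrite /chi out1// out2// !mulr0 subrr.
    have ichi : \int[mu]_(t in `[c, d]) chi t = 0.
      have c1 : continuous (fun t => r * th1 n t) by cts; exact: ct1.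
      have c2 : continuous (fun t => s * th2 n t) by cts; exact: ct2.
      rewrite /chi RintegralB ?RintegralZl//; try exact: ci.
      have -> : \int[mu]_(t in `[c, d]) th1 n t = s.
        by apply: eq_Rintegral => t _; rewrite mul1r.
      have -> : \int[mu]_(t in `[c, d]) th2 n t = r.
        by apply: eq_Rintegral => t _; rewrite mul1r.
      by rewrite mulrC subrr.
    have [P0 dP0] := antiderivative_exists cchi.
    pose psi t := P0 t - P0 c.
    have dpsi (t : R) : is_derive t (1 : R) psi (chi t).
      by have := derive_sub (dP0 t) (is_derive_cst (P0 c) t (1 : R)); rewrite subr0.
    have psic : psi c = 0 by rewrite /psi subrr.
    have psid : psi d = 0 by rewrite /psi -(FTC2_global cd cchi dP0).
    have psi0 t : t \notin `[c, d] -> psi t = 0.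
      rewrite in_itv/= negb_and -!ltNge => /orP[tc|dt].
        have := FTC2_global (ltW tc) cchi dpsi; rewrite psic sub0r.
        rewrite Rintegral_eq0; first by lra.
        move=> z; rewrite inE/= in_itv/= => /andP[_ zc]; rewrite chi0//.
        by rewrite in_itv/= negb_and -leNgt zc.
      have := FTC2_global (ltW dt) cchi dpsi; rewrite psid subr0 => <-.
      apply: Rintegral_eq0 => z; rewrite inE/= in_itv/= => /andP[dz _]; rewrite chi0//.
      by rewrite in_itv/= negb_and -!leNgt dz orbT.
    have tpsi : test_function a b psi.
      split; last by exists c, d.
      apply: Ck_derivable => m; apply: Ck_pred; apply: Ck_derive1 dpsi _.
      have -> : chi = (fun t => r * th1 n t + (- s) * th2 n t).
        by apply/funext => t; rewrite /chi mulNr.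
      apply: CkD; apply: CkM; try exact: Ck_cst; [exact: sm1|exact: sm2].
    have dpsiE : derive1 psi = chi.
      by apply/funext => t; rewrite derive1E; have [_ ->] := dpsi t.
    have cdab : `[c, d]%classic `<=` `]a, b[%classic.
      move=> t /=; rewrite !in_itv/= => /andP[ct td].
      by rewrite (lt_le_trans ac)// (le_lt_trans td).
    have := wd _ tpsi; rewrite /inner dpsiE.
    rewrite (@Rintegral_support _ _ c d cdab); last first.
      move=> t tcd; rewrite chi0 ?mulr0//; apply: contra tcd.
      exact: subset_itv_oo_cc.
    rewrite (@Rintegral_support _ _ c d cdab); last first.
      by move=> t tcd; rewrite psi0 ?mulr0.
    have ppsi : primitive psi chi by exact: is_derive_primitive.
    have cpsi := primitive_continuous ppsi.
    have [_ /(_ _ _ cd)] := primitiveM pG ppsi.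
    rewrite psic psid !mulr0 subrr.
    have fchi : mu.-integrable `[c, d] (EFin \o (fun t => f t * chi t)).
      by apply: integrable_continuousM => //; exact: fi.
    have gpsi : mu.-integrable `[c, d] (EFin \o (fun t => (g \_ `[c, d]) t * psi t)).
      by apply: integrable_continuousM => //; case: pG.
    have Gchi : continuous (fun t => G t * chi t) by cts.
    rewrite RintegralD//; last exact: ci.
    have -> : \int[mu]_(t in `[c, d]) ((g \_ `[c, d]) t * psi t) =
              \int[mu]_(t in `[c, d]) (g t * psi t).
      by apply: eq_Rintegral => t tcd; rewrite patchE tcd.
    move=> e1 e2.
    have e3 : \int[mu]_(t in `[c, d]) (f t * chi t) =
              \int[mu]_(t in `[c, d]) (G t * chi t).
      by move: e1 e2; generalize_Rintegral; lra.
    have hchi : \int[mu]_(t in `[c, d]) (h t * chi t) = 0.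
      rewrite (@eq_Rintegral _ _ _ mu _
        (fun t => f t * chi t - (G t * chi t + (F c - G c) * chi t))); last first.
        by move=> t; rewrite inE/= in_itv/= => tcd; rewrite /h (FG t tcd); ring.
      have ck : continuous (fun t => (F c - G c) * chi t) by cts.
      rewrite RintegralB//; last by apply: ci; exact: ctsD.
      rewrite RintegralD ?RintegralZl//; try exact: ci.
      by rewrite e3 ichi mulr0 addr0 subrr.
    have hi' := hi c d ac db.
    have i1 := integrable_continuousM (ct1 n) hi'.
    have i2 := integrable_continuousM (ct2 n) hi'.
    have i1' := integrableRZ r (measurable_itv _) i1.
    have i2' := integrableRZ s (measurable_itv _) i2.
    move: hchi; rewrite (@eq_Rintegral _ _ _ mu _
      (fun t => r * (h t * th1 n t) - s * (h t * th2 n t))); last first.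
      by move=> t _; rewrite /chi; ring.
    by rewrite RintegralB// !RintegralZl//; lra.
  have i1 : mu.-integrable `[c, d] (EFin \o (cst 1 : R -> R)).
    by apply: continuous_integrable; exact: cts_cst.
  have hi' := hi c d ac db.
  have l1 := cvg_smooth_indicator hi' cx1 yd1 ct1 th01 supp1 lim1.
  have l2 := cvg_smooth_indicator hi' cx2 yd2 ct2 th02 supp2 lim2.
  have l3 := cvg_smooth_indicator i1 cx1 yd1 ct1 th01 supp1 lim1.
  have l4 := cvg_smooth_indicator i1 cx2 yd2 ct2 th02 supp2 lim2.
  rewrite Rintegral_itv_cst ?mul1r ?ltW// in l3.
  rewrite Rintegral_itv_cst ?mul1r ?ltW// in l4.
  have L1 : (fun n => (\int[mu]_(t in `[c, d]) (h t * th1 n t)) *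
      (\int[mu]_(t in `[c, d]) (1 * th2 n t))) @ \oo -->
      (\int[mu]_(t in `[x1, y1]) h t) * (y2 - x2) by exact: cvgM l1 l4.
  have L2 : (fun n => (\int[mu]_(t in `[c, d]) (h t * th1 n t)) *
      (\int[mu]_(t in `[c, d]) (1 * th2 n t))) @ \oo -->
      (\int[mu]_(t in `[x2, y2]) h t) * (y1 - x1).
    by rewrite (funext eqn); exact: cvgM l2 l3.
  have E1 := cvg_lim (@Rhausdorff R) L1; have E2 := cvg_lim (@Rhausdorff R) L2.
  by rewrite -[LHS]E1 -[RHS]E2.
(* The middle third serves as the reference interval whose mean is the constant [k]. *)
pose x0 := a + (b - a) / 3; pose y0 := b - (b - a) / 3.
have ax0 : a < x0 by rewrite /x0; lra.
have xy0 : x0 < y0 by rewrite /x0 /y0; lra.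
have yb0 : y0 < b by rewrite /y0; lra.
pose k := (\int[mu]_(t in `[x0, y0]) h t) / (y0 - x0).
exists k.
have ik x y : mu.-integrable `[x, y] (EFin \o (cst k : R -> R)).
  by apply: continuous_integrable; exact: cts_cst.
have : {ae mu, forall x, x \in `]a, b[ -> h x - k = 0}.
  apply: ae_eq0_Rintegral => [x y ax yb|x y ax xy yb].
    by apply: integrableRB => //; exact: hi.
  rewrite RintegralB//; last exact: hi.
  move: xy; rewrite le_eqVlt => /predU1P[<-|xy].
    by rewrite set_itv1 !Rintegral_set1 subrr.
  rewrite Rintegral_itv_cst ?ltW//.
  have := key _ _ _ _ ax xy yb ax0 xy0 yb0 => E.
  have d0 : y0 - x0 != 0 by rewrite gt_eqF// subr_gt0.
  by apply/eqP; rewrite subr_eq0 /k mulrAC -E mulfK.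
by apply: ae_impl => x hx xab; have := hx xab; rewrite /h; lra.
Qed.

End WeakDerivative.

(** * Neumann eigenfunctions are cosines *)

Section NeumannEigenfunctions.
Context {R : realType}.
Local Notation mu := (@lebesgue_measure R).
Implicit Types (a b : R) (n m : nat).

Lemma sin_addn_pi (x : R) n : sin (x + n%:R * pi) = (- 1) ^+ n * sin x.
Proof.
elim: n => [|n IH]; first by rewrite mul0r addr0 mul1r.
rewrite -natr1 mulrDl mul1r addrA sinDpi /= IH exprS; ring.
Qed.

Lemma sin_eq0_nat (x : R) : 0 <= x -> sin x = 0 -> exists n : nat, x = n%:R * pi.
Proof.
move=> x0 sx; pose n := Num.truncn (x / pi); exists n.
have p0 := pi_gt0 R.
have /truncn_itv/andP[h1 h2] : 0 <= x / pi by rewrite divr_ge0// ltW.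
rewrite -/n in h1 h2.
rewrite ler_pdivlMr// in h1; rewrite ltr_pdivrMr// -natr1 mulrDl mul1r in h2.
have [//|h3] := eqVneq x (n%:R * pi).
have y0 : 0 < x - n%:R * pi < pi by rewrite subr_gt0 lt_neqAle eq_sym h3 h1/=; lra.
have := sin_addn_pi (x - n%:R * pi) n; rewrite subrK sx => /esym/eqP.
by rewrite mulf_eq0 signr_eq0/= gt_eqF// sin_gt0_pi.
Qed.

Lemma sin_nat_pi n : sin (n%:R * pi : R) = 0.
Proof. by have := sin_addn_pi 0 n; rewrite add0r sin0 mulr0. Qed.

Lemma derive0_constant a b (f : R -> R) :
  (forall x, x \in `]a, b[ -> is_derive x (1 : R) f 0) ->
  exists c, forall x, x \in `]a, b[ -> f x = c.
Proof.
move=> df; exists (f ((a + b) / 2)) => x xab.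
have wl y z : y \in `]a, b[ -> z \in `]a, b[ -> y < z -> f y = f z.
  move=> yab zab yz.
  have sub t : t \in `[y, z] -> t \in `]a, b[.
    move: yab zab; rewrite !in_itv/= => /andP[ay yb] /andP[az zb] /andP[yt tz].
    by rewrite (lt_le_trans ay)// (le_lt_trans tz).
  have dyz t : t \in `]y, z[ -> is_derive t (1 : R) f ((fun=> 0 : R) t).
    by move=> tyz; apply: df; apply: sub; exact: subset_itv_oo_cc.
  have cyz : {within `[y, z], continuous f}.
    apply: derivable_within_continuous => t tyz.
    by have [] := df t (sub _ tyz).
  have [t _] := MVT yz dyz cyz.
  by rewrite mul0r => /eqP; rewrite subr_eq0 => /eqP.
have mab : (a + b) / 2 \in `]a, b[.
  by move: xab; rewrite !in_itv/= => /andP[? ?]; apply/andP; split; lra.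
by have [/wl|/wl|->//] := ltgtP x ((a + b) / 2); [apply|move=> <-].
Qed.

Lemma derive_pointE (f : R -> R) (x : R) : derivable f x 1 ->
  is_derive x (1 : R) f (derive1 f x).
Proof. by move=> df; apply: DeriveDef => //; rewrite derive1E. Qed.

(** Reads a one-sided limit of [f], which is arbitrary outside ]a, b[, as the value of a continuous
    [g] that agrees with [f] inside. *)
Lemma cvg_at_right_itv a b (f g : R -> R) (l : R) : a < b ->
  (forall x, x \in `]a, b[ -> f x = g x) -> continuous g ->
  f x @[x --> a^'+] --> l -> g a = l.
Proof.
move=> ab fg cg fl; have ga := cvg_at_right_filter (cg a).
apply: (cvg_unique _ ga) => //.
apply: cvg_trans fl; apply: near_eq_cvg; near=> x.
by rewrite fg// in_itv/=; apply/andP; split; near: x; [exact: nbhs_right_gt|exact: nbhs_right_lt].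
Unshelve. all: by end_near.
Qed.

Lemma cvg_at_left_itv a b (f g : R -> R) (l : R) : a < b ->
  (forall x, x \in `]a, b[ -> f x = g x) -> continuous g ->
  f x @[x --> b^'-] --> l -> g b = l.
Proof.
move=> ab fg cg fl; have gb := cvg_at_left_filter (cg b).
apply: (cvg_unique _ gb) => //.
apply: cvg_trans fl; apply: near_eq_cvg; near=> x.
by rewrite fg// in_itv/=; apply/andP; split; near: x; [exact: nbhs_left_gt|exact: nbhs_left_lt].
Unshelve. all: by end_near.
Qed.

Definition freq a b n : R := n%:R * pi / (b - a).
Definition cosn a b n (x : R) : R := cos (freq a b n * (x - a)).

(** For each sign of [l], first integrals determine [phi] and its derivative on ]a, b[ explicitly;
    the derivative then extends continuously to the ends, where the boundary conditions can be
    imposed. A negative [l] forces phi = 0. *)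
Lemma Neumann_eigenpair_cosn a b l (phi : R -> R) : a < b ->
  Neumann_eigenpair a b l phi -> ~ (forall x, x \in `]a, b[ -> phi x = 0) ->
  exists n A, [/\ l = freq a b n ^+ 2, A != 0 &
    forall x, x \in `]a, b[ -> phi x = A * cosn a b n x].
Proof.
move=> ab [ode la lb] phi0.
have d1 x : x \in `]a, b[ -> is_derive x (1 : R) phi (derive1 phi x).
  by move=> /ode[h _ _]; exact: derive_pointE.
have d2 x : x \in `]a, b[ -> is_derive x (1 : R) (derive1 phi) (- (l * phi x)).
  move=> /ode[_ h <-]; rewrite opprK derive1nS derive1n1; exact: derive_pointE.
have ba0 : 0 < b - a by rewrite subr_gt0.
have fin n A : l = freq a b n ^+ 2 -> (forall x, x \in `]a, b[ -> phi x = A * cosn a b n x) ->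
  exists n A, [/\ l = freq a b n ^+ 2, A != 0 &
    forall x, x \in `]a, b[ -> phi x = A * cosn a b n x].
  move=> ln phiE; exists n, A; split => //; apply/eqP => A0.
  by apply: phi0 => x /phiE; rewrite A0 mul0r.
have [l0|l0|l0] := ltgtP l 0.
- pose m := Num.sqrt (- l).
  have m0 : 0 < m by rewrite sqrtr_gt0 oppr_gt0.
  have lE : l = - m ^+ 2 by rewrite sqr_sqrtr ?opprK// oppr_ge0 ltW.
  have [|k1 E1] := @derive0_constant a b
      (fun x => (derive1 phi x - m * phi x) * expR (m * (x - a))).
    move=> x xab.
    have := derive_mul (derive_sub (d2 x xab) (derive_scale m (d1 x xab)))
      (derive_exp_affine m a x).
    set d := (X in is_derive _ _ _ X).
    suff -> : d = 0 by [].
    by rewrite /d lE; ring.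
  have [|k2 E2] := @derive0_constant a b
      (fun x => (derive1 phi x + m * phi x) * expR (- m * (x - a))).
    move=> x xab.
    have := derive_mul (derive_add (d2 x xab) (derive_scale m (d1 x xab)))
      (derive_exp_affine (- m) a x).
    set d := (X in is_derive _ _ _ X).
    suff -> : d = 0 by [].
    by rewrite /d lE; ring.
  have F1 x : x \in `]a, b[ -> derive1 phi x - m * phi x = k1 * expR (- m * (x - a)).
    by move=> /E1 <-; rewrite mulNr expRN mulfK// gt_eqF// expR_gt0.
  have F2 x : x \in `]a, b[ -> derive1 phi x + m * phi x = k2 * expR (m * (x - a)).
    by move=> /E2 <-; rewrite mulNr expRN divfK// gt_eqF// expR_gt0.
  pose g x := 2^-1 * (k1 * expR (- m * (x - a)) + k2 * expR (m * (x - a))).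
  have gE x : x \in `]a, b[ -> derive1 phi x = g x.
    by move=> xab; rewrite /g -F1// -F2//; lra.
  have ce k : continuous (fun x : R => expR (k * (x - a))).
    exact: is_derive_continuous (derive_exp_affine k a).
  have cg : continuous g by rewrite /g; cts; exact: ce.
  have ga := cvg_at_right_itv ab gE cg la; have gb := cvg_at_left_itv ab gE cg lb.
  have ga' : k1 + k2 = 0.
    by move: ga; rewrite /g subrr !mulr0 expR0 !mulr1; lra.
  have k20 : k2 = 0.
    have k1E : k1 = - k2 by lra.
    have : k2 * (expR (m * (b - a)) - expR (- m * (b - a))) = 0.
      by move: gb; rewrite /g k1E; lra.
    move=> /eqP; rewrite mulf_eq0 => /orP[/eqP//|].
    rewrite gt_eqF// subr_gt0 ltr_expR mulNr.
    have mba0 : 0 < m * (b - a) by rewrite mulr_gt0.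
    lra.
  have k10 : k1 = 0 by lra.
  exfalso; apply: phi0 => x xab.
  have := F1 x xab; have := F2 x xab; rewrite k10 k20 !mul0r => e1 e2.
  have : 2 * (m * phi x) = 0 by lra.
  by move=> /eqP; rewrite !mulf_eq0 pnatr_eq0/= gt_eqF//= => /eqP.
- pose m := Num.sqrt l.
  have m0 : 0 < m by rewrite sqrtr_gt0.
  have lE : l = m ^+ 2 by rewrite sqr_sqrtr// ltW.
  have mn0 : m != 0 by rewrite gt_eqF.
  (* The vector (phi, phi'/m) rotates with angular speed m; its coordinates in the rotating frame,
     [k1] and [k2], are constant. *)
  have [|k1 E1] := @derive0_constant a b
      (fun x => phi x * cos (m * (x - a)) - m^-1 * (derive1 phi x * sin (m * (x - a)))).
    move=> x xab.
    have := derive_sub (derive_mul (d1 x xab) (derive_cos_affine m a x))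
      (derive_scale m^-1 (derive_mul (d2 x xab) (derive_sin_affine m a x))).
    set d := (X in is_derive _ _ _ X).
    suff -> : d = 0 by [].
    by rewrite /d lE; field.
  have [|k2 E2] := @derive0_constant a b
      (fun x => phi x * sin (m * (x - a)) + m^-1 * (derive1 phi x * cos (m * (x - a)))).
    move=> x xab.
    have := derive_add (derive_mul (d1 x xab) (derive_sin_affine m a x))
      (derive_scale m^-1 (derive_mul (d2 x xab) (derive_cos_affine m a x))).
    set d := (X in is_derive _ _ _ X).
    suff -> : d = 0 by [].
    by rewrite /d lE; field.
  have F1 x : x \in `]a, b[ -> phi x = k1 * cos (m * (x - a)) + k2 * sin (m * (x - a)).
    move=> xab; rewrite -(E1 x xab) -(E2 x xab).
    have := cos2Dsin2 (m * (x - a)); move: (cos _) (sin _) => C S CS.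
    by rewrite -[LHS]mulr1 -CS; ring.
  pose g x := m * (k2 * cos (m * (x - a)) - k1 * sin (m * (x - a))).
  have gE x : x \in `]a, b[ -> derive1 phi x = g x.
    move=> xab; rewrite /g -(E1 x xab) -(E2 x xab).
    have := cos2Dsin2 (m * (x - a)); move: (cos _) (sin _) => C S CS.
    by rewrite -[LHS]mulr1 -CS; field.
  have cc k : continuous (fun x : R => cos (k * (x - a))).
    exact: is_derive_continuous (derive_cos_affine k a).
  have cs k : continuous (fun x : R => sin (k * (x - a))).
    exact: is_derive_continuous (derive_sin_affine k a).
  have cg : continuous g by rewrite /g; cts; [exact: cc|exact: cs].
  have ga := cvg_at_right_itv ab gE cg la; have gb := cvg_at_left_itv ab gE cg lb.
  have k20 : k2 = 0.
    move: ga; rewrite /g subrr !mulr0 cos0 sin0 mulr0 subr0 mulr1 => /eqP.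
    by rewrite mulf_eq0 (negbTE mn0) => /eqP.
  have k1n0 : k1 != 0.
    apply/eqP => k10; apply: phi0 => x /F1 ->.
    by rewrite k10 k20 !mul0r addr0.
  have sb : sin (m * (b - a)) = 0.
    move: gb; rewrite /g k20 mul0r sub0r => /eqP.
    by rewrite mulf_eq0 (negbTE mn0)/= oppr_eq0 mulf_eq0 (negbTE k1n0) => /eqP.
  have [|n nE] := sin_eq0_nat _ sb; first by rewrite mulr_ge0 ?(ltW m0) ?(ltW ba0).
  have mE : m = freq a b n by rewrite /freq -nE mulfK// gt_eqF.
  apply: (fin n k1); first by rewrite lE mE.
  by move=> x /F1 ->; rewrite k20 mul0r addr0 mE.
- have [|k1 E1] := @derive0_constant a b (derive1 phi).
    by move=> x xab; have := d2 x xab; rewrite l0 mul0r oppr0.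
  have k10 : k1 = 0 by apply: (cvg_at_right_itv ab E1 _ la); exact: cts_cst.
  have [|k2 E2] := @derive0_constant a b phi.
    by move=> x xab; have := d1 x xab; rewrite E1// k10.
  apply: (fin 0%N k2); first by rewrite /freq l0 !mul0r expr0n.
  by move=> x /E2 ->; rewrite /cosn /freq !mul0r cos0 mulr1.
Qed.

End NeumannEigenfunctions.

(** * Orthogonality and completeness of the cosines *)

Section CosineSystem.
Context {R : realType}.
Local Notation mu := (@lebesgue_measure R).
Variables (a b : R).
Implicit Types (n m : nat) (f : R -> R).

Lemma integrable_bddM (D : set (measurableTypeR R)) f (h : R -> R) (C : R) : measurable D ->
  mu.-integrable D (EFin \o f) -> measurable_fun D h ->
  (forall x, D x -> `|h x| <= C) -> mu.-integrable D (EFin \o (fun t => f t * h t)).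
Proof.
move=> mD fi mh hC; have := @integrableMl _ _ _ mu D mD (EFin \o f) h fi mh.
apply; exists C; split; first exact: num_real.
by move=> M CM x Dx; apply: (le_trans (hC x Dx)); exact: ltW.
Qed.

Lemma continuous_cosn n : continuous (cosn a b n).
Proof. exact: is_derive_continuous (derive_cos_affine _ _). Qed.

Lemma cosn_le1 n x : `|cosn a b n x| <= 1.
Proof. exact: cos_max. Qed.

Lemma integrable_cosnM (D : set (measurableTypeR R)) f n : measurable D ->
  mu.-integrable D (EFin \o f) ->
  mu.-integrable D (EFin \o (fun t => f t * cosn a b n t)).
Proof.
move=> mD fi; apply: (@integrable_bddM _ _ _ 1) => //.
  by apply: measurable_funTS; apply: continuous_measurable_fun; exact: continuous_cosn.
by move=> x _; exact: cosn_le1.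
Qed.

Lemma L2_integrable f : L2 a b f -> mu.-integrable `]a, b[ (EFin \o f).
Proof.
move=> [mf f2].
have c1 : mu.-integrable `]a, b[ (EFin \o (cst 1 : R -> R)).
  apply: integrable_itv_oo.
  by apply: continuous_integrable; exact: cts_cst.
have := integrableRD (measurable_itv _) c1 f2.
apply: le_integrable => //; first exact/measurable_EFinP.
move=> x _ /=; rewrite lee_fin [leRHS]ger0_norm ?addr_ge0 ?sqr_ge0//.
have := normr_ge0 (f x); rewrite -(real_normK (num_real (f x))).
by move: `|f x| => y; nra.
Qed.

Hypothesis ab : a < b.
Let ba0 : 0 < b - a. Proof. by rewrite subr_gt0. Qed.

Lemma sin_freq n : sin (freq a b n * (b - a)) = 0.
Proof. by rewrite /freq divfK ?gt_eqF// sin_nat_pi. Qed.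

Definition sinn n (x : R) : R := sin (freq a b n * (x - a)).

Lemma continuous_sinn n : continuous (sinn n).
Proof. exact: is_derive_continuous (derive_sin_affine _ _). Qed.

Lemma freq_inj n m : freq a b n ^+ 2 = freq a b m ^+ 2 -> n = m.
Proof.
move=> /eqP; rewrite eqf_sqr.
have p0 := pi_gt0 R.
have f0 k : 0 <= freq a b k by rewrite /freq divr_ge0 ?(ltW ba0)// mulr_ge0// ltW.
have inj : freq a b n = freq a b m -> n = m.
  rewrite /freq => /(mulIf _) h; have := h (lt0r_neq0 _).
  rewrite invr_gt0 => /(_ ba0)/(mulIf (lt0r_neq0 p0))/eqP.
  by rewrite eqr_nat => /eqP.
move=> /orP[/eqP/inj//|/eqP h]; apply: inj.
by have := f0 n; have := f0 m; lra.
Qed.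

(** Common to sines and cosines: [g k l] is a Wronskian of two solutions, whose derivative is k^2 -
    l^2 times their product. *)
Let trig_orthogonal n m (f : R -> R) (g : R -> R -> R -> R) : n != m ->
  (forall k l x : R, is_derive x (1 : R) (g k l) ((k ^+ 2 - l ^+ 2) * (f (k * (x - a)) * f (l * (x - a))))) ->
  (forall k l, sin (k * (b - a)) = 0 -> sin (l * (b - a)) = 0 -> g k l b = g k l a) ->
  continuous f ->
  \int[mu]_(t in `[a, b]) (f (freq a b n * (t - a)) * f (freq a b m * (t - a))) = 0.
Proof.
move=> nm dg gab cf; set k := freq a b n; set l := freq a b m.
have kl : k ^+ 2 - l ^+ 2 != 0.
  by rewrite subr_eq0; apply: contra nm => /eqP/freq_inj ->.
have cfa r : continuous (fun t => f (r * (t - a))).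
  by apply: (@cts_comp _ f (fun t => r * (t - a))) => //; cts.
have := FTC2_global (ltW ab) _ (dg k l); rewrite gab ?sin_freq// subrr.
have cff : continuous (fun t => f (k * (t - a)) * f (l * (t - a))) by exact: ctsM.
rewrite RintegralZl//; last exact: continuous_integrable.
move=> /(_ _)/eqP; rewrite mulf_eq0 (negbTE kl) => h; apply/eqP/h.
by apply: ctsM => //; exact: cts_cst.
Qed.

Lemma cosn_orthogonal n m : n != m ->
  \int[mu]_(t in `[a, b]) (cosn a b n t * cosn a b m t) = 0.
Proof.
move=> nm; apply: (trig_orthogonal (f := cos) (g := fun k l x =>
  k * (sin (k * (x - a)) * cos (l * (x - a))) - l * (cos (k * (x - a)) * sin (l * (x - a))))) => //.
- move=> k l x; have := derive_sub
    (derive_scale k (derive_mul (derive_sin_affine k a x) (derive_cos_affine l a x)))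
    (derive_scale l (derive_mul (derive_cos_affine k a x) (derive_sin_affine l a x))).
  by congr (is_derive _ _ _ _); ring.
- by move=> k l kb lb; rewrite kb lb subrr !mulr0 sin0 !mul0r !mulr0.
- exact: continuous_cos.
Qed.

Lemma sinn_orthogonal n m : n != m ->
  \int[mu]_(t in `[a, b]) (sinn n t * sinn m t) = 0.
Proof.
move=> nm; apply: (trig_orthogonal (f := sin) (g := fun k l x =>
  l * (sin (k * (x - a)) * cos (l * (x - a))) - k * (cos (k * (x - a)) * sin (l * (x - a))))) => //.
- move=> k l x; have := derive_sub
    (derive_scale l (derive_mul (derive_sin_affine k a x) (derive_cos_affine l a x)))
    (derive_scale k (derive_mul (derive_cos_affine k a x) (derive_sin_affine l a x))).
  by congr (is_derive _ _ _ _); ring.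
- by move=> k l kb lb; rewrite kb lb subrr !mulr0 sin0 !mul0r !mulr0.
- exact: continuous_sin.
Qed.

Definition sqnorm n : R := if n is 0 then b - a else (b - a) / 2.

Lemma sqnorm_gt0 n : 0 < sqnorm n.
Proof. by case: n => [|n] //=; rewrite divr_gt0. Qed.

Lemma freq_gt0 n : 0 < freq a b n.+1.
Proof. by rewrite divr_gt0// mulr_gt0// ?pi_gt0// ltr0n. Qed.

(** The difference of the two integrals is an increment of sin cos, up to the frequency, hence 0;
    their sum is b - a. *)
Let cos_sin_sqr n :
  \int[mu]_(t in `[a, b]) (cosn a b n.+1 t ^+ 2) = (b - a) / 2 /\
  \int[mu]_(t in `[a, b]) (sinn n.+1 t ^+ 2) = (b - a) / 2.
Proof.
have := @continuous_cosn n.+1; have := @continuous_sinn n.+1.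
set k := freq a b n.+1 => cs cc.
have d x := derive_mul (derive_sin_affine k a x) (derive_cos_affine k a x).
have := FTC2_global (ltW ab) _ d.
rewrite !sin_freq subrr !mulr0 sin0 !mul0r subrr.
set f := (X in Rintegral _ _ X) => h0.
have fE : f = (fun t => k * (cosn a b n.+1 t ^+ 2 - sinn n.+1 t ^+ 2)).
  by apply/funext => t; rewrite /f /cosn /sinn -/k; ring.
have cc2 : continuous (fun t => cosn a b n.+1 t ^+ 2) by cts.
have cs2 : continuous (fun t => sinn n.+1 t ^+ 2) by cts.
have ci g : continuous g -> mu.-integrable `[a, b] (EFin \o g).
  exact: continuous_integrable.
have h1 : \int[mu]_(t in `[a, b]) (cosn a b n.+1 t ^+ 2) -
          \int[mu]_(t in `[a, b]) (sinn n.+1 t ^+ 2) = 0.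
  have : k * (\int[mu]_(t in `[a, b]) (cosn a b n.+1 t ^+ 2) -
          \int[mu]_(t in `[a, b]) (sinn n.+1 t ^+ 2)) = 0.
    rewrite -RintegralB//; try exact: ci.
    rewrite -RintegralZl//; last exact/ci/ctsB.
    have cf : continuous f by rewrite fE; apply: ctsM; [exact: cts_cst|exact: ctsB].
    by rewrite -fE; exact: h0.
  by move=> /eqP; rewrite mulf_eq0 gt_eqF ?freq_gt0//= => /eqP.
have h2 : \int[mu]_(t in `[a, b]) (cosn a b n.+1 t ^+ 2) +
          \int[mu]_(t in `[a, b]) (sinn n.+1 t ^+ 2) = b - a.
  rewrite -RintegralD//; try exact: ci.
  rewrite (@eq_Rintegral _ _ _ mu _ (cst 1)) ?Rintegral_itv_cst ?mul1r ?ltW//.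
  by move=> t _; rewrite /cosn /sinn cos2Dsin2.
by move: h1 h2; generalize_Rintegral; split; lra.
Qed.

Lemma cosn_sqnorm n : \int[mu]_(t in `[a, b]) (cosn a b n t * cosn a b n t) = sqnorm n.
Proof.
under eq_Rintegral do rewrite -expr2.
case: n => [|n]; last by have [] := cos_sin_sqr n.
rewrite (@eq_Rintegral _ _ _ mu _ (cst 1)) ?Rintegral_itv_cst ?mul1r ?ltW//.
by move=> t _; rewrite /cosn /freq !mul0r cos0 expr1n.
Qed.

Lemma sinn_sqnorm n : \int[mu]_(t in `[a, b]) (sinn n.+1 t * sinn n.+1 t) = (b - a) / 2.
Proof. by under eq_Rintegral do rewrite -expr2; have [] := cos_sin_sqr n. Qed.

Variables (lambda : nat -> R) (phi : nat -> R -> R).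
Hypothesis hphi : Neumann_eigensystem a b lambda phi.

Let phi_cosn k : exists n A, [/\ lambda k = freq a b n ^+ 2, A != 0 &
  forall x, x \in `]a, b[ -> phi k x = A * cosn a b n x].
Proof.
have [h1 _ h3 _] := hphi; apply: Neumann_eigenpair_cosn => // phi0.
have := h3 k k; rewrite eqxx /inner Rintegral_eq0.
  by move=> /eqP; rewrite eq_sym oner_eq0.
by move=> x; rewrite inE/= => /phi0 ->; rewrite mul0r.
Qed.

Let integrable_oo f : continuous f -> mu.-integrable `]a, b[ (EFin \o f).
Proof. by move=> cf; apply: integrable_itv_oo; exact: continuous_integrable. Qed.

Lemma cosine_system_total f : L2 a b f ->
  (forall n, \int[mu]_(t in `]a, b[) (f t * cosn a b n t) = 0) ->
  {ae mu, forall x, x \in `]a, b[ -> f x = 0}.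
Proof.
move=> f2 f0; have [_ _ _ tot] := hphi; apply: tot => // k.
have [n [A [_ _ phiE]]] := phi_cosn k.
rewrite /inner (@eq_Rintegral _ _ _ mu _ (fun x => A * (f x * cosn a b n x))).
  rewrite RintegralZl ?f0 ?mulr0//.
  by apply: integrable_cosnM => //; exact: L2_integrable.
by move=> x; rewrite inE/= => /phiE ->; rewrite mulrCA.
Qed.

(** Were this cosine missing from the system, it would be orthogonal to every [phi k], hence null by
    totality. *)
Lemma cosn_eigenfunction n : exists k A, [/\ lambda k = freq a b n ^+ 2, A != 0 &
  forall x, x \in `]a, b[ -> phi k x = A * cosn a b n x].
Proof.
apply: contrapT => none.
have cc m := @continuous_cosn m.
have e2 : L2 a b (cosn a b n).
  split; first by apply: measurable_funTS; exact: continuous_measurable_fun.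
  by apply: integrable_oo; cts; exact: cc.
have [_ _ _ tot] := hphi.
have cM m : continuous (fun t => cosn a b n t * cosn a b m t) by cts; exact: cc.
have : {ae mu, forall x, x \in `]a, b[ -> cosn a b n x = 0}.
  apply: tot => // k; have [m [A [lm A0 phiE]]] := phi_cosn k.
  have nm : n != m by apply/eqP => nm; apply: none; exists k, A; rewrite nm.
  rewrite /inner (@eq_Rintegral _ _ _ mu _ (fun x => A * (cosn a b n x * cosn a b m x))).
    rewrite RintegralZl//; last exact: integrable_oo.
    by rewrite Rintegral_itv_oo ?cosn_orthogonal ?mulr0//; exact: continuous_integrable.
  by move=> x; rewrite inE/= => /phiE ->; rewrite mulrCA.
move=> ae0.
have : \int[mu]_(t in `]a, b[) (cosn a b n t * cosn a b n t) = 0.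
  rewrite -[RHS](@Rintegral_eq0 _ `]a, b[%classic (cst 0))//; apply: ae_eq_Rintegral => //.
    by apply: measurable_funTS; exact: continuous_measurable_fun.
  by apply: ae_impl ae0 => x /= h xab; rewrite h// mul0r.
rewrite Rintegral_itv_oo ?cosn_sqnorm//; last exact: continuous_integrable.
by move=> /eqP; rewrite gt_eqF// sqnorm_gt0.
Qed.

(** Frees the rest of the proof from the given eigensystem, whose order and signs are arbitrary. *)
Lemma fractional_Laplacian_cosn s v p : mu.-integrable `]a, b[ (EFin \o v) ->
  fractional_Laplacian a b lambda phi s v p -> forall n,
  \int[mu]_(t in `]a, b[) (p t * cosn a b n t) =
  (freq a b n ^+ 2) `^ s * \int[mu]_(t in `]a, b[) (v t * cosn a b n t).
Proof.
move=> vi [pi pv] n; have [k [A [lk A0 phiE]]] := cosn_eigenfunction n.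
have inE (q : R -> R) : mu.-integrable `]a, b[ (EFin \o q) ->
    inner a b q (phi k) = A * \int[mu]_(t in `]a, b[) (q t * cosn a b n t).
  move=> qi; rewrite /inner (@eq_Rintegral _ _ _ mu _ (fun x => A * (q x * cosn a b n x))).
    by rewrite RintegralZl//; exact: integrable_cosnM.
  by move=> x; rewrite inE/= => /phiE ->; rewrite mulrCA.
have := pv k; rewrite !inE// lk => h; apply: (mulfI A0).
by rewrite h; ring.
Qed.

End CosineSystem.

(** * Uniqueness of coefficients in L^1 and absolutely convergent cosine series *)

Section CosineExpansion.
Context {R : realType}.
Local Notation mu := (@lebesgue_measure R).
Variables (a b : R).
Local Notation Omega := (`]a, b[%classic : set (measurableTypeR R)).
Hypothesis ab : a < b.
Hypothesis tot : forall f, L2 a b f ->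
  (forall n, \int[mu]_(t in `]a, b[) (f t * cosn a b n t) = 0) ->
  {ae mu, forall x, x \in `]a, b[ -> f x = 0}.
Implicit Types (n m : nat) (f : R -> R).

Lemma derive_eq0_oo f (f' : R -> R) : (forall x : R, is_derive x (1 : R) f (f' x)) ->
  (exists c, forall x, x \in `]a, b[ -> f x = c) -> forall x, x \in `]a, b[ -> f' x = 0.
Proof.
move=> df [c f0] x xab; have E : \near x, f x = cst c x.
  near=> t; rewrite f0//; near: t.
  by move: xab; rewrite in_itv/= => xab; exact: near_in_itvoo.
have := near_eq_is_derive E (df x); move=> [_ <-].
exact: derive_cst.
Unshelve. all: by end_near.
Qed.

Lemma ae_eq0_continuous f : continuous f ->
  {ae mu, forall x, x \in `]a, b[ -> f x = 0} -> forall x, x \in `]a, b[ -> f x = 0.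
Proof.
move=> cf f0; have [F dF] := antiderivative_exists cf.
apply: (derive_eq0_oo dF); exists (F ((a + b) / 2)) => x xab.
have wl y z : y \in `]a, b[ -> z \in `]a, b[ -> y <= z -> F y = F z.
  rewrite !in_itv/= => /andP[ay yb] /andP[az zb] yz.
  apply/esym/eqP; rewrite -subr_eq0 -(FTC2_global yz cf dF); apply/eqP.
  rewrite -[RHS](@Rintegral_eq0 _ `[y, z]%classic (cst 0))//; apply: ae_eq_Rintegral => //.
    by apply: measurable_funTS; exact: continuous_measurable_fun.
  apply: ae_impl f0 => t h; rewrite /= in_itv/= => /andP[yt tz]; apply: h.
  by rewrite in_itv/= (lt_le_trans ay yt) (le_lt_trans tz).
have mab : (a + b) / 2 \in `]a, b[.
  by move: xab; rewrite !in_itv/= => /andP[? ?]; apply/andP; split; lra.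
by have [/wl|/ltW/wl] := leP x ((a + b) / 2); [apply|move=> <-].
Qed.

(** Totality is known in L^2 and [f] is only in L^1, so [f] is integrated twice. The coefficient of
    index 0 makes the primitive [P] vanish at both ends; the others make it orthogonal to the sines.
    Its centred antiderivative [Q] is continuous and orthogonal to all cosines, hence 0, and then so
    are [P] and [f]. *)
Lemma cosine_coefficients_unique f : mu.-integrable `]a, b[ (EFin \o f) ->
  (forall n, \int[mu]_(t in `]a, b[) (f t * cosn a b n t) = 0) ->
  {ae mu, forall x, x \in `]a, b[ -> f x = 0}.
Proof.
move=> fi fc; pose f0 := f \_ Omega.
have f0T : mu.-integrable setT (EFin \o f0).
  exact: integrable_patch.
have f0i x y : mu.-integrable `[x, y] (EFin \o f0) by exact: integrableS f0T.
have f0E n : \int[mu]_(t in `[a, b]) (f0 t * cosn a b n t) = 0.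
  rewrite -Rintegral_itv_oo; last exact: integrable_cosnM.
  by rewrite -[RHS](fc n); apply: eq_Rintegral => t tab; rewrite /f0 patchE tab.
have [P0 pP0] := primitive_exists f0i.
pose P t := P0 t - P0 a.
have pP : primitive P f0.
  split=> [x y|x y xy]; first exact: f0i.
  by have [_ /(_ _ _ xy) <-] := pP0; rewrite /P; ring.
have Pa : P a = 0 by rewrite /P subrr.
have Pb : P b = 0.
  have [_ /(_ a b (ltW ab))] := pP; rewrite Pa subr0 => ->.
  rewrite -[RHS](f0E 0%N); apply: eq_Rintegral => t _.
  by rewrite /cosn /freq !mul0r cos0 mulr1.
have cP := primitive_continuous pP.
have ci g : continuous g -> mu.-integrable `[a, b] (EFin \o g).
  exact: continuous_integrable.
have Psin n : \int[mu]_(t in `[a, b]) (P t * sinn a b n.+1 t) = 0.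
  have pc : primitive (cosn a b n.+1) (fun t => - freq a b n.+1 * sinn a b n.+1 t).
    apply: is_derive_primitive; last exact: derive_cos_affine.
    by apply: ctsM; [exact: cts_cst|exact: continuous_sinn].
  have [_ /(_ a b (ltW ab))] := primitiveM pP pc.
  rewrite Pa Pb !mul0r subrr.
  have c1 : continuous (fun t => P t * sinn a b n.+1 t).
    by apply: ctsM => //; exact: continuous_sinn.
  have c2 : continuous (fun t => - freq a b n.+1 * (P t * sinn a b n.+1 t)).
    by apply: ctsM => //; exact: cts_cst.
  have -> : (fun t => f0 t * cosn a b n.+1 t + P t * (- freq a b n.+1 * sinn a b n.+1 t)) =
    (fun t => f0 t * cosn a b n.+1 t + - freq a b n.+1 * (P t * sinn a b n.+1 t)).
    by apply/funext => t; ring.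
  rewrite RintegralD//; [|exact: integrable_cosnM|exact: ci].
  rewrite f0E add0r RintegralZl//; last exact: ci.
  move=> /esym/eqP; rewrite mulf_eq0 oppr_eq0 gt_eqF ?freq_gt0//= => /eqP//.
have [Q0 dQ0] := antiderivative_exists cP.
(* Centring takes care of the constant mode, the only one that the sines say nothing about. *)
pose m := (\int[mu]_(t in `[a, b]) Q0 t) / (b - a).
pose Q t := Q0 t - m.
have dQ (x : R) : is_derive x (1 : R) Q (P x).
  by have := derive_sub (dQ0 x) (is_derive_cst m x (1 : R)); rewrite subr0.
have cQ := is_derive_continuous dQ; have cQ0 := is_derive_continuous dQ0.
have Qcos n : \int[mu]_(t in `[a, b]) (Q t * cosn a b n t) = 0.
  case: n => [|n].
    have -> : (fun t => Q t * cosn a b 0%N t) = (fun t => Q0 t - m).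
      by apply/funext => t; rewrite /cosn /freq !mul0r cos0 mulr1.
    have cm : continuous (fun _ : R => m) by exact: cts_cst.
    rewrite RintegralB//; try exact: ci.
    rewrite Rintegral_itv_cst ?ltW// /m divfK ?subrr// gt_eqF// subr_gt0//.
  have := FTC2_global (ltW ab) _ (fun x => derive_mul (dQ x)
     (derive_sin_affine (freq a b n.+1) a x)).
  rewrite sin_freq// subrr !mulr0 sin0 mulr0 subrr.
  have c1 : continuous (fun t => P t * sinn a b n.+1 t).
    by apply: ctsM => //; exact: continuous_sinn.
  have c2 : continuous (fun t => Q t * cosn a b n.+1 t).
    by apply: ctsM => //; exact: continuous_cosn.
  have c2' : continuous (fun t => freq a b n.+1 * (Q t * cosn a b n.+1 t)).
    by apply: ctsM => //; exact: cts_cst.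
  set h := (X in Rintegral _ _ X) => h0.
  have hE : h = (fun t => P t * sinn a b n.+1 t + freq a b n.+1 * (Q t * cosn a b n.+1 t)).
    by apply/funext => t; rewrite /h /cosn /sinn; ring.
  have ch : continuous h by rewrite hE; exact: ctsD.
  have := h0 ch; rewrite hE RintegralD//; try exact: ci.
  rewrite Psin add0r RintegralZl//; last exact: ci.
  by move=> /eqP; rewrite mulf_eq0 gt_eqF ?freq_gt0//= => /eqP.
have Q0ae : {ae mu, forall x, x \in `]a, b[ -> Q x = 0}.
  apply: tot => [|n].
    split; first by apply: measurable_funTS; exact: continuous_measurable_fun.
    apply: integrable_itv_oo.
    by apply: ci; exact: ctsX.
  by rewrite Rintegral_itv_oo//; apply: ci; apply: ctsM => //; exact: continuous_cosn.
have Qz := ae_eq0_continuous cQ Q0ae.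
have Pz : forall x, x \in `]a, b[ -> P x = 0.
  by apply: (derive_eq0_oo dQ); exists 0.
have : {ae mu, forall x, x \in `]a, b[ -> f0 x = 0}.
  apply: ae_eq0_Rintegral => [x y _ _|x y ax xy yb]; first exact: f0i.
  have [_ /(_ _ _ xy) <-] := pP; rewrite !Pz ?subrr// in_itv/= ?ax ?yb ?andbT.
    exact: le_lt_trans yb.
  exact: lt_le_trans xy.
by apply: ae_impl => x h xab; rewrite -h// /f0 patchE mem_setE xab.
Qed.

Section Expansion.
Variable d : nat -> R.
Hypothesis dcv : cvgn (series (fun n => `|d n|)).

Definition cosine_series x := limn (series (fun k => d k * cosn a b k x)).

Let dE n : series (fun k => `|d k|) n <= limn (series (fun k => `|d k|)).
Proof.
apply: nondecreasing_cvgn_le => //; apply: nondecreasing_series => k _ _.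
exact: normr_ge0.
Qed.

Lemma cvg_cosine_series x :
  series (fun k => d k * cosn a b k x) @ \oo --> cosine_series x.
Proof.
apply: normed_cvg; apply: series_le_cvg dcv => n; rewrite ?normr_ge0//=.
by rewrite normrM ler_piMr ?normr_ge0// cosn_le1.
Qed.

Let partial_le n x : `|series (fun k => d k * cosn a b k x) n| <= limn (series (fun k => `|d k|)).
Proof.
apply: le_trans (dE n); rewrite /series/=; apply: le_trans (ler_norm_sum _ _ _) _.
by apply: ler_sum => k _; rewrite normrM ler_piMr ?normr_ge0// cosn_le1.
Qed.

Let continuous_partial n : continuous (fun x => series (fun k => d k * cosn a b k x) n).
Proof.
elim: n => [|n IH].
  by under eq_fun do rewrite /series/= big_nil; exact: cts_cst.
under eq_fun do rewrite seriesSr.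
by apply: ctsD => //; apply: ctsM; [exact: cts_cst|exact: continuous_cosn].
Qed.

Lemma cosine_series_le x : `|cosine_series x| <= limn (series (fun k => `|d k|)).
Proof.
have h : `|series (fun k => d k * cosn a b k x) n| @[n --> \oo] --> `|cosine_series x|.
  by apply: cvg_norm; exact: cvg_cosine_series.
rewrite -(cvg_lim (@Rhausdorff R) h); apply: limr_le; first exact: cvgP h.
by apply: nearW => n; exact: partial_le.
Qed.

Lemma measurable_cosine_series : measurable_fun [set: measurableTypeR R] cosine_series.
Proof.
apply: (measurable_fun_cvg (h := fun n x => series (fun k => d k * cosn a b k x) n)).
  by move=> n; exact: continuous_measurable_fun.
by move=> x _; exact: cvg_cosine_series.
Qed.

Lemma Rintegral_cosine_series q : mu.-integrable `]a, b[ (EFin \o q) ->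
  (fun n => series (fun k => d k * \int[mu]_(t in `]a, b[) (q t * cosn a b k t)) n) @ \oo -->
  \int[mu]_(t in `]a, b[) (q t * cosine_series t).
Proof.
move=> qi; set C := limn (series (fun k => `|d k|)).
have mq : measurable_fun Omega q.
  exact: integrable_measurable qi.
have -> : (fun n => series (fun k => d k * \int[mu]_(t in `]a, b[) (q t * cosn a b k t)) n) =
  (fun n => \int[mu]_(t in `]a, b[) (q t * series (fun k => d k * cosn a b k t) n)).
  apply/funext => n; elim: n => [|n IH].
    rewrite /series/= big_nil Rintegral_eq0// => t _.
    by rewrite big_nil mulr0.
  rewrite seriesSr IH [RHS](@eq_Rintegral _ _ _ mu _ (fun t => d n * (q t * cosn a b n t) +
     q t * series (fun k => d k * cosn a b k t) n)); last first.
    by move=> t _; rewrite seriesSr; ring.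
  have i1 := @integrable_cosnM _ a b _ _ n (measurable_itv _) qi.
  rewrite RintegralD//; last 2 first.
  - exact: integrableRZ.
  - apply: (@integrable_bddM _ _ _ _ C) => //.
    by apply: measurable_funTS; exact: continuous_measurable_fun.
  by rewrite RintegralZl// addrC.
apply: (@dominated_Rintegral _ _ _ _ (fun t => C * `|q t|)) => //.
- move=> n; apply: measurable_funM => //.
  by apply: measurable_funTS; exact: continuous_measurable_fun.
- by apply: measurable_funM => //; apply: measurable_funTS; exact: measurable_cosine_series.
- by move=> x _; apply: cvgM; [exact: cvg_cst|exact: cvg_cosine_series].
- by apply: integrableRZ => //; exact: integrable_norm.
- by move=> n x _; rewrite normrM mulrC ler_wpM2r// partial_le.
Qed.

End Expansion.
End CosineExpansion.

(** * Expansion almost everywhere and Parseval's formula *)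

Section ExpansionAE.
Context {R : realType}.
Local Notation mu := (@lebesgue_measure R).
Variables (a b : R).
Local Notation Omega := (`]a, b[%classic : set (measurableTypeR R)).
Hypothesis ab : a < b.
Hypothesis tot : forall f, L2 a b f ->
  (forall n, \int[mu]_(t in `]a, b[) (f t * cosn a b n t) = 0) ->
  {ae mu, forall x, x \in `]a, b[ -> f x = 0}.
Variables (f : R -> R) (d : nat -> R).
Hypothesis fi : mu.-integrable `]a, b[ (EFin \o f).
Hypothesis dcv : cvgn (series (fun n => `|d n|)).
Hypothesis fd : forall n,
  \int[mu]_(t in `]a, b[) (f t * cosn a b n t) = d n * sqnorm a b n.

Let S := cosine_series a b d.

Let mS : measurable_fun Omega S.
Proof. by apply: measurable_funTS; exact: measurable_cosine_series. Qed.

Lemma integrable_cosine_seriesM q : mu.-integrable `]a, b[ (EFin \o q) ->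
  mu.-integrable `]a, b[ (EFin \o (fun t => q t * S t)).
Proof.
move=> qi; apply: (@integrable_bddM _ _ _ _ (limn (series (fun k => `|d k|)))) => //.
by move=> x _; exact: cosine_series_le.
Qed.

Let ic n : mu.-integrable `]a, b[ (EFin \o cosn a b n).
Proof.
apply: integrable_itv_oo.
by apply: continuous_integrable; exact: continuous_cosn.
Qed.

Lemma cosine_expansion : {ae mu, forall x, x \in `]a, b[ -> f x = S x}.
Proof.
have Si : mu.-integrable `]a, b[ (EFin \o S).
  have c1 : mu.-integrable `]a, b[ (EFin \o (cst 1 : R -> R)).
    apply: integrable_itv_oo.
    by apply: continuous_integrable; exact: cts_cst.
  have := integrable_cosine_seriesM c1; apply: eq_integrable => // t _ /=.
  by rewrite mul1r.
have Sc n : \int[mu]_(t in `]a, b[) (S t * cosn a b n t) = d n * sqnorm a b n.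
  have -> : \int[mu]_(t in `]a, b[) (S t * cosn a b n t) =
            \int[mu]_(t in `]a, b[) (cosn a b n t * S t).
    by apply: eq_Rintegral => t _; rewrite mulrC.
  have L := Rintegral_cosine_series dcv (ic n).
  rewrite -(cvg_lim (@Rhausdorff R) L); apply: lim_near_cst; first exact: Rhausdorff.
  near=> N; have nN : (n < N)%N by near: N; exact: nbhs_infty_gt.
  rewrite /series/= (big_mkord xpredT) (bigD1 (Ordinal nN))//= big1 ?addr0 => [|k kn].
    by rewrite Rintegral_itv_oo ?cosn_sqnorm//; apply: continuous_integrable; apply: ctsM; exact: continuous_cosn.
  rewrite Rintegral_itv_oo ?cosn_orthogonal ?mulr0//.
    by apply: contra kn => /eqP E; apply/eqP/val_inj.
  by apply: continuous_integrable; apply: ctsM; exact: continuous_cosn.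
have : {ae mu, forall x, x \in `]a, b[ -> f x - S x = 0}.
  apply: cosine_coefficients_unique => // [|n]; first exact: integrableRB.
  have i1 := @integrable_cosnM _ a b _ _ n (measurable_itv _) fi.
  have i2 := @integrable_cosnM _ a b _ _ n (measurable_itv _) Si.
  under eq_Rintegral do rewrite mulrBl.
  by rewrite RintegralB// fd Sc subrr.
by apply: ae_impl => x h /h /eqP; rewrite subr_eq0 => /eqP.
Unshelve. all: by end_near.
Qed.

(** The absolute convergence of the series of [f] lets the other factor be merely integrable. This
    matters for q = p, which may fail to be in L^2. *)
Lemma parseval_cvg q : mu.-integrable `]a, b[ (EFin \o q) ->
  mu.-integrable `]a, b[ (EFin \o (fun t => q t * f t)) /\
  (fun n => series (fun k => d k * \int[mu]_(t in `]a, b[) (q t * cosn a b k t)) n) @ \oo -->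
  \int[mu]_(t in `]a, b[) (q t * f t).
Proof.
move=> qi; have fS := cosine_expansion.
have mq : measurable_fun Omega q.
  exact: integrable_measurable qi.
have mf : measurable_fun Omega f.
  exact: integrable_measurable fi.
have E : {ae mu, forall x, `]a, b[%classic x -> q x * S x = q x * f x}.
  by apply: ae_impl fS => x h xab; rewrite h.
split.
  apply: ae_eq_integrable E (integrable_cosine_seriesM qi) => //.
  exact: measurable_funM.
rewrite -(ae_eq_Rintegral _ _ _ E)//; [|exact: measurable_funM|exact: measurable_funM].
exact: Rintegral_cosine_series.
Qed.

End ExpansionAE.

(** * Decay of the cosine coefficients *)

Section Summability.
Context {R : realType}.
Local Notation mu := (@lebesgue_measure R).
Implicit Types (n : nat).

Lemma cvg_series_shift (u : nat -> R) : (forall n, 0 <= u n) ->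
  cvgn (series (fun n => u n.+1)) -> cvgn (series u).
Proof.
move=> u0 cu; apply: nondecreasing_is_cvgn; first exact: nondecreasing_series.
exists (u 0%N + limn (series (fun n => u n.+1))) => _ [n _ <-].
apply: (@le_trans _ _ (series u n.+1)); first by rewrite seriesSr lerDl.
have -> : series u n.+1 = u 0%N + series (fun n => u n.+1) n.
  by rewrite /series/= big_nat_recl.
rewrite lerD2l; apply: nondecreasing_cvgn_le => //.
by apply: nondecreasing_series => k _ _; exact: u0.
Qed.

Lemma mulr_powRB1' (x s : R) : 0 < x -> x `^ s = x * x `^ (s - 1).
Proof.
move=> x0; rewrite -[X in X * _](powRr1 (ltW x0)) -powRD ?(gt_eqF x0) ?implybT//.
by congr (_ `^ _); ring.
Qed.

(** A discrete form of the comparison with an integral. It follows from ln(1 - y) <= - y and 1 + z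
    <= exp z, at y = 1 / (x + 1) and z = d y. *)
Lemma powR_telescope (d x : R) : 0 < d -> 0 < x ->
  (x + 1) `^ (- (d + 1)) <= d^-1 * (x `^ (- d) - (x + 1) `^ (- d)).
Proof.
move=> d0 x0; have x10 : 0 < x + 1 by lra.
rewrite ler_pdivlMl//.
have -> : (x + 1) `^ (- (d + 1)) = (x + 1) `^ (- d) * (x + 1)^-1.
  by rewrite opprD powRD ?(gt_eqF x10) ?implybT// powR_inv1// ltW.
have lnx : ln x <= ln (x + 1) - (x + 1)^-1.
  have := @le_ln1Dx R (- (x + 1)^-1).
  have -> : 1 - (x + 1)^-1 = x / (x + 1) by field; rewrite gt_eqF.
  rewrite ltrN2 invf_lt1// ltrDr x0 => /(_ isT).
  by rewrite ln_div ?posrE//; lra.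
have xE : x `^ (- d) = expR (- d * ln x) by rewrite /powR gt_eqF.
have x1E : (x + 1) `^ (- d) = expR (- d * ln (x + 1)) by rewrite /powR gt_eqF.
have h1 : expR (- d * ln (x + 1) + d * (x + 1)^-1) <= x `^ (- d).
  by rewrite xE ler_expR; nra.
rewrite expRD -x1E in h1.
have h2 := expR_ge1Dx (d * (x + 1)^-1).
have h3 : 0 < (x + 1) `^ (- d) by exact: powR_gt0.
move: h1 h2 h3; move: (expR (d * _)) => E; move: ((x + 1) `^ (- d)) => P.
move: (x `^ _) => Q; move: ((x + 1)^-1) => y h1 h2 h3.
have h4 : P * (1 + d * y) <= P * E by rewrite ler_pM2l.
by lra.
Qed.

Lemma cvg_series_powR (r : R) : 1 < r -> cvgn (series (fun n => n.+1%:R `^ (- r) : R)).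
Proof.
move=> r1; pose d := r - 1; have d0 : 0 < d by rewrite subr_gt0.
have rE : r = d + 1 by rewrite /d; ring.
apply: nondecreasing_is_cvgn.
  by apply: nondecreasing_series => n _ _; exact: powR_ge0.
exists (1 + d^-1) => _ [N _ <-].
have dV : 0 < d^-1 by rewrite invr_gt0.
have key n : series (fun n => n.+1%:R `^ (- r) : R) n.+1 <=
    1 + d^-1 * (1 - n.+1%:R `^ (- d)).
  elim: n => [|n IH].
    by rewrite seriesSr /series/= big_nil add0r !powR1 subrr mulr0 addr0.
  rewrite seriesSr; apply: le_trans (lerD IH (_ : _ <= d^-1 * (n.+1%:R `^ (- d) - n.+2%:R `^ (- d)))) _.
    by rewrite rE -[n.+2%:R]natr1; apply: powR_telescope => //; rewrite ltr0n.
  by rewrite le_eqVlt; apply/orP; left; apply/eqP; ring.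
case: N => [|N]; first by rewrite /series/= big_nil addr_ge0// ltW.
by apply: le_trans (key N) _; rewrite lerD2l ler_piMr ?(ltW dV)// gerBl powR_ge0.
Qed.

Variables (a b : R).
Hypothesis ab : a < b.
Let ba0 : 0 < b - a. Proof. by rewrite subr_gt0. Qed.
Let be := ((b - a) / 2)^-1.
Let be0 : 0 < be. Proof. by rewrite invr_gt0 divr_gt0. Qed.

Let ci f : continuous f -> mu.-integrable `[a, b] (EFin \o f).
Proof. exact: continuous_integrable. Qed.

(** Bessel's inequality. The [P] of [key] is the N-th partial sine sum of [D], built by induction
    along with its products with [D] and with itself; the bound is that (D - P)^2 has a nonnegative
    integral. *)
Lemma bessel_sinn (D : R -> R) : mu.-integrable `[a, b] (EFin \o D) ->
  mu.-integrable `[a, b] (EFin \o (fun t => D t ^+ 2)) ->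
  cvgn (series (fun n => (\int[mu]_(t in `[a, b]) (D t * sinn a b n.+1 t)) ^+ 2)).
Proof.
move=> Di D2i; pose c n := \int[mu]_(t in `[a, b]) (D t * sinn a b n.+1 t).
have cs n : continuous (sinn a b n) by exact: continuous_sinn.
have key N : exists P : R -> R, [/\ continuous P,
    \int[mu]_(t in `[a, b]) (D t * P t) = be * series (fun n => c n ^+ 2) N,
    \int[mu]_(t in `[a, b]) (P t * P t) = be * series (fun n => c n ^+ 2) N &
    forall m, (N <= m)%N -> \int[mu]_(t in `[a, b]) (P t * sinn a b m.+1 t) = 0].
  elim: N => [|N [P [cP DP PP Ps]]].
    exists (fun=> 0); split; first exact: cts_cst.
    - by rewrite /series/= big_nil mulr0 Rintegral_eq0// => t _; exact: mulr0.
    - by rewrite /series/= big_nil !mulr0 Rintegral_eq0.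
    - by move=> m _; rewrite Rintegral_eq0// => t _; rewrite mul0r.
  exists (fun t => P t + be * c N * sinn a b N.+1 t).
  have cP' : continuous (fun t => P t + be * c N * sinn a b N.+1 t).
    by apply: ctsD => //; apply: ctsM; [exact: cts_cst|exact: cs].
  have c1 : continuous (fun t => P t * sinn a b N.+1 t) by exact: ctsM.
  have c2 : continuous (fun t => sinn a b N.+1 t * sinn a b N.+1 t) by exact: ctsM.
  have c3 : continuous (fun t => P t * P t) by exact: ctsM.
  have c1' (k : R) : continuous (fun t => k * (P t * sinn a b N.+1 t)).
    by apply: ctsM => //; exact: cts_cst.
  have c2' (k : R) : continuous (fun t => k * (sinn a b N.+1 t * sinn a b N.+1 t)).
    by apply: ctsM => //; exact: cts_cst.
  split => //.
  - rewrite (@eq_Rintegral _ _ _ mu _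
      (fun t => D t * P t + be * c N * (D t * sinn a b N.+1 t))); last first.
      by move=> t _; ring.
    have i1 : mu.-integrable `[a, b] (EFin \o (fun t => D t * P t)).
      exact: integrable_continuousM.
    have i2 : mu.-integrable `[a, b] (EFin \o (fun t => D t * sinn a b N.+1 t)).
      by apply: integrable_continuousM => //; exact: cs.
    rewrite RintegralD//; last exact: integrableRZ.
    by rewrite RintegralZl// DP -/(c N) seriesSr; ring.
  - rewrite (@eq_Rintegral _ _ _ mu _ (fun t => P t * P t +
      ((2 * be * c N) * (P t * sinn a b N.+1 t) +
       (be * c N) ^+ 2 * (sinn a b N.+1 t * sinn a b N.+1 t)))); last first.
      by move=> t _; ring.
    rewrite RintegralD//; [|exact: ci|by apply: ci; exact: ctsD].
    rewrite RintegralD//; [|exact: ci|exact: ci].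
    rewrite !RintegralZl//; [|exact: ci|exact: ci].
    rewrite PP Ps// sinn_sqnorm// seriesSr /be; field.
    by rewrite gt_eqF.
  - move=> m Nm; rewrite (@eq_Rintegral _ _ _ mu _ (fun t => P t * sinn a b m.+1 t +
      be * c N * (sinn a b N.+1 t * sinn a b m.+1 t))); last first.
      by move=> t _; ring.
    have d1 : continuous (fun t => P t * sinn a b m.+1 t) by exact: ctsM.
    have d2 : continuous (fun t => sinn a b N.+1 t * sinn a b m.+1 t) by exact: ctsM.
    rewrite RintegralD//; [|exact: ci|]; last first.
      by apply: ci; apply: ctsM => //; exact: cts_cst.
    rewrite RintegralZl//; last exact: ci.
    rewrite Ps ?(ltnW Nm)// sinn_orthogonal// ?mulr0 ?addr0//.
    by rewrite eqSS neq_ltn Nm.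
apply: nondecreasing_is_cvgn.
  by apply: nondecreasing_series => n _ _; exact: sqr_ge0.
exists (be^-1 * \int[mu]_(t in `[a, b]) (D t ^+ 2)) => _ [N _ <-].
have [P [cP DP PP _]] := key N.
rewrite ler_pdivlMl//.
have i1 : mu.-integrable `[a, b] (EFin \o (fun t => D t * P t)).
  exact: integrable_continuousM.
have c3 : continuous (fun t => P t * P t) by exact: ctsM.
have i1' : mu.-integrable `[a, b] (EFin \o (fun t => 2 * (D t * P t))).
  exact: integrableRZ.
have i3 : mu.-integrable `[a, b] (EFin \o (fun t => P t * P t)) by exact: ci.
have : 0 <= \int[mu]_(t in `[a, b]) (D t ^+ 2 - 2 * (D t * P t) + P t * P t).
  apply: Rintegral_ge0 => t _.
  have -> : D t ^+ 2 - 2 * (D t * P t) + P t * P t = (D t - P t) ^+ 2 by ring.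
  exact: sqr_ge0.
rewrite RintegralD//; last exact: integrableRB.
rewrite RintegralB// RintegralZl// DP PP.
rewrite /c; generalize_Rintegral; move: (be * _) => y; lra.
Qed.

Lemma cosn_coefficient (V D : R -> R) n : primitive V D ->
  freq a b n.+1 * \int[mu]_(t in `[a, b]) (V t * cosn a b n.+1 t) =
  - \int[mu]_(t in `[a, b]) (D t * sinn a b n.+1 t).
Proof.
move=> pV; have cV := primitive_continuous pV; have [Di _] := pV.
have ps : primitive (sinn a b n.+1) (fun t => freq a b n.+1 * cosn a b n.+1 t).
  apply: is_derive_primitive; last exact: derive_sin_affine.
  by apply: ctsM; [exact: cts_cst|exact: continuous_cosn].
have [_ /(_ a b (ltW ab))] := primitiveM pV ps.
rewrite /sinn sin_freq// subrr !mulr0 sin0 mulr0 subrr -/(sinn a b n.+1).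
have i1 : mu.-integrable `[a, b] (EFin \o (fun t => D t * sinn a b n.+1 t)).
  by apply: integrable_continuousM => //; exact: continuous_sinn.
have c1 : continuous (fun t => V t * cosn a b n.+1 t).
  by apply: ctsM => //; exact: continuous_cosn.
have c2 : continuous (fun t => freq a b n.+1 * (V t * cosn a b n.+1 t)).
  by apply: ctsM => //; exact: cts_cst.
rewrite (@eq_Rintegral _ _ _ mu _ (fun t => D t * sinn a b n.+1 t +
  freq a b n.+1 * (V t * cosn a b n.+1 t))); last first.
  by move=> t _; rewrite /sinn; ring.
rewrite RintegralD//; last exact: ci.
rewrite RintegralZl//; last exact: ci.
by generalize_Rintegral; lra.
Qed.

(** A second integration by parts. [D] need not vanish at the ends, so boundary terms survive and
    the rate obtained is 1/n. *)
Lemma sinn_coefficient (D D2 : R -> R) n : primitive D D2 ->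
  freq a b n.+1 * `|\int[mu]_(t in `[a, b]) (D t * sinn a b n.+1 t)| <=
  `|D a| + `|D b| + \int[mu]_(t in `[a, b]) `|D2 t|.
Proof.
move=> pD; have cD := primitive_continuous pD; have [Di _] := pD.
have pc : primitive (cosn a b n.+1) (fun t => - freq a b n.+1 * sinn a b n.+1 t).
  apply: is_derive_primitive; last exact: derive_cos_affine.
  by apply: ctsM; [exact: cts_cst|exact: continuous_sinn].
have [_ /(_ a b (ltW ab))] := primitiveM pD pc.
have i1 : mu.-integrable `[a, b] (EFin \o (fun t => D2 t * cosn a b n.+1 t)).
  by apply: integrable_continuousM => //; exact: continuous_cosn.
have c1 : continuous (fun t => D t * sinn a b n.+1 t).
  by apply: ctsM => //; exact: continuous_sinn.
have c2 : continuous (fun t => - freq a b n.+1 * (D t * sinn a b n.+1 t)).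
  by apply: ctsM => //; exact: cts_cst.
rewrite (@eq_Rintegral _ _ _ mu _ (fun t => D2 t * cosn a b n.+1 t +
  - freq a b n.+1 * (D t * sinn a b n.+1 t))); last first.
  by move=> t _; ring.
rewrite RintegralD//; last exact: ci.
rewrite RintegralZl//; last exact: ci.
have h1 : `|\int[mu]_(t in `[a, b]) (D2 t * cosn a b n.+1 t)| <=
   \int[mu]_(t in `[a, b]) `|D2 t|.
  apply: le_trans (le_normr_Rintegral _ i1) _ => //.
  apply: le_Rintegral => //; [exact: integrable_norm|exact: integrable_norm|].
  by move=> t _; rewrite normrM ler_piMr// cosn_le1.
have ha : `|D a * cosn a b n.+1 a| <= `|D a| by rewrite normrM ler_piMr// cosn_le1.
have hb : `|D b * cosn a b n.+1 b| <= `|D b| by rewrite normrM ler_piMr// cosn_le1.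
rewrite -{2}(gtr0_norm (freq_gt0 ab n)) -normrM.
move: h1 ha hb; rewrite !ler_norml; generalize_Rintegral.
by move=> /andP[? ?] /andP[? ?] /andP[? ?] ?; apply/andP; split; lra.
Qed.

Definition cosine_coef (V : R -> R) n :=
  (\int[mu]_(t in `[a, b]) (V t * cosn a b n t)) / sqnorm a b n.

Let kap := pi / (b - a).
Let kap0 : 0 < kap. Proof. by rewrite divr_gt0// pi_gt0. Qed.
Let freqE n : freq a b n = n%:R * kap. Proof. by rewrite /freq mulrA. Qed.

Let cosine_coefE (V D : R -> R) n : primitive V D -> `|cosine_coef V n.+1| =
  be * (`|\int[mu]_(t in `[a, b]) (D t * sinn a b n.+1 t)| / (n.+1%:R * kap)).
Proof.
move=> pV; have := cosn_coefficient n pV; rewrite freqE => hc.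
have nk0 : 0 < n.+1%:R * kap by rewrite mulr_gt0// ltr0n.
rewrite /cosine_coef /sqnorm -/be -[Rintegral _ _ _](mulKf (lt0r_neq0 nk0)) hc.
rewrite !normrM normrN normfV (gtr0_norm nk0) (gtr0_norm be0).
by rewrite mulrC; congr (_ * _); rewrite mulrC.
Qed.

(** With [c n] the sine coefficients of [D], the general term is of size |c n| n^(s-1), at most a
    sum of c n ^ 2, handled by Bessel, and n^(2s-2), summable exactly when s < 1/2. *)
Lemma summable_cosine_coef_H1 (V D : R -> R) (rho : nat -> R) (K s : R) : primitive V D ->
  mu.-integrable `[a, b] (EFin \o (fun t => D t ^+ 2)) -> s < 2^-1 -> 0 <= K ->
  (forall n, `|rho n.+1| <= K * n.+1%:R `^ s) ->
  cvgn (series (fun n => `|cosine_coef V n * rho n|)).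
Proof.
move=> pV D2i s12 K0 rhoK; have [Di _] := pV.
pose c n := \int[mu]_(t in `[a, b]) (D t * sinn a b n.+1 t).
have cb : cvgn (series (fun n => c n ^+ 2)) by exact: bessel_sinn.
have cr : cvgn (series (fun n => n.+1%:R `^ (- (2 - 2 * s)) : R)).
  by apply: cvg_series_powR; lra.
apply: cvg_series_shift => [n|]; first exact: normr_ge0.
pose C := be * kap^-1 * K.
have C0 : 0 <= C by rewrite !mulr_ge0 ?(ltW be0)// invr_ge0 ltW.
apply: (@series_le_cvg _ _ (fun n => C * (c n ^+ 2 + n.+1%:R `^ (- (2 - 2 * s))))).
- by move=> n; exact: normr_ge0.
- by move=> n; rewrite mulr_ge0// addr_ge0 ?sqr_ge0 ?powR_ge0.
- move=> n; have n0 : 0 < n.+1%:R :> R by rewrite ltr0n.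
  rewrite normrM (cosine_coefE n pV) -/(c n).
  pose P := n.+1%:R `^ (s - 1) : R.
  have P2 : n.+1%:R `^ (- (2 - 2 * s)) = P ^+ 2.
    rewrite /P expr2 -powRD ?(gt_eqF n0) ?implybT//; congr (_ `^ _); ring.
  have PE : n.+1%:R `^ s = n.+1%:R * P.
    by rewrite /P mulr_powRB1' //.
  rewrite P2.
  apply: (@le_trans _ _ (C * (`|c n| * P))); last first.
    rewrite ler_wpM2l// -(real_normK (num_real (c n))).
    apply: le_trans (mulr_le_quarter_sqr _ _) _.
    by rewrite lerD2r ler_piMl ?sqr_ge0// invf_le1// ler1n.
  apply: (@le_trans _ _ (be * (`|c n| / (n.+1%:R * kap)) * (K * (n.+1%:R * P)))).
    rewrite -PE; apply: ler_wpM2l => //; apply: mulr_ge0; first exact: ltW.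
    by apply: divr_ge0; rewrite ?normr_ge0// ltW// mulr_gt0.
  rewrite le_eqVlt; apply/orP; left; apply/eqP; rewrite /C; field.
  by rewrite !gt_eqF.
- have h1 := is_cvg_seriesD cb cr.
  exact: (@is_cvg_seriesZ R _ C h1).
Qed.

(** Two integrations by parts give coefficients of size n^(-2), and n^(s-2) is summable for s <
    1. *)
Lemma summable_cosine_coef_H2 (V D D2 : R -> R) (rho : nat -> R) (K s : R) :
  primitive V D -> primitive D D2 -> s < 1 -> 0 <= K ->
  (forall n, `|rho n.+1| <= K * n.+1%:R `^ s) ->
  cvgn (series (fun n => `|cosine_coef V n * rho n|)).
Proof.
move=> pV pD s1 K0 rhoK.
pose c n := \int[mu]_(t in `[a, b]) (D t * sinn a b n.+1 t).
have cr : cvgn (series (fun n => n.+1%:R `^ (- (2 - s)) : R)).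
  by apply: cvg_series_powR; lra.
apply: cvg_series_shift => [n|]; first exact: normr_ge0.
pose M := `|D a| + `|D b| + \int[mu]_(t in `[a, b]) `|D2 t|.
have M0 : 0 <= M by rewrite !addr_ge0// Rintegral_ge0.
pose C := be * kap^-1 ^+ 2 * M * K.
have C0 : 0 <= C.
  by apply: mulr_ge0 => //; apply: mulr_ge0 => //; apply: mulr_ge0; [exact: ltW|exact: sqr_ge0].
apply: (@series_le_cvg _ _ (fun n => C * n.+1%:R `^ (- (2 - s)))).
- by move=> n; exact: normr_ge0.
- by move=> n; rewrite mulr_ge0// powR_ge0.
- move=> n; have n0 : 0 < n.+1%:R :> R by rewrite ltr0n.
  have := sinn_coefficient n pD; rewrite -/(c n) -/M freqE => hM.
  rewrite normrM (cosine_coefE n pV) -/(c n).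
  pose P := n.+1%:R `^ (- (2 - s)) : R.
  have PE : n.+1%:R `^ s = n.+1%:R ^+ 2 * P.
    rewrite (mulr_powRB1' s n0) (mulr_powRB1' (s - 1) n0) /P mulrA expr2.
    by congr (_ * _ `^ _); ring.
  rewrite -/P.
  have nk0 : 0 < n.+1%:R * kap by rewrite mulr_gt0.
  apply: (@le_trans _ _ (be * (M / (n.+1%:R * kap) ^+ 2) * (K * (n.+1%:R ^+ 2 * P)))).
    rewrite -PE; apply: ler_pM => //.
      by apply: mulr_ge0; [exact: ltW|apply: divr_ge0; rewrite ?normr_ge0// ltW].
    apply: ler_wpM2l; first exact: ltW.
    rewrite ler_pdivlMr ?exprn_gt0//.
    suff -> : `|c n| / (n.+1%:R * kap) * (n.+1%:R * kap) ^+ 2 = n.+1%:R * kap * `|c n| by [].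
    by field; rewrite !gt_eqF.
  rewrite le_eqVlt; apply/orP; left; apply/eqP; rewrite /C; field.
  by rewrite !gt_eqF.
- exact: (@is_cvg_seriesZ R _ C cr).
Qed.

End Summability.

(** * The fractional Laplacian as an integral of resolvents *)

Section ResolventRepresentation.
Context {R : realType}.
Local Notation mu := (@lebesgue_measure R).
Variables (a b : R).
Local Notation Omega := (`]a, b[%classic : set (measurableTypeR R)).
Hypothesis ab : a < b.
Hypothesis tot : forall f, L2 a b f ->
  (forall n, \int[mu]_(t in `]a, b[) (f t * cosn a b n t) = 0) ->
  {ae mu, forall x, x \in `]a, b[ -> f x = 0}.
Variables (V D : R -> R).
Hypothesis pV : primitive V D.
Variables (om : R -> R -> R).
Hypothesis omP : forall t, exists om1, resolvent a b (expR (t / 2)) V (om t) om1.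
Hypothesis dcv : cvgn (series (fun n => `|cosine_coef a b V n|)).
Variables (s : R) (q B : R -> R).
Hypothesis hs : 0 < s < 1.
Hypothesis q1 : forall x, 1 <= q x.
Hypothesis qi : mu.-integrable `[a, b] (EFin \o q).
Hypothesis Bi : mu.-integrable setT (EFin \o B).
Hypothesis qB : forall t,
  expR (s * t) * \int[mu]_(x in `[a, b]) (q x * `|V x - om t x|) <= B t.

Let cV : continuous V. Proof. exact: primitive_continuous pV. Qed.

Let com t : continuous (om t).
Proof. by have [om1 [+ _ _ _]] := omP t; exact: is_derive_continuous. Qed.

Let cp t : continuous (fun x => V x - om t x). Proof. exact: ctsB. Qed.

Let mult n t : R := freq a b n ^+ 2 / (freq a b n ^+ 2 + expR t).

Let mult_den n t : 0 < freq a b n ^+ 2 + expR t.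
Proof. by rewrite ltr_wpDl ?sqr_ge0 ?expR_gt0. Qed.

Let mult01 n t : 0 <= mult n t <= 1.
Proof.
apply/andP; split; first by apply: divr_ge0; [exact: sqr_ge0|exact/ltW].
by rewrite /mult ler_pdivrMr// mul1r lerDl expR_ge0.
Qed.

Let continuous_mult n : continuous (mult n).
Proof.
apply: ctsM; first exact: cts_cst.
apply: ctsV => [|x]; last by rewrite gt_eqF.
by apply: ctsD; [exact: cts_cst|exact: continuous_expR].
Qed.

Let d t n := cosine_coef a b V n * mult n t.

Let dle t n : `|d t n| <= `|cosine_coef a b V n|.
Proof.
have /andP[m0 m1] := mult01 n t.
by rewrite normrM (ger0_norm m0) ler_piMr.
Qed.

Let dcvt t : cvgn (series (fun n => `|d t n|)).
Proof. by apply: series_le_cvg dcv => n; rewrite ?normr_ge0. Qed.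

(** Nothing is known about [om] as a function of both variables. For each t the series equals V - om
    t for almost every x, and it is jointly measurable, as Fubini's theorem requires. *)
Let S t x := cosine_series a b (d t) x.

Lemma resolvent_cosn t n :
  \int[mu]_(x in `[a, b]) ((V x - om t x) * cosn a b n x) =
  freq a b n ^+ 2 / (freq a b n ^+ 2 + expR t) *
  \int[mu]_(x in `[a, b]) (V x * cosn a b n x).
Proof.
have [om1 res] := omP t.
have := resolvent_cos ab (expR_gt0 _) pV res (sin_freq ab n).
by rewrite -expRM_natr divfK ?pnatr_eq0.
Qed.

Let SE t : {ae mu, forall x, x \in `]a, b[ -> V x - om t x = S t x}.
Proof.
apply: cosine_expansion => // [|n].
  apply: integrable_itv_oo.
  exact: continuous_integrable.
rewrite Rintegral_itv_oo; last first.
  by apply: continuous_integrable; apply: ctsM => //; exact: continuous_cosn.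
rewrite resolvent_cosn /d /cosine_coef -/(mult n t).
have := sqnorm_gt0 ab n; generalize_Rintegral => n0.
by field; rewrite gt_eqF.
Qed.

Let mS : measurable_fun setT (fun z : measurableTypeR R * measurableTypeR R => S z.1 z.2).
Proof.
apply: (measurable_fun_cvg (h := fun n z => series (fun k => d z.1 k * cosn a b k z.2) n)).
  move=> n; elim: n => [|n IH].
    by under eq_fun do rewrite /series/= big_nil; exact: measurable_cst.
  under eq_fun do rewrite seriesSr.
  apply: measurable_funD => //; apply: measurable_funM.
    apply: measurable_funM => //.
    by apply: measurableT_comp measurable_fst; exact: continuous_measurable_fun.
  apply: measurableT_comp measurable_snd.
  by apply: continuous_measurable_fun; exact: continuous_cosn.
by move=> z _; exact: cvg_cosine_series.
Qed.

Section Weight.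
Variables (k : R -> R) (C : R).
Hypothesis mk : measurable_fun Omega k.
Hypothesis kq : forall x, x \in `]a, b[ -> `|k x| <= C * q x.

Let k0 := k \_ Omega.

Let mk0 : measurable_fun [set: measurableTypeR R] k0.
Proof.
have mI : measurable Omega by [].
by have [+ _] := measurable_restrictT k mI; apply.
Qed.

Let phi (z : measurableTypeR R * measurableTypeR R) : R :=
  expR (s * z.1) * (k0 z.2 * S z.1 z.2).

Let mphi : measurable_fun setT phi.
Proof.
apply: measurable_funM.
  apply: (@measurableT_comp _ _ _ _ _ _ (fun t : measurableTypeR R => expR (s * t)) _ fst) => //.
  by apply: continuous_measurable_fun; exact: cts_expM.
apply: measurable_funM => //.
by apply: (@measurableT_comp _ _ _ _ _ _ k0 _ snd).
Qed.

Let kp t x := k x * (V x - om t x).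

Let C0 : 0 <= C.
Proof.
have mab : (a + b) / 2 \in `]a, b[.
  by rewrite in_itv/=; move: ab => ?; apply/andP; split; lra.
have := le_trans (normr_ge0 _) (kq mab); rewrite pmulr_lge0//.
exact: lt_le_trans (q1 _).
Qed.

Let qpi t : mu.-integrable `[a, b] (EFin \o (fun x => q x * `|V x - om t x|)).
Proof. by apply: integrable_continuousM => //; apply: cts_norm. Qed.

Lemma integrable_weight_resolvent t : mu.-integrable `]a, b[ (EFin \o kp t).
Proof.
apply: (@le_integrable _ _ _ mu _ _ _ (EFin \o (fun x => C * (q x * `|V x - om t x|)))) => //.
- apply/measurable_EFinP; apply: measurable_funM => //.
  by apply: measurable_funTS; exact: continuous_measurable_fun.
- move=> x xab; rewrite /= lee_fin /kp normrM mulrA [leRHS]ger0_norm.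
    by apply: ler_wpM2r => //; exact: kq.
  by rewrite !mulr_ge0// (le_trans ler01).
- apply: integrableRZ => //.
  exact: integrable_itv_oo.
Qed.

Let kp0 t := kp t \_ Omega.

Let kp0i t : mu.-integrable [set: measurableTypeR R] (EFin \o kp0 t).
Proof.
by apply: integrable_patch => //; exact: integrable_weight_resolvent.
Qed.

Let phiE t : {ae mu, forall x, setT x -> phi (t, x) = expR (s * t) * kp0 t x}.
Proof.
apply: ae_impl (SE t) => x h _; rewrite /phi /kp0 /k0 /= !patchE mem_setE.
by case: ifPn => [/h <-//|_]; rewrite mul0r.
Qed.

Let mphit t : measurable_fun [set: measurableTypeR R] (fun x => phi (t, x)).
Proof. exact: measurableT_comp. Qed.

Let mkp0 t : measurable_fun [set: measurableTypeR R] (fun x => expR (s * t) * kp0 t x).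
Proof.
apply: measurable_funM => //; apply/measurable_EFinP.
exact: (measurable_int mu (kp0i t)).
Qed.

Let inner_phi t : \int[mu]_x phi (t, x) =
  expR (s * t) * \int[mu]_(x in `]a, b[) kp t x.
Proof.
rewrite (ae_eq_Rintegral _ _ _ (phiE t))// RintegralZl//.
by rewrite [in RHS]Rintegral_mkcond.
Qed.

Let inner_abs_phi t : (\int[mu]_x `|phi (t, x)|%:E =
  (expR (s * t) * \int[mu]_(x in `]a, b[) `|kp t x|)%:E)%E.
Proof.
transitivity (\int[mu]_x `|expR (s * t) * kp0 t x|%:E)%E.
  apply: ae_eq_integral => //.
  - by apply/measurable_EFinP; apply: measurableT_comp.
  - by apply/measurable_EFinP; apply: measurableT_comp.
  - by apply: ae_impl (phiE t) => x h xT; rewrite (h xT).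
have i1 : mu.-integrable [set: measurableTypeR R] (EFin \o (fun x => `|kp0 t x|)).
  exact: integrable_norm.
under eq_integral do rewrite normrM (ger0_norm (expR_ge0 _)) EFinM.
rewrite integralZl// EFinM; congr (_ * _)%E.
rewrite -[LHS]fineK; last exact: integrable_fin_num.
congr (_%:E); rewrite -/(Rintegral _ _ _) [in RHS]Rintegral_mkcond.
by apply: eq_Rintegral => x _; rewrite /kp0 !patchE; case: ifP; rewrite ?normr0.
Qed.

(** The hypothesis [qB] enters here: the weight [k] is at most C q in absolute value, so the double
    integral is at most C times that of [B]. *)
Let phi_fin : (\int[mu]_t \int[mu]_x `|phi (t, x)|%:E < +oo)%E.
Proof.
have /integrableP[_] : mu.-integrable [set: measurableTypeR R] (EFin \o (fun t => C * B t)).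
  exact: integrableRZ.
apply: le_lt_trans; apply: ge0_le_integral_nm => t _.
  by apply: integral_ge0 => x _; rewrite lee_fin.
rewrite inner_abs_phi lee_fin; apply: le_trans (ler_norm _).
apply: (@le_trans _ _ (C * (expR (s * t) * \int[mu]_(x in `[a, b]) (q x * `|V x - om t x|)))).
  rewrite mulrCA; apply: ler_wpM2l; first exact: expR_ge0.
  rewrite -Rintegral_itv_oo// -RintegralZl//; last first.
    exact: integrable_itv_oo.
  apply: le_Rintegral => //.
  - by apply: integrable_norm; exact: integrable_weight_resolvent.
  - apply: integrableRZ => //.
    exact: integrable_itv_oo.
  - by move=> x xab; rewrite /kp normrM mulrA ler_wpM2r// kq.
by rewrite ler_wpM2l// qB.
Qed.

Lemma integrable_weighted_resolvent : mu.-integrable setT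
  (EFin \o (fun t => expR (s * t) * \int[mu]_(x in `]a, b[) kp t x)).
Proof.
have [+ _ _] := fubini_real mphi phi_fin.
by apply: eq_integrable => // t _; rewrite /= inner_phi.
Qed.

Lemma weight_sections : {ae mu, forall x, mu.-integrable setT
  (EFin \o (fun t => expR (s * t) * ((k \_ Omega) x * S t x)))}.
Proof. by have [] := fubini_real_swap mphi phi_fin. Qed.

Lemma integrable_weight_series : mu.-integrable setT
  (EFin \o (fun x => \int[mu]_t (expR (s * t) *
    ((k \_ Omega) x * S t x)))).
Proof. by have [] := fubini_real_swap mphi phi_fin. Qed.

Lemma Rintegral_weight_series : \int[mu]_x \int[mu]_t (expR (s * t) *
    ((k \_ Omega) x * S t x)) =
  \int[mu]_t (expR (s * t) * \int[mu]_(x in `]a, b[) (k x * (V x - om t x))).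
Proof.
have [_ _] := fubini_real mphi phi_fin; rewrite /phi/= => <-.
by apply: eq_Rintegral => t _; have := inner_phi t; rewrite /phi/= => ->.
Qed.

End Weight.

(** To be identified with a constant multiple of [p]. *)
Let P x := \int[mu]_t (expR (s * t) * S t x).

Let m1 : measurable_fun Omega (fun=> 1 : R).
Proof. exact: measurable_cst. Qed.

Let q1' x : x \in `]a, b[ -> `|1 : R| <= 1 * q x.
Proof. by rewrite normr1 mul1r. Qed.

Let P_sections : {ae mu, forall x, x \in `]a, b[ ->
  mu.-integrable setT (EFin \o (fun t => expR (s * t) * S t x))}.
Proof.
apply: ae_impl (weight_sections m1 q1') => x h xab; move: h.
by apply: eq_integrable => // t _; rewrite /= patchE mem_setE xab mul1r.
Qed.

Let Pi : mu.-integrable `]a, b[ (EFin \o P).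
Proof.
have mI : measurable Omega by [].
have := integrableS measurableT mI (@subsetT _ _) (integrable_weight_series m1 q1').
apply: eq_integrable => // x; rewrite inE/= => xab; congr (_%:E).
by apply: eq_Rintegral => t _; rewrite patchE mem_setE xab mul1r.
Qed.

Let mP : measurable_fun Omega P.
Proof. exact: integrable_measurable Pi. Qed.

(** The weight 1 already shows that almost every section in t is integrable, so the factor [k x] can
    be taken out of the inner integral. *)
Let weightP (k : R -> R) (C : R) : measurable_fun Omega k ->
  (forall x, x \in `]a, b[ -> `|k x| <= C * q x) ->
  mu.-integrable `]a, b[ (EFin \o (fun x => k x * P x)) /\
  \int[mu]_(x in `]a, b[) (k x * P x) =
  \int[mu]_t (expR (s * t) * \int[mu]_(x in `]a, b[) (k x * (V x - om t x))).
Proof.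
move=> mk kq; have mI : measurable Omega by [].
pose F x := \int[mu]_t (expR (s * t) *
    ((k \_ Omega) x * S t x)).
have FT : mu.-integrable setT (EFin \o F) := integrable_weight_series mk kq.
have Fi : mu.-integrable `]a, b[ (EFin \o F) by exact: integrableS FT.
have mF : measurable_fun Omega F.
  exact: integrable_measurable Fi.
have FE : {ae mu, forall x, `]a, b[%classic x -> F x = k x * P x}.
  apply: ae_impl P_sections => x h xab; rewrite /F patchE mem_setE xab /P.
  rewrite -RintegralZl//; last exact: h.
  by apply: eq_Rintegral => t _; rewrite mulrCA.
split.
  by apply: ae_eq_integrable FE Fi => //; exact: measurable_funM.
rewrite -(Rintegral_weight_series mk kq) -(ae_eq_Rintegral _ _ _ FE)//; last first.
  exact: measurable_funM.
rewrite Rintegral_mkcond; apply: eq_Rintegral => x _; rewrite patchE; case: ifPn => // xab.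
rewrite -[LHS](Rintegral_set0 mu (cst 0)) Rintegral_mkcond.
by apply: eq_Rintegral => t _; rewrite !patchE (negbTE xab) in_set0 mul0r mulr0.
Qed.

Variable p : R -> R.
Hypothesis pint : mu.-integrable `]a, b[ (EFin \o p).
Hypothesis pcos : forall n, \int[mu]_(t in `]a, b[) (p t * cosn a b n t) =
  (freq a b n ^+ 2) `^ s * \int[mu]_(t in `]a, b[) (V t * cosn a b n t).

Let K := \int[mu]_t kern s t.

Let K0 : 0 < K. Proof. exact: Rintegral_kern_gt0. Qed.

(** Both sides are integrable and have the same cosine coefficients: the resolvent multipliers
    integrate to K times the power s by [Rintegral_kern_scale]. *)
Let pE : {ae mu, forall x, x \in `]a, b[ -> K * p x = P x}.
Proof.
have Kpi := integrableRZ K (measurable_itv _) pint.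
have : {ae mu, forall x, x \in `]a, b[ -> K * p x - P x = 0}.
  apply: (cosine_coefficients_unique ab tot) => [|n]; first exact: integrableRB.
  have i1 := @integrable_cosnM _ a b _ _ n (measurable_itv _) Kpi.
  have i2 := @integrable_cosnM _ a b _ _ n (measurable_itv _) Pi.
  have i3 := @integrable_cosnM _ a b _ _ n (measurable_itv _) pint.
  under eq_Rintegral do rewrite mulrBl.
  rewrite RintegralB//; under eq_Rintegral do rewrite -mulrA.
  rewrite RintegralZl// pcos.
  have -> : \int[mu]_(t in `]a, b[) (P t * cosn a b n t) =
            \int[mu]_(t in `]a, b[) (cosn a b n t * P t).
    by apply: eq_Rintegral => t _; rewrite mulrC.
  have [||_ ->] := @weightP (cosn a b n) 1.
  - by apply: measurable_funTS; apply: continuous_measurable_fun; exact: continuous_cosn.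
  - by move=> x _; rewrite mul1r; exact: le_trans (cosn_le1 _ _ _ _) (q1 _).
  set I := \int[mu]_(t in `]a, b[) (V t * cosn a b n t).
  have cI : mu.-integrable `[a, b] (EFin \o (fun t => V t * cosn a b n t)).
    by apply: continuous_integrable; apply: ctsM => //; exact: continuous_cosn.
  rewrite (@eq_Rintegral _ _ _ mu _ (fun t => I * (expR (s * t) * mult n t))); last first.
    move=> t _; have -> : \int[mu]_(x in `]a, b[) (cosn a b n x * (V x - om t x)) =
       \int[mu]_(x in `]a, b[) ((V x - om t x) * cosn a b n x).
      by apply: eq_Rintegral => x _; rewrite mulrC.
    rewrite Rintegral_itv_oo ?resolvent_cosn; last first.
      by apply: continuous_integrable; apply: ctsM => //; exact: continuous_cosn.
    by rewrite /I Rintegral_itv_oo// /mult; ring.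
  rewrite RintegralZl//; last first.
    (* With f = freq^2 and e = exp t, one has f / (f + e) <= (1 + f) / (1 + e). *)
    apply: (@le_integrable _ _ _ mu _ _ _ (EFin \o (fun t => (1 + freq a b n ^+ 2) * kern s t))) => //.
    + apply/measurable_EFinP; apply: continuous_measurable_fun.
      by apply: ctsM => //; exact: cts_expM.
    + move=> t _; have f0 := sqr_ge0 (freq a b n); have e0 := expR_gt0 t.
      rewrite /= lee_fin !ger0_norm; last 2 first.
      * by apply: mulr_ge0; [exact: addr_ge0|exact/ltW/kern_gt0].
      * by apply: mulr_ge0; [exact: expR_ge0|have /andP[] := mult01 n t].
      rewrite /kern [leRHS]mulrCA ler_wpM2l ?expR_ge0// /mult.
      rewrite ler_pdivrMr// mulrAC ler_pdivlMr ?kern_den_gt0//.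
      by move: f0 e0; move: (expR t) (freq a b n ^+ 2) => e f f0 e0; nra.
    + by apply: integrableRZ => //; exact: integrable_kern.
  rewrite Rintegral_kern_scale ?sqr_ge0// -/K; ring.
by apply: ae_impl => x h /h /eqP; rewrite subr_eq0 => /eqP.
Qed.

Lemma fractional_Laplacian_weight (k : R -> R) (C : R) :
  measurable_fun Omega k ->
  (forall x, x \in `]a, b[ -> `|k x| <= C * q x) ->
  mu.-integrable `]a, b[ (EFin \o (fun x => k x * p x)) /\
  \int[mu]_(x in `]a, b[) (k x * p x) = (\int[mu]_t kern s t)^-1 *
  \int[mu]_t (expR (s * t) * \int[mu]_(x in `]a, b[) (k x * (V x - om t x))).
Proof.
move=> mk kq; have [kPi kPE] := weightP mk kq; rewrite -kPE.
have mp : measurable_fun Omega p.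
  exact: integrable_measurable pint.
have E : {ae mu, forall x, `]a, b[%classic x -> K^-1 * (k x * P x) = k x * p x}.
  by apply: ae_impl pE => x h /h <-; rewrite mulrCA mulKf ?gt_eqF.
split.
  apply: ae_eq_integrable E _ => //; [exact: measurable_funM|exact: integrableRZ].
rewrite -RintegralZl//; apply/esym; apply: ae_eq_Rintegral E => //.
  by apply: measurable_funM => //; exact: measurable_funM.
exact: measurable_funM.
Qed.

End ResolventRepresentation.

(** * Integrable bounds in the resolvent parameter *)

Section ResolventDecay.
Context {R : realType}.
Local Notation mu := (@lebesgue_measure R).
Variables (a b : R).
Hypothesis ab : a < b.

Lemma primitive_bounded (F f : R -> R) : primitive F f ->
  exists2 M, 0 <= M & forall x, a <= x <= b -> `|F x| <= M.
Proof.
move=> [fi Ff]; exists (`|F a| + \int[mu]_(t in `[a, b]) `|f t|).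
  by rewrite addr_ge0// Rintegral_ge0.
move=> x /andP[ax xb]; rewrite -(subrKC (F a) (F x)).
apply: le_trans (ler_normD _ _) _; rewrite lerD2l Ff//.
apply: le_trans (le_normr_Rintegral _ (fi a x)) _ => //.
rewrite (@Rintegral_split _ _ a x b)//; last exact: integrable_norm.
by rewrite lerDl Rintegral_ge0.
Qed.

Variables (V D : R -> R) (om : R -> R -> R) (s : R).
Hypothesis pV : primitive V D.
Hypothesis D2i : mu.-integrable `[a, b] (EFin \o (fun t => D t ^+ 2)).
Hypothesis omP : forall t, exists om1, resolvent a b (expR (t / 2)) V (om t) om1.
Hypothesis hs : 0 < s < 1.

Let cV : continuous V. Proof. exact: primitive_continuous pV. Qed.

Let com t : continuous (om t).
Proof. by have [om1 [+ _ _ _]] := omP t; exact: is_derive_continuous. Qed.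

(** One weight that dominates, up to constants, all those to be paired with [p]: bounded functions,
    [D], and the sawtooth times [D]. *)
Let q x := 1 + `|D x|.

Let qi : mu.-integrable `[a, b] (EFin \o q).
Proof.
have [Di _] := pV; apply: integrableRD => //; last exact: integrable_norm.
by apply: continuous_integrable; exact: cts_cst.
Qed.

Let q2i : mu.-integrable `[a, b] (EFin \o (fun x => q x ^+ 2)).
Proof.
have [Di _] := pV.
have i0 : mu.-integrable `[a, b] (EFin \o (fun x : R => 1 + 2 * `|D x|)).
  apply: integrableRD => //; last by apply: integrableRZ => //; exact: integrable_norm.
  by apply: continuous_integrable; exact: cts_cst.
have := integrableRD (measurable_itv _) i0 D2i.
apply: eq_integrable => // x _; rewrite /= /q -(real_normK (num_real (D x))).
by congr EFin; ring.
Qed.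

Let pp t x := V x - om t x.

Let cpp t : continuous (pp t). Proof. exact: ctsB. Qed.

Let qpi t : mu.-integrable `[a, b] (EFin \o (fun x => q x * `|pp t x|)).
Proof. by apply: integrable_continuousM => //; apply: cts_norm. Qed.

Let Q := \int[mu]_(x in `[a, b]) (q x ^+ 2).
Let Q0 : 0 <= Q. Proof. by apply: Rintegral_ge0 => x _; exact: sqr_ge0. Qed.
Let D2 := \int[mu]_(x in `[a, b]) (D x ^+ 2).
Let D20 : 0 <= D2. Proof. by apply: Rintegral_ge0 => x _; exact: sqr_ge0. Qed.
Let V2 := \int[mu]_(x in `[a, b]) (V x ^+ 2).
Let V20 : 0 <= V2. Proof. by apply: Rintegral_ge0 => x _; exact: sqr_ge0. Qed.

Let weighted_amgm t (k : R) : 0 < k -> \int[mu]_(x in `[a, b]) (q x * `|pp t x|) <=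
  k * Q + k^-1 * \int[mu]_(x in `[a, b]) (pp t x ^+ 2).
Proof.
move=> k0; have i2 : mu.-integrable `[a, b] (EFin \o (fun x => pp t x ^+ 2)).
  by apply: continuous_integrable; apply: ctsX.
rewrite -!RintegralZl// -RintegralD//; try exact: integrableRZ.
apply: le_Rintegral => //; first by apply: integrableRD => //; exact: integrableRZ.
move=> x _; rewrite -(real_normK (num_real (pp t x))).
move: (q x) `|pp t x| => u v; rewrite -subr_ge0.
have -> : k * u ^+ 2 + k^-1 * v ^+ 2 - u * v = k^-1 * ((k * u - v / 2) ^+ 2 + 3 / 4 * v ^+ 2).
  by field; rewrite gt_eqF.
by rewrite mulr_ge0 ?invr_ge0 ?(ltW k0)// addr_ge0 ?sqr_ge0// mulr_ge0 ?sqr_ge0.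
Qed.

(** For t <= 0 the uniform L^2 bound suffices: exp(s t) is integrable at -oo and 1 + exp t <= 2. *)
Let small_t (t : R) : t <= 0 ->
  expR (s * t) * \int[mu]_(x in `[a, b]) (q x * `|pp t x|) <= 2 * (Q + V2) * kern s t.
Proof.
move=> t0; have [om1 res] := omP t.
have h := @weighted_amgm t 1 ltr01; rewrite invr1 !mul1r in h.
have h2 := resolvent_square_le ab (expR_gt0 _) pV res.
have h3 : \int[mu]_(x in `[a, b]) (q x * `|pp t x|) <= Q + V2.
  by apply: le_trans h _; rewrite lerD2l.
rewrite /kern mulrCA ler_wpM2l ?expR_ge0//.
rewrite ler_pdivlMr ?kern_den_gt0//.
have e1 : 1 + expR t <= 2 by rewrite -expR0 in t0 *; rewrite lerD2l ler_expR.
have i0 : 0 <= \int[mu]_(x in `[a, b]) (q x * `|pp t x|).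
  by apply: Rintegral_ge0 => x _; rewrite mulr_ge0// addr_ge0.
by rewrite mulrC; apply: ler_pM => //; exact/ltW/kern_den_gt0.
Qed.

Let kern_ge (r t : R) : 0 <= t -> expR (r * t) / expR t <= 2 * kern r t.
Proof.
move=> t0; rewrite /kern mulrCA ler_wpM2l ?expR_ge0// ler_pdivlMr ?kern_den_gt0//.
have e1 : 1 <= expR t by rewrite -expR0 ler_expR.
by rewrite mulrC ler_pdivrMr ?expR_gt0//; lra.
Qed.

(** For t >= 0 the L^2 norm squared of V - om t decays like exp(-t). Balancing [weighted_amgm] with
    k = exp(-t/2) leaves exp((s - 1/2) t), the behaviour of [kern (s + 2^-1)] at +oo, an integrable
    kernel because s < 1/2. *)
Lemma resolvent_decay_H1 : s < 2^-1 -> exists2 B : R -> R, mu.-integrable setT (EFin \o B) &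
  forall t, expR (s * t) * \int[mu]_(x in `[a, b]) (q x * `|V x - om t x|) <= B t.
Proof.
move=> s12; have /andP[s0 s1] := hs.
exists (fun t => 2 * (Q + V2) * kern s t + 2 * (Q + D2) * kern (s + 2^-1) t).
  by apply: integrableRD => //; apply: integrableRZ => //; apply: integrable_kern; lra.
have k0 (r t : R) : 0 <= kern r t by exact/ltW/kern_gt0.
move=> t; have [t0|/ltW t0] := leP t 0.
  apply: le_trans (small_t t0) _; rewrite lerDl mulr_ge0//.
  by rewrite mulr_ge0// addr_ge0.
have [om1 res] := omP t.
have h2 := resolvent_square_decay ab (expR_gt0 _) pV res D2i.
apply: (@le_trans _ _ (2 * (Q + D2) * kern (s + 2^-1) t)); last first.
  by rewrite lerDr mulr_ge0// mulr_ge0// addr_ge0.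
have h := @weighted_amgm t (expR (- (t / 2))) (expR_gt0 _).
rewrite -expRN opprK in h; rewrite -expRM_natr divfK ?pnatr_eq0// in h2.
have E : expR (t / 2) * expR (t / 2) = expR t by rewrite -expRD; congr expR; field.
have e0 := expR_gt0 (t / 2).
have h3 : \int[mu]_(x in `[a, b]) (q x * `|pp t x|) <= expR (- (t / 2)) * (Q + D2).
  apply: le_trans h _; rewrite mulrDr lerD2l.
  apply: (@le_trans _ _ (expR (t / 2) * ((4 * expR t)^-1 * D2))); first by rewrite ler_pM2l.
  rewrite mulrA ler_wpM2r// -E expRN; set e := expR _ in e0 *.
  have -> : e * (4 * (e * e))^-1 = 4^-1 * e^-1 by field; rewrite gt_eqF.
  by rewrite ler_piMl ?invr_ge0 ?(ltW e0)// invf_le1// ler1n.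
apply: (@le_trans _ _ (expR (s * t) * (expR (- (t / 2)) * (Q + D2)))).
  by rewrite ler_wpM2l ?expR_ge0.
rewrite mulrA [leRHS]mulrAC; apply: ler_wpM2r; first exact: addr_ge0.
rewrite -expRD; apply: le_trans (kern_ge _ t0); rewrite -expRN -expRD ler_expR; lra.
Qed.

(** Here [D] is bounded, so the weight costs a constant, and the L^1 decay exp(-t) leaves exp((s -
    1) t). *)
Lemma resolvent_decay_H2 D' : primitive D D' -> exists2 B : R -> R, mu.-integrable setT (EFin \o B) &
  forall t, expR (s * t) * \int[mu]_(x in `[a, b]) (q x * `|V x - om t x|) <= B t.
Proof.
move=> pD; have cD := primitive_continuous pD.
have [M M0 DM] := primitive_bounded pD.
pose N := `|D a| + `|D b| + \int[mu]_(t in `[a, b]) `|D' t|.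
have N0 : 0 <= N by rewrite !addr_ge0// Rintegral_ge0.
exists (fun t => 2 * (Q + V2) * kern s t + (1 + M) * N * (2 * kern s t)).
  by apply: integrableRD => //; do ?apply: integrableRZ => //; apply: integrable_kern.
have k0 (r t : R) : 0 <= kern r t by exact/ltW/kern_gt0.
move=> t; have [t0|/ltW t0] := leP t 0.
  apply: le_trans (small_t t0) _; rewrite lerDl; apply: mulr_ge0.
    by apply: mulr_ge0 => //; apply: addr_ge0.
  by apply: mulr_ge0.
have [om1 res] := omP t.
have dV (x : R) : is_derive x (1 : R) V (D x) by apply: (primitive_is_derive pV); exact: cD.
have h2 := resolvent_L1_decay ab (expR_gt0 _) dV pD res.
rewrite -expRM_natr divfK ?pnatr_eq0// -/N in h2.
apply: (@le_trans _ _ ((1 + M) * N * (2 * kern s t))); last first.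
  by rewrite lerDr; apply: mulr_ge0 => //; apply: mulr_ge0 => //; apply: addr_ge0.
have h3 : \int[mu]_(x in `[a, b]) (q x * `|pp t x|) <= (1 + M) * ((expR t)^-1 * N).
  apply: (@le_trans _ _ ((1 + M) * \int[mu]_(x in `[a, b]) `|pp t x|)); last first.
    by rewrite ler_wpM2l// addr_ge0.
  have i1 : mu.-integrable `[a, b] (EFin \o (fun x => `|pp t x|)).
    by apply: continuous_integrable; exact: cts_norm.
  rewrite -RintegralZl//; apply: le_Rintegral => //; first exact: integrableRZ.
  by move=> x; rewrite /= in_itv/= => xab; rewrite ler_wpM2r// lerD2l DM.
apply: (@le_trans _ _ (expR (s * t) * ((1 + M) * ((expR t)^-1 * N)))).
  by rewrite ler_wpM2l ?expR_ge0.
have -> : expR (s * t) * ((1 + M) * ((expR t)^-1 * N)) = (1 + M) * N * (expR (s * t) / expR t).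
  by ring.
by rewrite ler_wpM2l ?kern_ge// mulr_ge0// addr_ge0.
Qed.

End ResolventDecay.

(** * Inequalities for the fractional Laplacian *)

Section FractionalInequalities.
Context {R : realType}.
Local Notation mu := (@lebesgue_measure R).
Variables (a b : R).
Local Notation Omega := (`]a, b[%classic : set (measurableTypeR R)).
Hypothesis ab : a < b.
Hypothesis tot : forall f, L2 a b f ->
  (forall n, \int[mu]_(t in `]a, b[) (f t * cosn a b n t) = 0) ->
  {ae mu, forall x, x \in `]a, b[ -> f x = 0}.
Variables (V D : R -> R) (s : R).
Hypothesis pV : primitive V D.
Hypothesis D2i : mu.-integrable `[a, b] (EFin \o (fun t => D t ^+ 2)).
Hypothesis hs : 0 < s < 1.
Hypothesis hD : s < 2^-1 \/ exists D', primitive D D'.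

Let cV : continuous V. Proof. exact: primitive_continuous pV. Qed.

Lemma summable_cosine_coef (rho : nat -> R) (K : R) : 0 <= K ->
  (forall n, `|rho n.+1| <= K * n.+1%:R `^ s) ->
  cvgn (series (fun n => `|cosine_coef a b V n * rho n|)).
Proof.
move=> K0 rhoK; have [s12|[D' pD]] := hD.
  exact: (summable_cosine_coef_H1 ab pV D2i s12 K0 rhoK).
by have /andP[_ s1] := hs; exact: (summable_cosine_coef_H2 ab pV pD s1 K0 rhoK).
Qed.

Let dcv : cvgn (series (fun n => `|cosine_coef a b V n|)).
Proof.
have /andP[s0 _] := hs.
have := @summable_cosine_coef (fun=> 1) 1 ler01.
under eq_fun do rewrite mulr1; apply => n.
have := @ler_powR _ (n.+1%:R : R) _ 0 s (ltW s0).
by rewrite normr1 mul1r powRr0; apply; rewrite ler1n.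
Qed.

Variable p : R -> R.
Hypothesis pint : mu.-integrable `]a, b[ (EFin \o p).
Hypothesis pcos : forall n, \int[mu]_(t in `]a, b[) (p t * cosn a b n t) =
  (freq a b n ^+ 2) `^ s * \int[mu]_(t in `]a, b[) (V t * cosn a b n t).

Let q x := 1 + `|D x|.

(* [om t] is the resolvent with parameter [expR t]. *)
Let weight : exists om : R -> R -> R,
  (forall t, exists om1, resolvent a b (expR (t / 2)) V (om t) om1) /\
  forall (k : R -> R) (C : R), measurable_fun [set: measurableTypeR R] k ->
  (forall x, a <= x <= b -> `|k x| <= C * q x) ->
  [/\ mu.-integrable `]a, b[ (EFin \o (fun x => k x * p x)),
   mu.-integrable setT (EFin \o (fun t => expR (s * t) * \int[mu]_(x in `[a, b]) (k x * (V x - om t x)))),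
   forall t, mu.-integrable `[a, b] (EFin \o (fun x => k x * (V x - om t x))) &
  \int[mu]_(x in `]a, b[) (k x * p x) = (\int[mu]_t kern s t)^-1 *
  \int[mu]_t (expR (s * t) * \int[mu]_(x in `[a, b]) (k x * (V x - om t x)))].
Proof.
have om_ex t : exists om, exists om1, resolvent a b (expR (t / 2)) V om om1.
  by apply: resolvent_exists => //; exact: expR_gt0.
have /choice [om omP] := om_ex; exists om; split=> // k C mk kq.
have [B Bi qB] : exists2 B : R -> R, mu.-integrable setT (EFin \o B) &
  forall t, expR (s * t) * \int[mu]_(x in `[a, b]) (q x * `|V x - om t x|) <= B t.
  have [s12|[D' pD]] := hD; first exact: (resolvent_decay_H1 ab pV D2i omP hs s12).
  exact: (resolvent_decay_H2 ab pV D2i omP hs pD).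
have q1 x : 1 <= q x by rewrite lerDl.
have [Di _] := pV.
have qi : mu.-integrable `[a, b] (EFin \o q).
  apply: integrableRD => //; last exact: integrable_norm.
  by apply: continuous_integrable; exact: cts_cst.
have mk' : measurable_fun Omega k by exact: measurable_funTS.
have kq' x : x \in `]a, b[ -> `|k x| <= C * q x.
  by rewrite in_itv/= => /andP[ax xb]; rewrite kq// !ltW.
have [h1 h2] := fractional_Laplacian_weight ab tot pV omP dcv hs q1 qi Bi qB pint pcos mk' kq'.
have h3 := integrable_weighted_resolvent ab tot pV omP dcv q1 qi Bi qB mk' kq'.
have h4 t : mu.-integrable `[a, b] (EFin \o (fun x => k x * (V x - om t x))).
  have [om1 [/is_derive_continuous com _ _ _]] := omP t.
  have cp : continuous (fun x => V x - om t x) by exact: ctsB.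
  apply: (@le_integrable _ _ _ mu _ _ _ (EFin \o (fun x => C * (q x * `|V x - om t x|)))) => //.
  - apply/measurable_EFinP; apply: measurable_funTS; apply: measurable_funM => //.
    exact: continuous_measurable_fun.
  - move=> x; rewrite /= in_itv/= => xab; rewrite lee_fin normrM mulrA.
    by apply: le_trans (ler_norm _); rewrite ler_wpM2r// kq.
  - by apply: integrableRZ => //; apply: integrable_continuousM => //; exact: cts_norm.
have E : (fun t => expR (s * t) * \int[mu]_(x in `]a, b[) (k x * (V x - om t x))) =
         (fun t => expR (s * t) * \int[mu]_(x in `[a, b]) (k x * (V x - om t x))).
  by apply/funext => t; rewrite Rintegral_itv_oo.
by rewrite -E; split.
Qed.

Let kern_pos : 0 <= (\int[mu]_t kern s t)^-1.
Proof. by rewrite invr_ge0 ltW// Rintegral_kern_gt0. Qed.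

Let qV : exists2 M, 0 <= M & forall x, a <= x <= b -> `|V x| <= M.
Proof. exact: primitive_bounded pV. Qed.

Let mD : measurable_fun [set: measurableTypeR R] D.
Proof.
have [Di _] := pV; rewrite -(bigcup_itvT true false); apply/measurable_fun_bigcup => // n.
exact: integrable_measurable (Di _ _).
Qed.

Lemma fractional_Laplacian_integrableM : mu.-integrable `]a, b[ (EFin \o (fun x => D x * p x)).
Proof.
have [om [_ w]] := weight.
have Dq x : a <= x <= b -> `|D x| <= 1 * q x by move=> _; rewrite mul1r lerDr.
by have [] := w D 1 mD Dq.
Qed.

(** Both sides are integrals in t of the two sides of [resolvent_functional], against the positive
    weight exp(s t). *)
Lemma fractional_Laplacian_functional c : a <= c <= b ->
  (forall x, a <= x <= b -> V c <= V x) ->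
  2^-1 * \int[mu]_(x in `]a, b[) (V x * p x) <=
  \int[mu]_(x in `]a, b[) ((V x - sawtooth a b c x * D x) * p x).
Proof.
move=> cab Vc; have [om [omP w]] := weight; have [M M0 VM] := qV.
have mV : measurable_fun [set: measurableTypeR R] V by exact: continuous_measurable_fun.
have Vq x : a <= x <= b -> `|V x| <= M * q x.
  by move=> /VM VMx; apply: le_trans VMx _; rewrite ler_peMr// lerDl.
have msaw : measurable_fun [set: measurableTypeR R] (sawtooth a b c).
  rewrite /sawtooth; apply: measurable_funB => //; apply: measurable_fun_ifT => //.
  exact: measurable_fun_ltr.
have mk : measurable_fun [set: measurableTypeR R] (fun x => V x - sawtooth a b c x * D x).
  by apply: measurable_funB => //; exact: measurable_funM.
have kq x : a <= x <= b -> `|V x - sawtooth a b c x * D x| <= (M + (b - a)) * q x.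
  move=> xab; rewrite [leRHS]mulrDl; apply: le_trans (ler_normB _ _) _; apply: lerD; first exact: Vq.
  have saw : `|sawtooth a b c x| <= b - a.
    move: xab cab => /andP[ax xb] /andP[ac cb]; rewrite /sawtooth ler_norml.
    by case: ifP => _; apply/andP; split; lra.
  have Dq : `|D x| <= q x by rewrite lerDr.
  by rewrite normrM; exact: ler_pM.
have [i1 i2 i3 ->] := w _ _ mV Vq; have [j1 j2 j3 ->] := w _ _ mk kq.
rewrite mulrCA ler_wpM2l// -RintegralZl//; apply: le_Rintegral => //; first exact: integrableRZ.
move=> t _; rewrite mulrCA ler_wpM2l ?expR_ge0//.
by have [om1 res] := omP t; exact: (resolvent_functional ab (expR_gt0 _) pV res).
Qed.

(** The same transfer from resolvents; be(V) is bounded because [V] is, so it is an admissible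
    weight. *)
Lemma fractional_Laplacian_composition_le0 (be be1 : R -> R) :
  (forall x : R, is_derive x (1 : R) be (be1 x)) -> continuous be1 ->
  (forall x, be1 x <= 0) -> {homo be : x y /~ x <= y} ->
  mu.-integrable `]a, b[ (EFin \o (fun x => be (V x) * p x)) /\
  \int[mu]_(x in `]a, b[) (be (V x) * p x) <= 0.
Proof.
move=> dbe cbe1 be10 homo_be; have [om [omP w]] := weight; have [M M0 VM] := qV.
have cbe : continuous (fun x => be (V x)) by apply: cts_comp => //; exact: is_derive_continuous dbe.
have mk : measurable_fun [set: measurableTypeR R] (fun x => be (V x)).
  exact: continuous_measurable_fun.
have kq x : a <= x <= b -> `|be (V x)| <= (`|be M| + `|be (- M)|) * q x.
  move=> /VM; rewrite ler_norml => /andP[Vl Vu].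
  apply: (@le_trans _ _ (`|be M| + `|be (- M)|)); last by rewrite ler_peMr ?lerDl// addr_ge0.
  have := homo_be _ _ Vl; have := homo_be _ _ Vu.
  have := ler_norm (be (- M)); have := ler_norm (- be M); rewrite normrN.
  have := normr_ge0 (be (- M)); have := normr_ge0 (be M).
  by move=> *; rewrite ler_norml; apply/andP; split; lra.
have [i1 i2 i3 ->] := w _ _ mk kq; split=> //.
rewrite mulr_ge0_le0//.
rewrite -oppr_ge0 -mulN1r -RintegralZl//; apply: Rintegral_ge0 => t _.
rewrite mulN1r oppr_ge0 mulr_ge0_le0 ?expR_ge0//.
have [om1 res] := omP t.
have := resolvent_composition_le0 ab (expR_gt0 _) pV res dbe cbe1 be10 homo_be.
by under eq_Rintegral do rewrite mulrC.
Qed.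

Variable u : R -> R.
Hypothesis ui : mu.-integrable `]a, b[ (EFin \o u).
Hypothesis ucos : forall n, \int[mu]_(t in `]a, b[) (u t * cosn a b n t) =
  (freq a b n ^+ 2) `^ (s / 2) * \int[mu]_(t in `]a, b[) (V t * cosn a b n t).

(** Parseval for the pairs (u, u) and (p, V) gives the same series, since the multiplier of [u]
    squares to that of [p]. *)
Lemma fractional_Laplacian_energy :
  [/\ mu.-integrable `]a, b[ (EFin \o (fun x => u x ^+ 2)),
      mu.-integrable `]a, b[ (EFin \o (fun x => V x * p x)) &
  \int[mu]_(x in `]a, b[) u x ^+ 2 = \int[mu]_(x in `]a, b[) (V x * p x)].
Proof.
have /andP[s0 _] := hs.
pose rho n := (freq a b n ^+ 2) `^ (s / 2).
pose K := ((pi / (b - a)) ^+ 2) `^ (s / 2) : R.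
have ci g : continuous g -> mu.-integrable `]a, b[ (EFin \o g).
  move=> cg; apply: integrable_itv_oo.
  exact: continuous_integrable.
have cVcos n : continuous (fun x => V x * cosn a b n x).
  by apply: ctsM => //; exact: continuous_cosn.
have fdV n : \int[mu]_(x in `]a, b[) (V x * cosn a b n x) = cosine_coef a b V n * sqnorm a b n.
  rewrite Rintegral_itv_oo ?/cosine_coef ?divfK ?gt_eqF ?sqnorm_gt0//.
  exact: continuous_integrable.
have rhoK n : `|rho n.+1| <= K * n.+1%:R `^ s.
  rewrite ger0_norm ?powR_ge0// /rho /K /freq -mulrA exprMn powRM ?sqr_ge0//.
  rewrite mulrC -[n.+1%:R ^+ 2]powR_mulrn// -powRrM mulrCA.
  by rewrite (_ : 2%:R / 2 = 1) ?mulr1// divff.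
have dcu := summable_cosine_coef (powR_ge0 _ _) rhoK.
have fdu n : \int[mu]_(x in `]a, b[) (u x * cosn a b n x) =
    cosine_coef a b V n * rho n * sqnorm a b n.
  by rewrite ucos fdV -/(rho n); ring.
have [u2i cu] := parseval_cvg ab tot ui dcu fdu ui.
have [pVi cVp] := parseval_cvg ab tot (ci _ cV) dcv fdV pint.
split.
- by move: u2i; apply: eq_integrable.
- by move: pVi; apply: eq_integrable => // x _; rewrite /= mulrC.
have -> : \int[mu]_(x in `]a, b[) u x ^+ 2 = \int[mu]_(x in `]a, b[) (u x * u x) by [].
have -> : \int[mu]_(x in `]a, b[) (V x * p x) = \int[mu]_(x in `]a, b[) (p x * V x).
  by apply: eq_Rintegral => x _; rewrite mulrC.
apply: (cvg_unique _ cu) => //.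
have -> // : (fun k => cosine_coef a b V k * rho k * \int[mu]_(t in `]a, b[) (u t * cosn a b k t)) =
   (fun k => cosine_coef a b V k * \int[mu]_(t in `]a, b[) (p t * cosn a b k t)).
apply/funext => n; rewrite ucos pcos -/(rho n).
(* For n = 0 the base is 0, where adding exponents requires their sum to be nonzero; s > 0 gives
   it. *)
have -> : (freq a b n ^+ 2) `^ s = rho n * rho n.
  rewrite /rho -powRD -?splitr//; apply/implyP => /eqP; lra.
by ring.
Qed.

End FractionalInequalities.

(** * Extremal points, comparison and local primitives *)

Section ContradictionTools.
Context {R : realType}.
Local Notation mu := (@lebesgue_measure R).

Lemma sublevel_min (a b l : R) (f V : R -> R) : continuous f -> continuous V ->
  (exists x, a <= x <= b /\ f x <= l) ->
  exists c, [/\ a <= c <= b, f c <= l & forall x, a <= x <= b -> f x <= l -> V c <= V x].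
Proof.
move=> cf cV [x0 [x0ab fx0]].
pose A : set R := `[a, b]%classic `&` f @^-1` [set y | y <= l].
have cA : compact A.
  apply: compact_closedI; first exact: segment_compact.
  by apply: closed_comp => [x _|]; [exact: cf|exact: closed_le].
have A0 : A !=set0 by exists x0; split=> //=; rewrite in_itv.
have [c] := compact_EVT_min A0 cA (continuous_subspaceT cV).
rewrite inE => -[/=]; rewrite in_itv/= => cab fc Vc.
exists c; split=> // x xab fx; by apply: Vc; rewrite inE; split=> //=.
Qed.

(* Among the minimum points of [V] choose one minimizing [H]. *)
Lemma lexicographic_min (a b : R) (V H : R -> R) : a <= b -> continuous V -> continuous H ->
  exists c, [/\ a <= c <= b, forall x, a <= x <= b -> V c <= V x &
    forall e, 0 < e -> exists2 d, 0 < d & forall x, a <= x <= b -> V x < V c + d -> H c - e < H x].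
Proof.
move=> ab cV cH.
have [c0 [c0ab _ Vc0]] : exists c, [/\ a <= c <= b, (0 : R) <= 0 &
    forall x, a <= x <= b -> (0 : R) <= 0 -> V c <= V x].
  by apply: (@sublevel_min a b 0 (fun=> 0) V) => //; [exact: cts_cst|exists a; rewrite lexx ab].
(* Now [V] is the constraint, V <= min V, and [H] is minimized. *)
have [c [cab Vcc0 Hc]] := @sublevel_min a b (V c0) V H cV cH (ex_intro _ c0 (conj c0ab (lexx _))).
have Vc x : a <= x <= b -> V c <= V x.
  by move=> xab; exact: le_trans Vcc0 (Vc0 _ xab (lexx _)).
exists c; split=> // e e0.
have [ex|nex] := pselect (exists x, a <= x <= b /\ H x <= H c - e); last first.
  exists 1 => // x xab _; rewrite ltNge; apply/negP => Hx; apply: nex.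
  by exists x.
(* Among the points where [H] drops by [e], [y] has the least [V]. None of them minimizes [V], by
   the choice of [c], so V y - V c is a positive gap. *)
have [y [yab Hy Vy]] := sublevel_min cH cV ex.
have VyVc : V c < V y.
  rewrite ltNge; apply/negP => Vyc.
  have := Hc y yab (le_trans Vyc (Vc _ c0ab)).
  by move: Hy e0; lra.
exists (V y - V c); first by rewrite subr_gt0.
move=> x xab; rewrite subrKC => Vx; rewrite ltNge; apply/negP => /(Vy _ xab).
by rewrite leNgt Vx.
Qed.

(** Replacing [g] by max(f, g), equal to it almost everywhere, makes the comparison hold at every
    point. *)
Lemma ae_le_Rintegral (D : set (measurableTypeR R)) (f g : R -> R) : measurable D ->
  mu.-integrable D (EFin \o f) -> mu.-integrable D (EFin \o g) ->
  {ae mu, forall x, D x -> f x <= g x} ->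
  \int[mu]_(x in D) f x <= \int[mu]_(x in D) g x.
Proof.
move=> mD fi gi fg.
have mf := integrable_measurable fi.
have mg := integrable_measurable gi.
have E : {ae mu, forall x, D x -> g x = Num.max (f x) (g x)}.
  by apply: ae_impl fg => x h Dx; rewrite max_r// h.
have mm : measurable_fun D (fun x => Num.max (f x) (g x)) by exact: measurable_maxr.
rewrite (ae_eq_Rintegral _ _ _ E)//; apply: le_Rintegral => //.
  exact: ae_eq_integrable E gi.
by move=> x _; rewrite le_max lexx.
Qed.

Lemma Rintegral_continuous_gt0 (a b c : R) (f : R -> R) : a < b -> continuous f ->
  (forall x, a <= x <= b -> 0 <= f x) -> a <= c <= b -> 0 < f c ->
  0 < \int[mu]_(x in `[a, b]) f x.
Proof.
move=> ab cf f0 cab fc; rewrite lt_neqAle eq_sym; apply/andP; split; last first.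
  by apply: Rintegral_ge0 => x; rewrite /= in_itv/=; exact: f0.
apply/eqP => I0.
have [F dF] := antiderivative_exists cf.
have fz x : x \in `]a, b[ -> f x = 0.
  apply: (derive_eq0_oo dF); exists (F a) => {}x; rewrite in_itv/= => /andP[ax xb].
  have h1 : 0 <= \int[mu]_(t in `[a, x]) f t.
    apply: Rintegral_ge0 => t; rewrite /= in_itv/= => /andP[at_ tx]; apply: f0.
    by rewrite at_ (le_trans tx) ?ltW.
  have h2 : 0 <= \int[mu]_(t in `[x, b]) f t.
    apply: Rintegral_ge0 => t; rewrite /= in_itv/= => /andP[xt tb]; apply: f0.
    by rewrite tb (le_trans _ xt) ?ltW.
  move: h1 h2 I0; rewrite !(FTC2_global _ cf dF) ?(ltW ax) ?(ltW xb) ?(ltW ab)//.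
  by move=> *; lra.
have fa : f a = 0.
  by apply: (cvg_at_right_itv (f := cst 0) ab _ cf); [move=> x /fz|exact: cvg_cst].
have fb : f b = 0.
  by apply: (cvg_at_left_itv (f := cst 0) ab _ cf); [move=> x /fz|exact: cvg_cst].
move: fc; rewrite (_ : f c = 0) ?ltxx//.
move: cab => /andP[]; rewrite le_eqVlt => /predU1P[<-//|ac].
rewrite le_eqVlt => /predU1P[->//|cb]; apply: fz.
by rewrite in_itv/= ac cb.
Qed.

Lemma local_primitive_exists (a b : R) (g : R -> R) : a < b ->
  (forall x y, a < x -> y < b -> mu.-integrable `[x, y] (EFin \o g)) ->
  exists P : R -> R, forall x y, a < x -> x <= y -> y < b ->
    P y - P x = \int[mu]_(t in `[x, y]) g t.
Proof.
move=> ab gi; pose c := (a + b) / 2.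
have [ac cb] : a < c /\ c < b by rewrite /c; split; lra.
exists (fun x => \int[mu]_(t in `[c, x]) g t - \int[mu]_(t in `[x, c]) g t).
move=> x y ax xy yb; have [xc|cx] := leP x c; last first.
  rewrite !(@Rintegral_itv_ge _ _ _ c) ?(le_trans (ltW cx))// ?(ltW cx)//.
  rewrite (@Rintegral_split _ _ c x y) ?(ltW cx)//; last exact: gi.
  by generalize_Rintegral; lra.
rewrite (@Rintegral_itv_ge _ _ c x)//; have [yc|cy] := leP y c.
  rewrite (@Rintegral_itv_ge _ _ c y)//.
  rewrite (@Rintegral_split _ _ x y c)//; last exact: gi.
  by generalize_Rintegral; lra.
rewrite (@Rintegral_itv_ge _ _ y c) ?(ltW cy)//.
rewrite (@Rintegral_split _ _ x c y) ?(ltW cy)//; last exact: gi.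
by generalize_Rintegral; lra.
Qed.

End ContradictionTools.

(** * A nonincreasing cutoff *)

Section Cutoff.
Context {R : realType}.
Local Notation mu := (@lebesgue_measure R).

(** The function max(0, l - y)^2 / 2, obtained as an integral so that its derivative is continuous
    by construction. *)
Lemma cutoff_exists (l : R) : exists be be1 : R -> R,
  [/\ forall x : R, is_derive x (1 : R) be (be1 x), continuous be1, forall x, be1 x <= 0,
      {homo be : x y /~ x <= y} &
      (forall x, l <= x -> be x = 0) /\ (forall x, x < l -> 0 < be x)].
Proof.
pose m (y : R) := Num.max 0 (l - y).
have m0 y : 0 <= m y by rewrite le_max lexx.
have cm : continuous m.
  move=> y; apply: (@continuous_max _ _ (fun=> 0) (fun y => l - y)); first exact: cst_continuous.
  by apply: ctsB; [exact: cts_cst|exact: cts_id].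
have [F dF] := antiderivative_exists cm.
have FE x y : x <= y -> F y - F x = \int[mu]_(t in `[x, y]) m t.
  by move=> xy; rewrite (FTC2_global xy cm dF).
exists (fun y => F l - F y), (fun y => 0 - m y); split.
- by move=> y; apply: derive_sub => //; exact: is_derive_cst.
- by apply: ctsB => //; exact: cts_cst.
- by move=> y; rewrite sub0r oppr_le0.
- move=> x y xy; rewrite lerD2l lerN2 -subr_ge0 FE//.
  by apply: Rintegral_ge0.
split=> [x lx|x xl].
- apply/eqP; rewrite -oppr_eq0 opprB FE//.
  rewrite (@eq_Rintegral _ _ _ mu _ (fun _ => 0)) ?Rintegral_itv_cst ?mul0r//.
  by move=> t; rewrite inE/= in_itv/= => /andP[lt_ _]; rewrite /m max_l// subr_le0.
- rewrite FE ?ltW//; apply: (@Rintegral_continuous_gt0 _ x l x) => //.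
    by rewrite lexx ltW.
  by rewrite lt_max subr_gt0 xl orbT.
Qed.

End Cutoff.

(** * The bound of the energy by the weighted flux *)

Section FluxBound.
Context {R : realType}.
Local Notation mu := (@lebesgue_measure R).
Variables (a b A : R) (V D p g : R -> R).
Local Notation Omega := (`]a, b[%classic : set (measurableTypeR R)).
Hypothesis ab : a < b.
Hypothesis pV : primitive V D.
Hypothesis V0 : forall x, a <= x <= b -> 0 <= V x.
Hypothesis wd : weak_derivative a b p g.
Hypothesis Dpi : mu.-integrable `]a, b[ (EFin \o (fun x => D x * p x)).
Hypothesis Vpi : mu.-integrable `]a, b[ (EFin \o (fun x => V x * p x)).
Hypothesis functional : forall c, a <= c <= b ->
  (forall x, a <= x <= b -> V c <= V x) ->
  2^-1 * A <= \int[mu]_(x in `]a, b[) ((V x - sawtooth a b c x * D x) * p x).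
Hypothesis composition_le0 : forall be be1 : R -> R,
  (forall x : R, is_derive x (1 : R) be (be1 x)) -> continuous be1 ->
  (forall x, be1 x <= 0) -> {homo be : x y /~ x <= y} ->
  mu.-integrable `]a, b[ (EFin \o (fun x => be (V x) * p x)) /\
  \int[mu]_(x in `]a, b[) (be (V x) * p x) <= 0.
Hypothesis Vgi : mu.-integrable `]a, b[ (EFin \o (fun x => V x * `|g x|)).

Let cV : continuous V. Proof. exact: primitive_continuous pV. Qed.

Let gi x y : a < x -> y < b -> mu.-integrable `[x, y] (EFin \o g).
Proof. by case: wd => _ lg _; exact: locally_integrable_itv. Qed.

Let h := (fun x => D x * p x) \_ Omega.

Let hi : mu.-integrable setT (EFin \o h).
Proof. exact: integrable_patch. Qed.

Section Representatives.
Variable H : R -> R.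
Hypothesis pH : primitive H h.

Variable P : R -> R.
Hypothesis pP : forall x y, a < x -> x <= y -> y < b -> P y - P x = \int[mu]_(t in `[x, y]) g t.
Hypothesis pE : {ae mu, forall x, x \in `]a, b[ -> p x = P x}.

Let G x := V x * P x - H x.

(** The derivative of V P is D P + V g, and that of [H] is D p; the terms with [D] cancel because p
    = P almost everywhere. *)
Let Gdiff x y : a < x -> x <= y -> y < b ->
  G y - G x = \int[mu]_(t in `[x, y]) (V t * g t).
Proof.
move=> ax xy yb.
pose g' := g \_ (`[x, y]%classic : set (measurableTypeR R)).
have g'T : mu.-integrable setT (EFin \o g').
  by apply: integrable_patch => //; exact: gi.
have g'i z w : mu.-integrable `[z, w] (EFin \o g') by exact: integrableS g'T.
have [P1 [_ pP1]] := primitive_exists g'i.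
pose P2 t := P1 t - P1 x + P x.
have pP2 : primitive P2 g'.
  by split=> // z w zw; rewrite -pP1// /P2; ring.
have P2E t : x <= t <= y -> P2 t = P t.
  move=> /andP[xt ty]; rewrite /P2 pP1//.
  have -> : \int[mu]_(r in `[x, t]) g' r = \int[mu]_(r in `[x, t]) g r.
    apply: eq_Rintegral => r; rewrite inE/= in_itv/= => /andP[xr rt].
    by rewrite /g' patchE mem_setE in_itv/= xr (le_trans rt ty).
  by rewrite -pP ?(le_lt_trans ty)//; ring.
have [i1 /(_ x y xy)] := primitiveM pV pP2.
have Vg_i : mu.-integrable `[x, y] (EFin \o (fun t => V t * g t)).
  have := integrable_continuousM cV (gi ax yb).
  by apply: eq_integrable => // t _ /=; rewrite mulrC.
have hxy : mu.-integrable `[x, y] (EFin \o h) by exact: integrableS hi.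
have i2 : mu.-integrable `[x, y] (EFin \o (fun t => h t + V t * g t)) by exact: integrableRD.
have E : {ae mu, forall t, `[x, y]%classic t -> D t * P2 t + V t * g' t = h t + V t * g t}.
  apply: ae_impl pE => t pt; rewrite /= in_itv/= => txy; have /andP[xt ty] := txy.
  have tab : t \in `]a, b[ by rewrite in_itv/= (lt_le_trans ax xt) (le_lt_trans ty yb).
  by rewrite P2E// /g' /h !patchE !mem_setE in_itv/= txy tab pt.
rewrite (ae_eq_Rintegral _ _ _ E)//; last 2 first.
- exact: integrable_measurable (i1 x y).
- exact: integrable_measurable i2.
rewrite RintegralD// !P2E ?lexx ?xy//.
by have [_ <-//] := pH; rewrite /G; generalize_Rintegral; lra.
Qed.

Let M := \int[mu]_(x in `]a, b[) (V x * `|g x|).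

Let Gdiff_le x y : a < x -> x <= y -> y < b -> `|G y - G x| <= M.
Proof.
move=> ax xy yb; rewrite Gdiff//.
have Vg_i : mu.-integrable `[x, y] (EFin \o (fun t => V t * g t)).
  have := integrable_continuousM cV (gi ax yb).
  by apply: eq_integrable => // t _ /=; rewrite mulrC.
apply: le_trans (le_normr_Rintegral _ Vg_i) _ => //.
have V0' t : `]a, b[%classic t -> 0 <= V t.
  by rewrite /= in_itv/= => /andP[? ?]; rewrite V0// !ltW.
have sub : `[x, y]%classic `<=` `]a, b[%classic.
  by move=> t /=; rewrite !in_itv/= => /andP[xt ty]; rewrite (lt_le_trans ax xt) (le_lt_trans ty yb).
rewrite (@eq_Rintegral _ _ _ mu _ (fun t => V t * `|g t|)); last first.
  by move=> t; rewrite inE => /sub/V0' ?; rewrite normrM ger0_norm.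
rewrite /M (Rintegral_mkcond mu `[x, y]) (Rintegral_mkcond mu `]a, b[).
have rst (I : set (measurableTypeR R)) : measurable I -> I `<=` `]a, b[%classic ->
    mu.-integrable setT (EFin \o ((fun t => V t * `|g t|) \_ I)).
  by move=> mI Iab; apply: integrable_patch => //; exact: integrableS Vgi.
apply: le_Rintegral => //; [exact: rst|exact: rst|].
move=> t _; rewrite !patchE; case: ifPn => [|_]; first by rewrite inE => /sub txy; rewrite mem_set.
by case: ifPn => //; rewrite inE => /V0' ?; rewrite mulr_ge0.
Qed.

Let G_oscillation x y : x \in `]a, b[ -> y \in `]a, b[ -> `|G y - G x| <= M.
Proof.
rewrite !in_itv/= => /andP[ax xb] /andP[ay yb].
by have [xy|/ltW yx] := leP x y; [|rewrite distrC]; exact: Gdiff_le.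
Qed.

Let ci f : continuous f -> mu.-integrable `]a, b[ (EFin \o f).
Proof.
move=> cf; apply: integrable_itv_oo.
exact: continuous_integrable.
Qed.

Let cH : continuous H. Proof. exact: primitive_continuous pH. Qed.

(* Integrating the functional by parts turns the sawtooth into [H c - H]. *)
Let functional_H c : a <= c <= b -> (forall x, a <= x <= b -> V c <= V x) ->
  2^-1 * A <= \int[mu]_(x in `]a, b[) (V x * p x - H x + H c).
Proof.
move=> cab Vc; have /andP[ac cb] := cab; apply: le_trans (functional cab Vc) _.
have [i1 E] := primitive_weighted ac cb pH.
have VH : mu.-integrable `]a, b[ (EFin \o (fun x => V x * p x - H x)).
  by apply: integrableRB => //; exact: ci.
have i2 : mu.-integrable `]a, b[ (EFin \o (fun t => sawtooth a b c t * h t)).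
  exact: integrable_itv_oo.
have -> : \int[mu]_(x in `]a, b[) ((V x - sawtooth a b c x * D x) * p x) =
  \int[mu]_(x in `]a, b[) (V x * p x - sawtooth a b c x * h x).
  by apply: eq_Rintegral => x xab; rewrite /h patchE xab; ring.
rewrite RintegralB//.
rewrite (RintegralD _ VH)//; last by apply: ci; exact: cts_cst.
rewrite (RintegralB _ Vpi)//; last exact: ci.
have -> : \int[mu]_(x in `]a, b[) (sawtooth a b c x * h x) =
  \int[mu]_(x in `[a, b]) (sawtooth a b c x * h x) by exact: Rintegral_itv_oo.
have -> : \int[mu]_(x in `]a, b[) H x = \int[mu]_(x in `[a, b]) H x.
  by apply: Rintegral_itv_oo; exact: continuous_integrable.
have -> : \int[mu]_(x in `]a, b[) H c = H c * (b - a).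
  rewrite Rintegral_itv_oo ?Rintegral_itv_cst ?(ltW ab)//.
  by apply: continuous_integrable; exact: cts_cst.
by rewrite E; generalize_Rintegral; lra.
Qed.

Lemma flux_bound_aux : A <= 2 * (b - a) * \int[mu]_(x in `]a, b[) (V x * `|g x|).
Proof.
rewrite -/M leNgt; apply/negP => MA.
have ck k : mu.-integrable `]a, b[ (EFin \o (fun _ : R => k)).
  by apply: ci; exact: cts_cst.
(* The surplus A / (2 L) - M is split into three equal margins, spent on the averaging, on the
   variation of [H] near the minimum of [V], and on the final lower bound. *)
pose e := (A / (2 * (b - a)) - M) / 3.
have L0 : 0 < b - a by rewrite subr_gt0.
have e0 : 0 < e.
  by rewrite divr_gt0// subr_gt0 ltr_pdivlMr ?mulr_gt0// mulrC.
have Ae : 2^-1 * A = (M + 3 * e) * (b - a).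
  by rewrite /e; field; rewrite gt_eqF.
have [c [cab Vc Hc]] := lexicographic_min (ltW ab) cV cH.
(* Some value exceeds M + 2 e because the mean of G + H(c) is at least M + 3 e. *)
have [x1 x1ab x1e] : exists2 x1, x1 \in `]a, b[ & M + 2 * e < G x1 + H c.
  apply: contrapT => nex.
  have : 2^-1 * A <= \int[mu]_(x in `]a, b[) (M + 2 * e).
    apply: le_trans (functional_H cab Vc) _; apply: ae_le_Rintegral => //.
      by apply: integrableRD => //; apply: integrableRB => //; exact: ci.
    apply: ae_impl pE => x hx xab; rewrite hx// leNgt; apply/negP => hlt; apply: nex.
    by exists x => //; rewrite /G.
  rewrite Rintegral_itv_oo; last by apply: continuous_integrable; exact: cts_cst.
  rewrite Rintegral_itv_cst ?(ltW ab)// Ae ler_pM2r//.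
  by move: e0; move: (M) (e) => M' e'; lra.
have Gx x : x \in `]a, b[ -> 2 * e < G x + H c.
  move=> xab; have := G_oscillation x1ab xab; rewrite ler_norml => /andP[+ _].
  move: x1e; rewrite /G; move: (M) => M'; lra.
have [d d0 Hd] := Hc e e0.
(* Positive even when the minimum of [V] is 0, which allows division by [l]. *)
pose l := V c + d.
have l0 : 0 < l by rewrite ltr_wpDl// V0.
have [be [be1 [dbe cbe1 be10 homo_be [beE be_gt0]]]] := cutoff_exists l.
have be0 y : 0 <= be y by have [/beE->|/be_gt0/ltW] := leP l y.
have [bpi bp0] := composition_le0 dbe cbe1 be10 homo_be.
have cbe : continuous (fun x => be (V x)).
  by apply: cts_comp => //; exact: is_derive_continuous dbe.
have : 0 < \int[mu]_(x in `[a, b]) be (V x).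
  by apply: (@Rintegral_continuous_gt0 _ a b c) => //; rewrite be_gt0// ltrDl.
rewrite -Rintegral_itv_oo; last exact: continuous_integrable.
(* Where be(V) does not vanish, V < l and p >= e / l; hence (e / l) be(V) <= be(V) p, whose integral
   is at most 0. *)
apply/negP; rewrite -leNgt -(pmulr_rle0 _ (divr_gt0 e0 l0)) -RintegralZl//; last exact: ci.
apply: le_trans bp0; apply: ae_le_Rintegral => //; first by apply: integrableRZ => //; exact: ci.
apply: ae_impl pE => x hx xab; rewrite hx// mulrC.
have [lV|Vl] := leP l (V x); first by rewrite beE// !mul0r.
rewrite ler_wpM2l// ler_pdivrMr//.
have xab' : a <= x <= b by move: xab; rewrite /= in_itv/= => /andP[? ?]; rewrite !ltW.
have VP : e <= V x * P x.
  have := Gx x xab; have := Hd x xab' Vl; rewrite /G.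
  by move: (V x * P x) => VPx; lra.
have Px : 0 <= P x.
  by rewrite leNgt; apply/negP => Px; move: (mulr_ge0_le0 (V0 xab') (ltW Px)) e0 VP; lra.
by apply: le_trans VP _; rewrite mulrC ler_wpM2l// ltW.
Qed.

End Representatives.

Lemma flux_bound : A <= 2 * (b - a) * \int[mu]_(x in `]a, b[) (V x * `|g x|).
Proof.
have [P pP] := local_primitive_exists ab gi.
have [k pE] := weak_derivative_ae ab wd pP.
have hxy x y : mu.-integrable `[x, y] (EFin \o h) by exact: integrableS hi.
have [H pH] := primitive_exists hxy.
(* The representative of [p] is [P] shifted by the constant [k], which does not affect
   increments. *)
apply: (flux_bound_aux pH _ pE) => x y ax xy yb.
by rewrite -pP//; ring.
Qed.

End FluxBound.

(** * A weighted Cauchy-Schwarz inequality in extended reals *)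

Section CauchySchwarz.
Context {R : realType}.
Local Notation mu := (@lebesgue_measure R).

(** The optimal choice is t = m / x. If x = 0 and m > 0, taking t = (y + 1) / m contradicts the
    hypothesis. *)
Lemma sqr_le_of_scaled_mean (m x y : R) : 0 <= m -> 0 <= x -> 0 <= y ->
  (forall t, 0 < t -> 2 * m <= t * x + t^-1 * y) -> m ^+ 2 <= x * y.
Proof.
rewrite le_eqVlt => /predU1P[<-|m0] x0 y0 h; first by rewrite expr0n mulr_ge0.
move: x0; rewrite le_eqVlt => /predU1P[x0|x0].
  have t0 : 0 < (y + 1) / m by rewrite divr_gt0// ltr_wpDl.
  have := h _ t0; rewrite -x0 mulr0 add0r invf_div mulrAC ler_pdivlMr ?ltr_wpDl//.
  by move: m0 y0 => ? ?; nra.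
have := h (m / x) (divr_gt0 m0 x0); rewrite divfK ?gt_eqF// invf_div.
have -> : x / m * y = x * y / m by rewrite mulrAC.
have -> : 2 * m = m + m by ring.
by rewrite lerD2l ler_pdivlMr// -expr2.
Qed.

Lemma measurable_fun_einv (D : set (measurableTypeR R)) (w : R -> R) : measurable D ->
  measurable_fun D w -> (forall x, D x -> 0 <= w x) ->
  measurable_fun D (fun x => ((w x)%:E^-1)%E).
Proof.
move=> mD mw w0.
apply: (@eq_measurable_fun _ _ _ _ D
  (fun x => if w x == 0 then +oo%E else (expR (- ln (w x)))%:E)).
  move=> x /set_mem Dx; rewrite inver; case: ifPn => // wx.
  have wx0 : 0 < w x by rewrite lt_neqAle eq_sym wx w0.
  by rewrite expRN lnK.
apply: measurable_fun_if => //.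
- by apply: measurable_fun_eqr => //; exact: measurable_cst.
- apply/measurable_EFinP; apply: (measurable_funS mD); first exact: subIsetl.
  by apply: measurableT_comp => //; apply: measurableT_comp => //; exact: measurableT_comp.
Qed.

(** A pointwise inequality with a free parameter t is integrated and then optimized. It remains
    meaningful where w = 0, and it gives the integrability of the product as well. *)
Lemma weighted_Cauchy_Schwarz (D : set (measurableTypeR R)) (v w g : R -> R) : measurable D ->
  measurable_fun D v -> measurable_fun D w -> measurable_fun D g ->
  (forall x, D x -> 0 <= w x) ->
  (\int[mu]_(x in D) ((v x ^+ 2)%:E / (w x)%:E) < +oo)%E ->
  (\int[mu]_(x in D) (w x * `|g x| ^+ 2)%:E < +oo)%E ->
  mu.-integrable D (EFin \o (fun x => `|v x| * `|g x|)) /\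
  (((\int[mu]_(x in D) (`|v x| * `|g x|))%R ^+ 2)%:E <=
  (\int[mu]_(x in D) ((v x ^+ 2)%:E / (w x)%:E)) *
  (\int[mu]_(x in D) (w x * `|g x| ^+ 2)%:E))%E.
Proof.
move=> mD mv mw mg w0.
set J1 := fun x => ((v x ^+ 2)%:E / (w x)%:E)%E.
set J2 := fun x => (w x * `|g x| ^+ 2)%:E.
have mJ1 : measurable_fun D J1.
  apply: emeasurable_funM; last exact: measurable_fun_einv.
  by apply/measurable_EFinP; exact: measurable_funX.
have mJ2 : measurable_fun D J2.
  apply/measurable_EFinP; apply: measurable_funM => //; apply: measurable_funX.
  exact: measurableT_comp.
have J10 x : D x -> (0 <= J1 x)%E.
  by move=> Dx; rewrite /J1 mule_ge0 ?lee_fin ?sqr_ge0// inve_ge0 lee_fin w0.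
have J20 x : D x -> (0 <= J2 x)%E.
  by move=> Dx; rewrite lee_fin mulr_ge0 ?w0// sqr_ge0.
have mvg : measurable_fun D (fun x => `|v x| * `|g x|).
  by apply: measurable_funM; exact: measurableT_comp.
set I1 := (\int[mu]_(x in D) J1 x)%E; set I2 := (\int[mu]_(x in D) J2 x)%E.
move=> I1oo I2oo.
have I10 : (0 <= I1)%E by exact: integral_ge0.
have I20 : (0 <= I2)%E by exact: integral_ge0.
have I1f : I1 \is a fin_num by rewrite ge0_fin_numE.
have I2f : I2 \is a fin_num by rewrite ge0_fin_numE.
have pw (t : R) x : 0 < t -> D x ->
    ((2 * (`|v x| * `|g x|))%:E <= t%:E * J1 x + (t^-1)%:E * J2 x)%E.
  (* Where w = 0, the first integrand is +oo unless v = 0, in which case the left-hand side is 0. *)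
  move=> t0 Dx; rewrite /J1 inver; case: ifPn => [wx|wx].
    have [->|vx] := eqVneq (v x) 0.
      by rewrite normr0 mul0r mulr0 expr0n mul0e mule0 add0e; apply: mule_ge0; [rewrite lee_fin invr_ge0 ltW|exact: J20].
    rewrite gt0_muley ?lte_fn ?lte_fin; last by rewrite exprn_even_gt0.
    rewrite gt0_muley ?lte_fin// /J2 -EFinM addye//.
    by rewrite leey.
  have wx0 : 0 < w x by rewrite lt_neqAle eq_sym wx w0.
  rewrite -!EFinM -EFinD lee_fin -(real_normK (num_real (v x))).
  move: `|v x| `|g x| => p q; rewrite -subr_ge0.
  have -> : t * (p ^+ 2 / w x) + t^-1 * (w x * q ^+ 2) - 2 * (p * q) =
     (t * w x)^-1 * (t * p - w x * q) ^+ 2.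
    by field; rewrite wx gt_eqF.
  by rewrite mulr_ge0 ?sqr_ge0// invr_ge0 mulr_ge0 ?ltW.
have It (t : R) : 0 < t -> (\int[mu]_(x in D) (2 * (`|v x| * `|g x|))%:E <=
    t%:E * I1 + (t^-1)%:E * I2)%E.
  move=> t0; rewrite /I1 /I2 -!ge0_integralZl ?lee_fin ?invr_ge0 ?(ltW t0)//.
  rewrite -ge0_integralD//; last 4 first.
  - by move=> x Dx; apply: mule_ge0; [rewrite lee_fin ltW|exact: J10].
  - exact: measurable_funeM.
  - by move=> x Dx; apply: mule_ge0; [rewrite lee_fin invr_ge0 ltW|exact: J20].
  - exact: measurable_funeM.
  apply: ge0_le_integral_nm => x Dx; first by rewrite lee_fin !mulr_ge0.
  exact: pw.
have vgi : mu.-integrable D (EFin \o (fun x => `|v x| * `|g x|)).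
  apply/integrableP; split; first exact/measurable_EFinP.
  apply: (@le_lt_trans _ _ (1%:E * I1 + (1^-1)%:E * I2)%E).
    apply: le_trans (It 1 ltr01); apply: ge0_le_integral_nm => x Dx //=.
    by rewrite lee_fin ger0_norm ?mulr_ge0// ler_peMl ?mulr_ge0// ler1n.
  by rewrite invr1 !mul1e lte_add_pinfty.
split=> //; rewrite -(fineK I1f) -(fineK I2f) -EFinM lee_fin.
apply: sqr_le_of_scaled_mean; [|exact: fine_ge0|exact: fine_ge0|].
  by apply: Rintegral_ge0 => x _; rewrite mulr_ge0.
move=> t t0; rewrite -RintegralZl//.
have := It t t0; rewrite -(fineK I1f) -(fineK I2f) -!EFinM -EFinD.
rewrite -[X in (X <= _)%E]fineK ?lee_fin//.
by have := integrable_fin_num mD (integrableRZ 2 mD vgi).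
Qed.

End CauchySchwarz.

(** * Absolutely continuous representatives of Sobolev functions *)

Section SobolevRepresentative.
Context {R : realType}.
Local Notation mu := (@lebesgue_measure R).
Variables (a b : R).
Hypothesis ab : a < b.
Implicit Types f g v V D : R -> R.
Local Notation Omega := (`]a, b[%classic : set (measurableTypeR R)).

Lemma L2_extension g : L2 a b g ->
  (forall x y, mu.-integrable `[x, y] (EFin \o (g \_ Omega))) /\
  mu.-integrable `[a, b] (EFin \o (fun x => (g \_ Omega) x ^+ 2)).
Proof.
move=> Lg; have gi := L2_integrable Lg; have [_ g2] := Lg.
split=> [x y|]; first exact: integrableS (integrable_patch (measurable_itv _) gi).
have : mu.-integrable `[a, b] (EFin \o ((fun x => g x ^+ 2) \_ Omega)).
  exact: integrableS (@integrable_patch _ _ (fun x => g x ^+ 2) (measurable_itv _) g2).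
apply: eq_integrable => // x _ /=; rewrite !patchE.
by case: ifP => // _; rewrite expr0n.
Qed.

(** [g] and [D] agree only almost everywhere, so the lemma can be iterated: the representative found
    for a derivative serves as [D] one order below. *)
Lemma weak_derivative_primitive f g D : weak_derivative a b f g ->
  (forall x y, mu.-integrable `[x, y] (EFin \o D)) ->
  {ae mu, forall x, x \in `]a, b[ -> g x = D x} ->
  exists F, primitive F D /\ {ae mu, forall x, x \in `]a, b[ -> f x = F x}.
Proof.
move=> wd Di gD; have [F0 pF0] := primitive_exists Di.
have [k fk] : exists k, {ae mu, forall x, x \in `]a, b[ -> f x = F0 x + k}.
  apply: (weak_derivative_ae ab wd) => x y ax xy yb; have [_ ->//] := pF0.
  have [_ lg _] := wd; have gi := locally_integrable_itv lg ax yb.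
  apply: ae_eq_Rintegral => //.
  - exact: integrable_measurable (Di x y).
  - exact: integrable_measurable gi.
  apply: ae_impl gD => t gt; rewrite /= in_itv/= => /andP[xt ty]; rewrite gt//.
  by rewrite in_itv/= (lt_le_trans ax xt) (le_lt_trans ty yb).
exists (fun x => F0 x + k); split=> //.
by split=> // x y xy; have [_ <-//] := pF0; ring.
Qed.

Lemma ge0_continuous V : continuous V ->
  {ae mu, forall x, x \in `]a, b[ -> 0 <= V x} -> forall x, a <= x <= b -> 0 <= V x.
Proof.
move=> cV V0; pose m x := Num.min 0 (V x).
have cm : continuous m.
  by move=> x; apply: (@continuous_min _ _ (fun=> 0) V); [exact: cst_continuous|exact: cV].
have mV x : m x = 0 -> 0 <= V x by move=> /eqP; rewrite eq_minl.
have mz : forall x, x \in `]a, b[ -> m x = 0.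
  apply: ae_eq0_continuous => //; apply: ae_impl V0 => x h /h V0.
  by rewrite /m min_l.
move=> x /andP[]; rewrite le_eqVlt => /predU1P[<- _|ax].
  by apply/mV/(cvg_at_right_itv (f := cst 0) ab _ cm); [move=> y /mz|exact: cvg_cst].
rewrite le_eqVlt => /predU1P[->|xb].
  by apply/mV/(cvg_at_left_itv (f := cst 0) ab _ cm); [move=> y /mz|exact: cvg_cst].
by apply/mV/mz; rewrite in_itv/= ax.
Qed.

(** The integer part of 2 s + 1 is 1 for s < 1/2 and 2 otherwise; this is the origin of the two
    regimes. In the second one [D] is itself absolutely continuous. *)
Lemma Sobolev_representative s v : 0 < s < 1 -> Sobolev a b (2 * s + 1) v ->
  {ae mu, forall x, x \in `]a, b[ -> 0 <= v x} ->
  exists V D, [/\ primitive V D, {ae mu, forall x, x \in `]a, b[ -> v x = V x},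
    forall x, a <= x <= b -> 0 <= V x,
    mu.-integrable `[a, b] (EFin \o (fun t => D t ^+ 2)) &
    s < 2^-1 \/ exists D', primitive D D'].
Proof.
move=> /andP[s0 s1] [Dv [D0 L2D wdD _]] v0.
suff [V [D [pV vV D2 hD]]] : exists V D, [/\ primitive V D,
    {ae mu, forall x, x \in `]a, b[ -> v x = V x},
    mu.-integrable `[a, b] (EFin \o (fun t => D t ^+ 2)) &
    s < 2^-1 \/ exists D', primitive D D'].
  exists V, D; split=> //; apply: ge0_continuous; first exact: primitive_continuous pV.
  by apply: ae_impl2 v0 vV => x h1 h2 xab; rewrite -h2// h1.
have ext g : {ae mu, forall x, x \in `]a, b[ -> g x = (g \_ Omega) x}.
  by apply: aeW => x xab; rewrite patchE mem_setE xab.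
have [s12|s12] := ltP s 2^-1.
  have m1 : Num.truncn (2 * s + 1) = 1%N.
    by apply: truncn_def; apply/andP; split; [|rewrite mulr2n]; lra.
  move: L2D wdD; rewrite m1 => L2D wdD.
  have [Di D2i] := L2_extension (L2D 1%N isT).
  have [V [pV vV]] := weak_derivative_primitive (wdD 0%N isT) Di (ext _).
  by exists V, (Dv 1%N \_ Omega); split=> //; [rewrite -D0|left].
have m2 : Num.truncn (2 * s + 1) = 2%N.
  by apply: truncn_def; apply/andP; split; lra.
move: L2D wdD; rewrite m2 => L2D wdD.
have [D2i _] := L2_extension (L2D 2%N isT).
have [D [pD DD]] := weak_derivative_primitive (wdD 1%N isT) D2i (ext _).
have cD := primitive_continuous pD.
have Di x y : mu.-integrable `[x, y] (EFin \o D) by exact: continuous_integrable.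
have [V [pV vV]] := weak_derivative_primitive (wdD 0%N isT) Di DD.
exists V, D; split=> //; [by rewrite -D0| |by right; exists (Dv 2%N \_ Omega)].
by apply: continuous_integrable; apply: ctsX.
Qed.

End SobolevRepresentative.

(* [/] and [^-1] on \bar R satisfy 0^-1 = +oo, and 0 * +oo = 0, so the first
   integrand is +oo where w = 0 < v and 0 where w = v = 0. *)
Theorem lemma3p1 (R : realType) (a b s : R) (hab : a < b) (hs : 0 < s < 1)
    (lambda : nat -> R) (phi : nat -> R -> R)
    (hphi : Neumann_eigensystem a b lambda phi)
    (w : R -> R) (hwm : measurable_fun `]a, b[%classic w)
    (hw : forall x, x \in `]a, b[ -> 0 <= w x)
    (v : R -> R) (hv : Sobolev a b (2 * s + 1) v)
    (hv0 : {ae (@lebesgue_measure R), forall x, x \in `]a, b[ -> 0 <= v x})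
    (p : R -> R) (hp : fractional_Laplacian a b lambda phi s v p)
    (g : R -> R) (hg : weak_derivative a b p g)
    (u : R -> R) (hu : fractional_Laplacian a b lambda phi (s / 2) v u) :
  (mul_absorbing
     (\int[@lebesgue_measure R]_(x in `]a, b[) ((v x ^+ 2)%:E / (w x)%:E))
     (\int[@lebesgue_measure R]_(x in `]a, b[) (w x * `|g x| ^+ 2)%:E)
   >= (1 / (4 * `|b - a| ^+ 2))%:E *
      (\int[@lebesgue_measure R]_(x in `]a, b[) (`|u x| ^+ 2)%:E) ^+ 2)%E.
Proof.
have tot := cosine_system_total hab hphi.
have [V [D [pV vV V0 D2i hD]]] := Sobolev_representative hab hs hv hv0.
pose mu := @lebesgue_measure R.
have cV := primitive_continuous pV.
have mI : measurable (`]a, b[%classic : set (measurableTypeR R)) by [].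
have Lv : L2 a b v by case: hv => Dv [<- L2D _ _]; exact: L2D.
have vi := L2_integrable Lv; have [mv _] := Lv.
have vVcos n : \int[mu]_(t in `]a, b[) (v t * cosn a b n t) =
    \int[mu]_(t in `]a, b[) (V t * cosn a b n t).
  have mc : measurable_fun (`]a, b[%classic : set (measurableTypeR R)) (cosn a b n).
    by apply: measurable_funTS; apply: continuous_measurable_fun; exact: continuous_cosn.
  apply: ae_eq_Rintegral => //; try exact: measurable_funM.
    apply: measurable_funM => //; apply: measurable_funTS.
    exact: continuous_measurable_fun.
  by apply: ae_impl vV => x h xab; rewrite h.
have pcos n : \int[mu]_(t in `]a, b[) (p t * cosn a b n t) =
    (freq a b n ^+ 2) `^ s * \int[mu]_(t in `]a, b[) (V t * cosn a b n t).
  by rewrite (fractional_Laplacian_cosn hab hphi vi hp) vVcos.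
have ucos n : \int[mu]_(t in `]a, b[) (u t * cosn a b n t) =
    (freq a b n ^+ 2) `^ (s / 2) * \int[mu]_(t in `]a, b[) (V t * cosn a b n t).
  by rewrite (fractional_Laplacian_cosn hab hphi vi hu) vVcos.
have [pint _] := hp; have [ui _] := hu.
have [u2i Vpi uE] := fractional_Laplacian_energy hab tot pV D2i hs hD pint pcos ui ucos.
have Dpi := fractional_Laplacian_integrableM hab tot pV D2i hs hD pint pcos.
have func := fractional_Laplacian_functional hab tot pV D2i hs hD pint pcos.
have comp := fractional_Laplacian_composition_le0 hab tot pV D2i hs hD pint pcos.
set I1 := (X in mul_absorbing X _); set I2 := (X in mul_absorbing _ X).
have L0 : 0 < b - a by rewrite subr_gt0.
(* An infinite factor makes the left-hand side +oo; from here on both integrals are finite. *)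
rewrite /mul_absorbing; case: ifPn => [_|/norP[I1y I2y]]; first exact: leey.
have mg : measurable_fun (`]a, b[%classic : set (measurableTypeR R)) g.
  by case: hg => _ [+ _ _] _.
have I1oo : (I1 < +oo)%E by rewrite ltey.
have I2oo : (I2 < +oo)%E by rewrite ltey.
have [vgi CS] := weighted_Cauchy_Schwarz mI mv hwm mg hw I1oo I2oo.
have vgE : {ae mu, forall x, `]a, b[%classic x -> `|v x| * `|g x| = V x * `|g x|}.
  apply: ae_impl vV => x h xab; rewrite h// ger0_norm// V0//.
  by move: xab; rewrite /= in_itv/= => /andP[? ?]; rewrite !ltW.
have mVg : measurable_fun (`]a, b[%classic : set (measurableTypeR R)) (fun x => V x * `|g x|).
  apply: measurable_funM; last exact: measurableT_comp.
  by apply: measurable_funTS; exact: continuous_measurable_fun.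
have Vgi := ae_eq_integrable mI mVg vgE vgi.
have := flux_bound hab pV V0 hg Dpi Vpi func comp Vgi.
rewrite -(ae_eq_Rintegral mI _ mVg vgE); last first.
  by apply: measurable_funM; exact: measurableT_comp.
rewrite -uE.
set A := Rintegral _ _ _; set M := Rintegral _ _ _ => AM.
have A0 : 0 <= A by apply: Rintegral_ge0 => x _; exact: sqr_ge0.
(* What remains is A^2 / (4 L^2) <= M^2, the square of A <= 2 L M. *)
apply: le_trans CS.
have -> : (\int[lebesgue_measure]_(x in `]a, b[) (`|u x| ^+ 2)%:E = A%:E)%E.
  rewrite /A /Rintegral fineK; last exact: integrable_fin_num.
  by apply: eq_integral => x _; rewrite real_normK ?num_real.
rewrite -EFin_expe -EFinM lee_fin -/M.
rewrite mul1r mulrC ler_pdivrMr; last by rewrite mulr_gt0// exprn_gt0// normr_gt0 gt_eqF.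
rewrite gtr0_norm//.
have -> : M ^+ 2 * (4 * (b - a) ^+ 2) = (2 * (b - a) * M) ^+ 2 by ring.
by rewrite lerXn2r// nnegrE ?(le_trans A0 AM).
Qed.
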